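(* Let $\Delta^L=\langle p_1,p_2,p_3\rangle$ and $\Delta^R=\langle p_1,p_2,p_4\rangle$ be nondegenerate triangles with disjoint interiors sharing the edge $[p_1,p_2]$, and write $p_4=\eta_1p_1+\eta_2p_2+\eta_3p_3$ with $\eta_1+\eta_2+\eta_3=1$. Let $s^L=\sum_{i=1}^{28}b^L_iB^L_i$ on $\Delta^L$ and $s^R=\sum_{i=1}^{28}b^R_iB^R_i$ on $\Delta^R$. Then: (i) $s^L$ and $s^R$ join continuously across $[p_1,p_2]$ if and only if $b^R_i=b^L_i$ for $i=1,2,4,7,10,13$; (ii) $s^L$ and $s^R$ join $C^1$ across $[p_1,p_2]$ if and only if they join continuously and $b^R_5=\eta_1b^L_1+\eta_2b^L_4+\eta_3b^L_5$, $b^R_{16}=(\eta_1+\tfrac{\eta_2}2)b^L_4+\tfrac{\eta_2}2b^L_{10}+\eta_3b^L_{16}$, $b^R_{19}=(\tfrac35\eta_1+\tfrac25\eta_2)b^L_{10}+(\tfrac25\eta_1+\tfrac35\eta_2)b^L_{13}+\eta_3b^L_{19}$, $b^R_{17}=(\tfrac{\eta_1}2+\eta_2)b^L_7+\tfrac{\eta_1}2b^L_{13}+\eta_3b^L_{17}$, $b^R_6=\eta_1b^L_7+\eta_2b^L_2+\eta_3b^L_6$.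
   Context: For a nondegenerate triangle $\Delta=\langle v_1,v_2,v_3\rangle$ with ordered vertices and area $|\Delta|$, define $v_{1,2}=\tfrac23v_2+\tfrac13v_3$, $v_{1,3}=\tfrac13v_2+\tfrac23v_3$, $v_{2,1}=\tfrac23v_1+\tfrac13v_3$, $v_{2,3}=\tfrac13v_1+\tfrac23v_3$, $v_{3,1}=\tfrac23v_1+\tfrac13v_2$, $v_{3,2}=\tfrac13v_1+\tfrac23v_2$. Simplex splines: for a multiset $\Xi=\{\xi_1,\dots,\xi_6\}\subset\mathbb R^2$ with convex hull of positive area, choose any simplex $\sigma\subset\mathbb R^5$ of positive volume whose vertices project (onto the first two coordinates, $\pi$) to the $\xi_i$, and set $M_\Xi(x)=\mathrm{vol}_3(\sigma\cap\pi^{-1}(x))/\mathrm{vol}_5(\sigma)$. The local basis of $\Delta$ is $B_i=w_iM_{\Xi_i}$ (on $\Delta$, boundary values by continuity from the interior), with $\Xi_1=\{v_1^{(4)},v_{3,1},v_{2,1}\}$, $\Xi_2=\{v_2^{(4)},v_{3,2},v_{1,2}\}$, $\Xi_3=\{v_3^{(4)},v_{1,3},v_{2,3}\}$, $\Xi_4=\{v_1^{(3)},v_{3,1},v_{3,2},v_{2,1}\}$, $\Xi_5=\{v_1^{(3)},v_{2,1},v_{2,3},v_{3,1}\}$, $\Xi_6=\{v_2^{(3)},v_{1,2},v_{1,3},v_{3,2}\}$, $\Xi_7=\{v_2^{(3)},v_{3,2},v_{3,1},v_{1,2}\}$, $\Xi_8=\{v_3^{(3)},v_{2,3},v_{2,1},v_{1,3}\}$,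 $\Xi_9=\{v_3^{(3)},v_{1,3},v_{1,2},v_{2,3}\}$, $\Xi_{10}=\{v_1^{(2)},v_{3,1},v_{3,2},v_2,v_{2,1}\}$, $\Xi_{11}=\{v_1^{(2)},v_{2,1},v_{2,3},v_3,v_{3,1}\}$, $\Xi_{12}=\{v_2^{(2)},v_{1,2},v_{1,3},v_3,v_{3,2}\}$, $\Xi_{13}=\{v_2^{(2)},v_{3,2},v_{3,1},v_1,v_{1,2}\}$, $\Xi_{14}=\{v_3^{(2)},v_{2,3},v_{2,1},v_1,v_{1,3}\}$, $\Xi_{15}=\{v_3^{(2)},v_{1,3},v_{1,2},v_2,v_{2,3}\}$, $\Xi_{16}=\{v_1^{(2)},v_{3,1},v_{3,2},v_{2,1},v_{2,3}\}$, $\Xi_{17}=\{v_2^{(2)},v_{3,2},v_{3,1},v_{1,2},v_{1,3}\}$, $\Xi_{18}=\{v_3^{(2)},v_{1,3},v_{1,2},v_{2,3},v_{2,1}\}$, $\Xi_{19}=\{v_1,v_2,v_{3,1},v_{3,2},v_{2,1},v_{1,2}\}$, $\Xi_{20}=\{v_2,v_3,v_{1,2},v_{1,3},v_{3,2},v_{2,3}\}$, $\Xi_{21}=\{v_3,v_1,v_{2,3},v_{2,1},v_{1,3},v_{3,1}\}$, $\Xi_{22}=\{v_1,v_{3,1},v_{3,2},v_{1,2},v_{2,3},v_{2,1}\}$, $\Xi_{23}=\{v_1,v_{2,1},v_{2,3},v_{1,3},v_{3,2},v_{3,1}\}$, $\Xi_{24}=\{v_2,v_{1,2},v_{1,3},v_{2,3},v_{3,1},v_{3,2}\}$,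 $\Xi_{25}=\{v_2,v_{3,1},v_{3,2},v_{1,2},v_{1,3},v_{2,1}\}$, $\Xi_{26}=\{v_3,v_{2,3},v_{2,1},v_{3,1},v_{1,2},v_{1,3}\}$, $\Xi_{27}=\{v_3,v_{1,2},v_{1,3},v_{2,3},v_{2,1},v_{3,2}\}$, $\Xi_{28}=\{v_{3,1},v_{3,2},v_{1,2},v_{1,3},v_{2,3},v_{2,1}\}$ (superscript $(m)$ = multiplicity $m$), and $w_i=\frac{|\Delta|}{15}c_i$, $c=(\tfrac16^{\times3},\tfrac13^{\times6},\tfrac12^{\times6},\tfrac23^{\times3},\tfrac56^{\times3},\tfrac23^{\times6},1)$. $B^L_i$ denotes this basis for $\Delta^L$ with $(v_1,v_2,v_3)=(p_1,p_2,p_3)$, and $B^R_i$ the basis for $\Delta^R$ with $(v_1,v_2,v_3)=(p_1,p_2,p_4)$. *)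

(* Defs.v *)
From HB Require Import structures.
From mathcomp Require Import all_boot all_order all_algebra.
From mathcomp Require Import all_classical all_reals all_analysis.
Import Order.TTheory GRing.Theory Num.Theory.
Import numFieldNormedType.Exports.
Local Open Scope classical_set_scope.
Local Open Scope ring_scope.

Section PS12.
Context {R : realType}.

(** Points of the plane R^2 and of R^3; R^5 is identified with R^2 x R^3,
    the projection pi onto the first two coordinates being [fst]. *)
Definition pt := (R * R)%type.
Definition R3 := ((R * R) * R)%type.

Definition leb1 := (@lebesgue_measure R).
Definition leb2 := (leb1 \x leb1)%E.
Definition leb3 := (leb2 \x leb1)%E.
Definition leb5 := (leb2 \x leb3)%E.

Definition vol3 (A : set R3) : \bar R := leb3 A.
Definition vol5 (A : set (pt * R3)) : \bar R := leb5 A.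

Definition padd (u v : pt) : pt := (u.1 + v.1, u.2 + v.2).
Definition pscale (a : R) (u : pt) : pt := (a * u.1, a * u.2).
Definition comb2 (a : R) (u : pt) (b : R) (v : pt) : pt :=
  padd (pscale a u) (pscale b v).
Definition comb3 (a : R) (u : pt) (b : R) (v : pt) (c : R) (w : pt) : pt :=
  padd (comb2 a u b v) (pscale c w).

Definition hull6 (xi : 'I_6 -> pt) (y : {ffun 'I_6 -> R3}) : set (pt * R3) :=
  [set w | exists lam : 'I_6 -> R,
      (forall i, 0 <= lam i) /\ \sum_(i < 6) lam i = 1 /\
      w.1 = (\sum_(i < 6) lam i * (xi i).1, \sum_(i < 6) lam i * (xi i).2) /\
      w.2 = ((\sum_(i < 6) lam i * (y i).1.1, \sum_(i < 6) lam i * (y i).1.2),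
             \sum_(i < 6) lam i * (y i).2)].

Definition admissible_lift (xi : 'I_6 -> pt) (y : {ffun 'I_6 -> R3}) : Prop :=
  (0 < vol5 (hull6 xi y))%E.

Definition lift0 : {ffun 'I_6 -> R3} := [ffun => ((0, 0), 0)].

(** the chosen admissible simplex (the value of M does not depend on it) *)
Definition the_lift (xi : 'I_6 -> pt) : {ffun 'I_6 -> R3} :=
  xget lift0 (admissible_lift xi).

Definition slice (xi : 'I_6 -> pt) (y : {ffun 'I_6 -> R3}) (x : pt) : set R3 :=
  [set z | hull6 xi y (x, z)].

Definition simplex_spline (xi : 'I_6 -> pt) (x : pt) : R :=
  fine (vol3 (slice xi (the_lift xi) x)) / fine (vol5 (hull6 xi (the_lift xi))).

Definition knots (s : seq pt) : 'I_6 -> pt := fun i => nth (0, 0) s i.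

Definition tri_area (v1 v2 v3 : pt) : R :=
  `|(v2.1 - v1.1) * (v3.2 - v1.2) - (v3.1 - v1.1) * (v2.2 - v1.2)| / 2.

Definition tri (v1 v2 v3 : pt) : set pt :=
  [set x | exists a b c : R, 0 <= a /\ 0 <= b /\ 0 <= c /\ a + b + c = 1 /\
                             x = comb3 a v1 b v2 c v3].
Definition otri (v1 v2 v3 : pt) : set pt :=
  [set x | exists a b c : R, 0 < a /\ 0 < b /\ 0 < c /\ a + b + c = 1 /\
                             x = comb3 a v1 b v2 c v3].

Definition segment (p q : pt) : set pt :=
  [set x | exists t : R, 0 <= t <= 1 /\ x = comb2 (1 - t) p t q].
Definition osegment (p q : pt) : set pt :=
  [set x | exists t : R, 0 < t < 1 /\ x = comb2 (1 - t) p t q].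

Definition Xi (v1 v2 v3 : pt) (i : nat) : seq pt :=
  let v12 := comb2 (2/3) v2 (1/3) v3 in
  let v13 := comb2 (1/3) v2 (2/3) v3 in
  let v21 := comb2 (2/3) v1 (1/3) v3 in
  let v23 := comb2 (1/3) v1 (2/3) v3 in
  let v31 := comb2 (2/3) v1 (1/3) v2 in
  let v32 := comb2 (1/3) v1 (2/3) v2 in
  match i with
  | 1 => [:: v1; v1; v1; v1; v31; v21]
  | 2 => [:: v2; v2; v2; v2; v32; v12]
  | 3 => [:: v3; v3; v3; v3; v13; v23]
  | 4 => [:: v1; v1; v1; v31; v32; v21]
  | 5 => [:: v1; v1; v1; v21; v23; v31]
  | 6 => [:: v2; v2; v2; v12; v13; v32]
  | 7 => [:: v2; v2; v2; v32; v31; v12]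
  | 8 => [:: v3; v3; v3; v23; v21; v13]
  | 9 => [:: v3; v3; v3; v13; v12; v23]
  | 10 => [:: v1; v1; v31; v32; v2; v21]
  | 11 => [:: v1; v1; v21; v23; v3; v31]
  | 12 => [:: v2; v2; v12; v13; v3; v32]
  | 13 => [:: v2; v2; v32; v31; v1; v12]
  | 14 => [:: v3; v3; v23; v21; v1; v13]
  | 15 => [:: v3; v3; v13; v12; v2; v23]
  | 16 => [:: v1; v1; v31; v32; v21; v23]
  | 17 => [:: v2; v2; v32; v31; v12; v13]
  | 18 => [:: v3; v3; v13; v12; v23; v21]
  | 19 => [:: v1; v2; v31; v32; v21; v12]
  | 20 => [:: v2; v3; v12; v13; v32; v23]
  | 21 => [:: v3; v1; v23; v21; v13; v31]
  | 22 => [:: v1; v31; v32; v12; v23; v21]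
  | 23 => [:: v1; v21; v23; v13; v32; v31]
  | 24 => [:: v2; v12; v13; v23; v31; v32]
  | 25 => [:: v2; v31; v32; v12; v13; v21]
  | 26 => [:: v3; v23; v21; v31; v12; v13]
  | 27 => [:: v3; v12; v13; v23; v21; v32]
  | _ => [:: v31; v32; v12; v13; v23; v21]
  end.

Definition cw (i : nat) : R :=
  if (i <= 3)%N then 1/6
  else if (i <= 9)%N then 1/3
  else if (i <= 15)%N then 1/2
  else if (i <= 18)%N then 2/3
  else if (i <= 21)%N then 5/6
  else if (i <= 27)%N then 2/3
  else 1.

Definition wgt (v1 v2 v3 : pt) (i : nat) : R := tri_area v1 v2 v3 / 15 * cw i.

Definition Bfun (v1 v2 v3 : pt) (i : nat) (x : pt) : R :=
  let f := fun z => wgt v1 v2 v3 i * simplex_spline (knots (Xi v1 v2 v3 i)) z in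
  if x \in otri v1 v2 v3 then f x
  else lim (f z @[z --> within (otri v1 v2 v3) (nbhs x)]).

Definition spline (v1 v2 v3 : pt) (b : nat -> R) (x : pt) : R :=
  \sum_(1 <= i < 29) b i * Bfun v1 v2 v3 i x.

Definition C1_on (f : pt -> R) (U : set pt) : Prop :=
  forall z, U z ->
    forall v : pt, v = (1, 0) \/ v = (0, 1) ->
      derivable f z v /\ {for z, continuous (fun w => 'D_v f w)}.

Definition join_C0 (sL sR : pt -> R) (p1 p2 : pt) : Prop :=
  forall x, segment p1 p2 x -> sL x = sR x.

Definition glue (sL sR : pt -> R) (p1 p2 p3 : pt) (x : pt) : R :=
  if x \in tri p1 p2 p3 then sL x else sR x.

Definition join_C1 (sL sR : pt -> R) (p1 p2 p3 p4 : pt) : Prop :=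
  join_C0 sL sR p1 p2 /\
  exists U : set pt, open U /\ U `<=` tri p1 p2 p3 `|` tri p1 p2 p4 /\
    osegment p1 p2 `<=` U /\ C1_on (glue sL sR p1 p2 p3) U.

End PS12.

(* Main.v *)
Require Import Defs.
From HB Require Import structures.
From mathcomp Require Import all_boot all_order all_algebra.
From mathcomp Require Import all_classical all_reals all_analysis.
From mathcomp Require Import measurable_realfun ring lra.
Import Order.TTheory GRing.Theory Num.Theory.
Import numFieldNormedType.Exports.
Local Open Scope classical_set_scope.
Local Open Scope ring_scope.

(* Writing a slice of the lifted simplex in the weights of three of the six knots
   shows that a simplex spline is, up to a constant, the volume of a polyhedron
   in R^3; for the constant, the scaling of volume under a linear map only has to
   be known to exist (uniqueness of Haar measure). By affine invariance the basis
   is computed once, in a reference triangle with barycentric coordinates X, where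
   nested integration yields, near the edge X3 = 0, sums of cubes of truncated
   linear forms. On the edge only the functions 1, 2, 4, 7, 10, 13 are nonzero,
   and they are linearly independent there: this is (i). Both splines extend to
   C^1 functions across the edge, so they join C^1 iff the gradients of these
   extensions agree on the edge. Given (i), the jump of the gradient is a multiple
   of a combination of the transversal derivatives of the functions 5, 16, 19, 17,
   6, which are linearly independent; its coefficients are the defects of the five
   equations in (ii). *)

Set Implicit Arguments.
Unset Strict Implicit.

(** * Affine changes of variables for Lebesgue measure *)

(** On the edge the basis functions restrict to $C^2$ piecewise cubics and their first derivatives
    to $C^1$ piecewise quadratics, with interior breaks only at the two trisection points. These
    spaces have dimensions 4+2=6 and 3+2=5, so the independent families of six and of five functions
    are bases; hence six equations in (i) and five more in (ii). The domains of validity of the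
    closed forms shape the proof. A formula holds only while the cell keeps its shape, in general in
    a wedge along the edge that pinches at both ends. Gradients matter on the open edge only, but
    continuity concerns the closed segment, where values are limits from the interior. So the six
    functions that live on the edge are computed in the whole triangle, and the others are squeezed
    between 0 and a multiple of X3. In every knot multiset a triple of the same area is singled out,
    so one positive factor [scale] serves all basis functions of both triangles and divides out. *)

Lemma leb1_affine (R : realType) (A : set R) (b g : R) : b != 0 ->
  measurable (A : set (measurableTypeR R)) ->
  (`|b|%:E * lebesgue_measure [set x | A (b * x + g)%R] = lebesgue_measure A)%E.
Proof.
move=> b0 mA.
have bp : 0 < `|b| by rewrite normr_gt0.
pose f : measurableTypeR R -> measurableTypeR R := fun x : R => (b * x + g)%R.
have mf : measurable_fun setT f by apply: measurable_funD => //; exact: measurable_funM.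
have [m2 m2E] : exists m2 : {measure set (measurableTypeR R) -> \bar R},
    forall B, m2 B = lebesgue_measure (f @^-1` B).
  unshelve refine (ex_intro _ (pushforward lebesgue_measure f : {measure set _ -> \bar R}) _) => //.
transitivity (mscale (NngNum (ltW bp)) m2 A); first by rewrite /mscale/= m2E.
(* The scaled pushforward is a measure, so it suffices to compare lengths of half-open intervals. A
   negative slope turns []u, v]] into an interval closed on the left, of the same length. *)
apply/esym/lebesgue_measure_unique => //= _ [[u v]] _ <-/=.
rewrite /mscale/= m2E.
have [bp0|bn0] := ltrP 0 b.
  have -> : f @^-1` `]u, v] = `](u - g) / b, (v - g) / b]%classic.
    apply/seteqP; split=> x /=; rewrite !in_itv/= /f ltr_pdivrMr// ler_pdivlMr//;
    by move=> /andP[h1 h2]; apply/andP; split; lra.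
  rewrite !lebesgue_measure_itv/= !lte_fin.
  have -> : ((u - g) / b < (v - g) / b) = (u < v).
    by rewrite ltr_pM2r ?invr_gt0// ltrD2r.
  case: ifP => _; last by rewrite mule0.
  by rewrite gtr0_norm// -!EFinD -EFinM; congr (_%:E); field.
have {}bn0 : b < 0 by rewrite lt_neqAle b0.
have -> : f @^-1` `]u, v] = `[(v - g) / b, (u - g) / b[%classic.
  apply/seteqP; split=> x /=; rewrite !in_itv/= /f ler_ndivrMr// ltr_ndivlMr//;
  by move=> /andP[h1 h2]; apply/andP; split; lra.
rewrite !lebesgue_measure_itv/= !lte_fin.
have -> : ((v - g) / b < (u - g) / b) = (u < v).
  by rewrite ltr_nM2r ?invr_lt0// ltrD2r.
case: ifP => _; last by rewrite mule0.
by rewrite ltr0_norm// -!EFinD -EFinM; congr (_%:E); field.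
Qed.

(** * Products of sigma-finite measures *)

Section SigmaFiniteProduct.
Local Open Scope ereal_scope.
Context d1 d2 (T1 : measurableType d1) (T2 : measurableType d2) (R : realType).
Variable m1 : {sigma_finite_measure set T1 -> \bar R}.
Variable m2 : {sigma_finite_measure set T2 -> \bar R}.

(* An alias: the library's sigma-finite structure on [\x] is the one for
   products of subprobabilities, which does not apply to Lebesgue measure. *)
Definition pm : set (T1 * T2) -> \bar R := m1 \x m2.

HB.instance Definition _ := Measure.copy pm (m1 \x m2).

Lemma pm_sigma_finite : sigma_finite setT pm.
Proof.
have /sigma_finiteP[F [FT Fnd Ffin]] := sigma_finiteT m1.
have /sigma_finiteP[G [GT Gnd Gfin]] := sigma_finiteT m2.
(* One index suffices for both factors because [F] and [G] are increasing: a point of [F n] and a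
   point of [G k] meet at [maxn n k]. *)
exists (fun n => F n `*` G n) => [|k].
  apply/esym/seteqP; split => // -[x y] _.
  have [n _ Fnx] : (\bigcup_k F k) x by rewrite -FT.
  have [k _ Gky] : (\bigcup_k G k) y by rewrite -GT.
  exists (maxn n k) => //; split => /=.
    by move/subsetPset: (Fnd _ _ (leq_maxl n k)); apply.
  by move/subsetPset: (Gnd _ _ (leq_maxr n k)); apply.
have [[? ?] [? ?]] := (Ffin k, Gfin k); split; first exact: measurableX.
by rewrite /pm product_measure1E// lte_mul_pinfty// ge0_fin_numE.
Qed.

HB.instance Definition _ := Measure_isSigmaFinite.Build _ _ _ pm pm_sigma_finite.

Lemma pm_xE (A : set (T1 * T2)) :
  pm A = \int[m1]_x m2 [set y | A (x, y)].
Proof. by apply: eq_integral => x _ /=; rewrite xsectionE. Qed.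

Lemma pm_yE (A : set (T1 * T2)) : measurable A ->
  pm A = \int[m2]_y m1 [set x | A (x, y)].
Proof.
move=> mA; transitivity ((m1 \x^ m2) A).
  rewrite /pm; by apply: product_measure_unique => // B C mB mC /=; rewrite product_measure2E.
by apply: eq_integral => x _ /=; rewrite ysectionE.
Qed.

Lemma pm_setX (A : set T1) (B : set T2) : measurable A -> measurable B ->
  pm (A `*` B) = m1 A * m2 B.
Proof. by move=> mA mB; rewrite /pm product_measure1E. Qed.

Lemma measurable_fun_xsec (A : set (T1 * T2)) : measurable A ->
  measurable_fun setT (fun x => m2 [set y | A (x, y)]).
Proof.
move=> mA; rewrite (_ : (fun _ => _) = m2 \o xsection A).
  exact: measurable_fun_xsection.
by apply/funext => x /=; rewrite xsectionE.
Qed.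

Lemma measurable_fun_ysec (A : set (T1 * T2)) : measurable A ->
  measurable_fun setT (fun y => m1 [set x | A (x, y)]).
Proof.
move=> mA; rewrite (_ : (fun _ => _) = m1 \o ysection A).
  exact: measurable_fun_ysection.
by apply/funext => x /=; rewrite ysectionE.
Qed.

Lemma pm_fubini (f : T1 * T2 -> \bar R) : measurable_fun setT f ->
  (forall x, 0 <= f x) -> \int[pm]_z f z = \int[m1]_x \int[m2]_y f (x, y).
Proof. exact: fubini_tonelli1. Qed.

End SigmaFiniteProduct.

Lemma measurable_xsec d1 d2 (T1 : measurableType d1) (T2 : measurableType d2)
  (A : set (T1 * T2)) x : measurable A -> measurable [set y | A (x, y)].
Proof. by move=> /(measurable_xsection x); rewrite xsectionE. Qed.

Lemma measurable_ysec d1 d2 (T1 : measurableType d1) (T2 : measurableType d2)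
  (A : set (T1 * T2)) y : measurable A -> measurable [set x | A (x, y)].
Proof. by move=> /(measurable_ysection y); rewrite ysectionE. Qed.

Lemma measurable_comp_set d1 d2 (T1 : measurableType d1) (T2 : measurableType d2)
  (f : T1 -> T2) (A : set T2) : measurable_fun setT f -> measurable A ->
  measurable [set x | A (f x)].
Proof. by move=> mf mA; rewrite -[X in measurable X]setTI; exact: mf. Qed.

Local Notation M1 R := (measurableTypeR R).
Local Notation M2 R := (M1 R * M1 R)%type.
Local Notation M3 R := (M2 R * M1 R)%type.
Local Notation L1 := lebesgue_measure.
Local Notation L2 := (pm L1 L1).
Local Notation L3 := (pm L2 L1).
Local Notation L5 := (pm L2 L3).

Lemma vol3E (R : realType) (A : set (@R3 R)) : vol3 A = L3 A.
Proof. by []. Qed.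

Lemma vol5E (R : realType) (A : set (@pt R * @R3 R)) : vol5 A = L5 A.
Proof. by []. Qed.

(* Otherwise closing tactics try to compare measures by unfolding them. *)
Opaque pm.

Section Affine2.
Context (R : realType).
Implicit Types (A : set (M2 R)).

Lemma measurable_affine d (T : measurableType d) (f g : T -> M1 R) (a b c : R) :
  measurable_fun setT f -> measurable_fun setT g ->
  measurable_fun setT (fun x => (a * f x + b * g x + c : R)%R : M1 R).
Proof.
move=> mf mg; apply: measurable_funD => //.
by apply: measurable_funD; apply: measurable_funM.
Qed.

Lemma leb2_fib2 A (b a c : R) : b != 0 -> measurable A ->
  (`|b|%:E * L2 [set x : M2 R | A (x.1, a * x.1 + b * x.2 + c)%R] = L2 A)%E.
Proof.
move=> b0 mA.
rewrite !pm_xE -ge0_integralZl//; last first.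
  apply: (@measurable_fun_xsec _ _ _ _ _ _ [set x : M2 R | A (x.1, a * x.1 + b * x.2 + c)%R]).
  apply: measurable_comp_set mA; apply: measurable_fun_pair => //.
  exact: measurable_affine.
apply: eq_integral => x _ /=.
rewrite -(@leb1_affine _ [set y | A (x, y)] b (a * x + c) b0); last exact: measurable_xsec.
by congr (_ * L1 _)%E; apply/seteqP; split => y /=; rewrite addrCA addrA.
Qed.

Lemma measurable_swap2 d1 d2 (T1 : measurableType d1) (T2 : measurableType d2)
  (A : set (T1 * T2)) : measurable A -> measurable [set x | A (x.2, x.1)].
Proof. by apply: measurable_comp_set; apply: measurable_fun_pair. Qed.

Lemma leb2_swap A : measurable A -> (L2 [set x : M2 R | A (x.2, x.1)] = L2 A)%E.
Proof.
move=> mA; rewrite [RHS]pm_yE// pm_xE.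
exact: eq_integral.
Qed.

Lemma leb2_fib1 A (b a c : R) : b != 0 -> measurable A ->
  (`|b|%:E * L2 [set x : M2 R | A (b * x.1 + a * x.2 + c, x.2)%R] = L2 A)%E.
Proof.
move=> b0 mA; rewrite -(leb2_swap mA).
rewrite -(@leb2_fib2 [set x | A (x.2, x.1)] b a c b0); last exact: measurable_swap2.
congr (_ * _)%E; rewrite -leb2_swap; last first.
  apply: measurable_comp_set mA; apply: measurable_fun_pair => //.
  exact: measurable_affine.
congr (L2 _); apply/seteqP; split => -[x y] /=; by rewrite (addrC (b * y)).
Qed.

(** Gaussian elimination with pivot [a]: the map is composed of changes of one coordinate at a time,
    with factors [a] and [d - c * b / a]. If [a] is zero, exchanging the coordinates makes [b] the
    pivot. *)
Lemma leb2_affine A (a b c d e f : R) : a * d - b * c != 0 -> measurable A ->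
  (`|a * d - b * c|%:E *
    L2 [set x : M2 R | A (a * x.1 + b * x.2 + e, c * x.1 + d * x.2 + f)%R] = L2 A)%E.
Proof.
wlog a0 : a b c d / a != 0.
  move=> H D0 mA; have [az|] := eqVneq a 0; last by move=> a0; exact: H.
  have b0 : b != 0 by apply: contraNneq D0 => b0; rewrite az b0 !mul0r subrr.
  rewrite -(H b a d c) //; last by rewrite -oppr_eq0 opprB.
  rewrite -normrN opprB; congr (_ * _)%E; rewrite -leb2_swap; last first.
    apply: measurable_comp_set mA; apply: measurable_fun_pair => //;
    exact: measurable_affine.
  by congr (L2 _); apply/seteqP; split => -[x y] /=; rewrite (addrC (a * y)) (addrC (c * y)).
move=> D0 mA.
have D1 : d - c * b / a != 0.
  apply: contraNneq D0 => h; rewrite (_ : a * d - b * c = a * (d - c * b / a)); first by rewrite h mulr0.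
  by field.
rewrite -(@leb2_fib2 A (d - c * b / a) (c / a) (f - c / a * e) D1 mA).
rewrite -(@leb2_fib1 [set x : M2 R | A (x.1, c / a * x.1 + (d - c * b / a) * x.2 +
   (f - c / a * e))%R] a b e a0); last first.
  apply: measurable_comp_set mA; apply: measurable_fun_pair => //.
  exact: measurable_affine.
rewrite muleA -EFinM -normrM; congr (`|_|%:E * L2 _)%E; first by field.
apply/seteqP; split => -[x y] /=; set u := (X in A (_, X)); set v := (X in _ -> A (_, X));
 (suff -> : u = v by []); rewrite /u /v /=.
  by field.
by field.
Qed.

End Affine2.

Definition sub3 (R : realType) (z w : M3 R) : M3 R :=
  ((z.1.1 - w.1.1, z.1.2 - w.1.2), z.2 - w.2)%R.

Section Affine3.
Context (R : realType).
Implicit Types (A B : set (M3 R)).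

Lemma measurable_fun_pair3 d (T : measurableType d) (f g h : T -> M1 R) :
  measurable_fun setT f -> measurable_fun setT g -> measurable_fun setT h ->
  measurable_fun setT (fun x => ((f x, g x), h x) : M3 R).
Proof. by move=> mf mg mh; do 2 (apply: measurable_fun_pair => //). Qed.

Lemma measurable_11 : measurable_fun setT (fun x : M3 R => x.1.1).
Proof. exact: (measurableT_comp measurable_fst measurable_fst). Qed.
Lemma measurable_12 : measurable_fun setT (fun x : M3 R => x.1.2).
Proof. exact: (measurableT_comp measurable_snd measurable_fst). Qed.

Lemma measurable_scale_shift d (T : measurableType d) (f : T -> M1 R) (s v : R) :
  measurable_fun setT f -> measurable_fun setT (fun x => s * f x + v : R)%R.
Proof. by move=> mf; apply: measurable_funD => //; apply: measurable_funM. Qed.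

(** The cases [s = 1] and [s = -1] give translations and point reflections, the two invariances
    behind the Haar argument. *)
Lemma leb3_diag A (s : R) (v : M3 R) : `|s| = 1 -> measurable A ->
  (L3 [set z : M3 R | A ((s * z.1.1 + v.1.1, s * z.1.2 + v.1.2), s * z.2 + v.2)%R] = L3 A)%E.
Proof.
move=> s1 mA.
have s0 : s != 0 by rewrite -normr_eq0 s1 oner_eq0.
transitivity (L3 [set z : M3 R | A (z.1, s * z.2 + v.2)%R]).
  rewrite !pm_yE; last 2 first.
    apply: measurable_comp_set mA; apply: measurable_fun_pair => //.
    exact: measurable_scale_shift.
    apply: measurable_comp_set mA; apply: measurable_fun_pair3;
    apply: measurable_scale_shift => //; [exact: measurable_11|exact: measurable_12].
  apply: eq_integral => y _ /=.
  have mAy : measurable [set x | A (x, s * y + v.2)%R] by exact: measurable_ysec.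
  rewrite -[RHS](@leb2_affine _ _ s 0 0 s v.1.1 v.1.2 _ mAy); last first.
    by rewrite mulr0 subr0 mulf_neq0.
  rewrite mulr0 subr0 normrM s1 mulr1 mul1e.
  by congr (L2 _); apply/seteqP; split => -[x x'] /=; rewrite !mul0r addr0 add0r.
rewrite !pm_xE; apply: eq_integral => x _ /=.
have mAx : measurable [set y | A (x, y)] by exact: measurable_xsec.
by rewrite -(leb1_affine v.2 s0 mAx) s1 mul1e.
Qed.

Lemma leb3_shift A (w : M3 R) : measurable A ->
  (L3 [set z : M3 R | A (sub3 z w)] = L3 A)%E.
Proof.
move=> mA.
apply: etrans (@leb3_diag A 1 ((- w.1.1, - w.1.2), - w.2)%R (normr1 _) mA).
by congr (L3 _); apply/seteqP; split => z /=; rewrite !mul1r.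
Qed.

Lemma leb3_refl A (w : M3 R) : measurable A ->
  (L3 [set z : M3 R | A (sub3 w z)] = L3 A)%E.
Proof.
move=> mA; apply: etrans (@leb3_diag A (-1) w (normrN1 _) mA).
by congr (L3 _); apply/seteqP; split => z /=; rewrite !mulN1r /sub3 !(addrC (- _)).
Qed.

Lemma measurable_sub3 d (T : measurableType d) (f g : T -> M3 R) :
  measurable_fun setT f -> measurable_fun setT g ->
  measurable_fun setT (fun x => sub3 (f x) (g x)).
Proof.
move=> mf mg; apply: measurable_fun_pair3; apply: measurable_funB;
 by [exact: (measurableT_comp measurable_11)|exact: (measurableT_comp measurable_12)|exact: measurableT_comp].
Qed.

(* Uniqueness of Haar measure, by computing in two ways the measure of the
   set of (z, t) such that psi z - t is in A and t is in B. *)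
Lemma leb3_haar (psi phi : M3 R -> M3 R) A B :
  measurable_fun setT psi ->
  (forall z t, psi (sub3 z (phi t)) = sub3 (psi z) t) ->
  measurable A -> measurable B ->
  (L3 [set z | A (psi z)] * L3 B = L3 A * L3 [set z | B (psi z)])%E.
Proof.
move=> mpsi psiE mA mB.
have key C D : measurable C -> measurable D ->
    (pm L3 L3 [set x : M3 R * M3 R | D x.2 /\ C (sub3 (psi x.1) x.2)]
     = L3 [set z | C (psi z)] * L3 D)%E.
  move=> mC mD.
  have mCp : measurable [set z | C (psi z)] by exact: measurable_comp_set mC.
  have mS : measurable [set x : M3 R * M3 R | D x.2 /\ C (sub3 (psi x.1) x.2)].
    apply: measurableI; first exact: (measurable_comp_set measurable_snd).
    apply: measurable_comp_set mC; apply: measurable_sub3 => //.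
    exact: measurableT_comp.
  rewrite pm_yE//.
  rewrite (eq_integral (fun t => L3 [set z | C (psi z)] * (\1_D t)%:E)%E); last first.
    move=> t _ /=; rewrite indicE; have [/set_mem Dt|/negP Dt] := boolP (t \in D).
      rewrite mule1; apply: etrans _ (leb3_shift (phi t) mCp).
      by congr (L3 _); apply/seteqP; split => z /=; rewrite psiE => // -[].
    rewrite mule0 (_ : [set x | _] = set0) ?measure0//.
    by apply/seteqP; split => z // -[/mem_set].
  rewrite ge0_integralZl//; last by apply/measurable_EFinP; exact: measurable_indic.
  congr (_ * _)%E; apply: etrans (integral_indic _ measurableT mD) _.
  by rewrite setIT.
rewrite [RHS]muleC; apply: etrans (esym (key _ _ mA mB)) (etrans _ (key _ _ mB mA)).
(* For fixed [z] the reflection [t |-> psi z - t] exchanges the two conditions. *)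
rewrite 2!pm_xE; apply: eq_integral => z _ /=.
have mBA : measurable [set t | B t /\ A (sub3 (psi z) t)].
  apply: measurableI => //; apply: measurable_comp_set mA.
  exact: measurable_sub3.
apply: etrans (esym (leb3_refl (psi z) mBA)) _; by congr (L3 _); apply/seteqP; split => -[[u v] w] /=; rewrite /sub3/= !subKr => -[].
Qed.

End Affine3.

(** * Images under linear maps of three-space *)

Section Linear3.
Context (R : realType).
Implicit Types (A : set (M3 R)) (M : 'M[R]_3).

Definition vec3 (z : M3 R) : 'cV[R]_3 := \col_i nth 0 [:: z.1.1; z.1.2; z.2] i.
Definition unvec3 (v : 'cV[R]_3) : M3 R :=
  ((v ord0 0, v (inord 1) 0), v ord_max 0).

Lemma vec3K z : unvec3 (vec3 z) = z.
Proof. by case: z => -[a b] c; rewrite /unvec3 !mxE !inordK. Qed.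

Lemma unvec3K v : vec3 (unvec3 v) = v.
Proof.
apply/matrixP => i j; rewrite !mxE (ord1 j) /=.
by case: i => -[|[|[|//]]] /= h; congr (v _ _); apply: val_inj => //=; rewrite inordK.
Qed.

Definition lin3 M (z : M3 R) : M3 R := unvec3 (M *m vec3 z).

Lemma lin3E M z : lin3 M z =
  ((M ord0 ord0 * z.1.1 + M ord0 (inord 1) * z.1.2 + M ord0 ord_max * z.2,
    M (inord 1) ord0 * z.1.1 + M (inord 1) (inord 1) * z.1.2 + M (inord 1) ord_max * z.2),
    M ord_max ord0 * z.1.1 + M ord_max (inord 1) * z.1.2 + M ord_max ord_max * z.2).
Proof.
have e1 : lift ord0 ord0 = inord 1 :> 'I_3 by apply: val_inj; rewrite /= inordK.
have e2 : lift ord0 (lift ord0 ord0) = ord_max :> 'I_3 by apply: val_inj.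
rewrite /lin3 /unvec3 !mxE !big_ord_recl !big_ord0 !mxE /= e1 e2 !addr0 !addrA.
by [].
Qed.

Lemma measurable_form3 (a b c d : R) :
  measurable_fun setT (fun z : M3 R => a * z.1.1 + b * z.1.2 + c * z.2 + d : M1 R).
Proof.
apply: measurable_funD => //; apply: measurable_funD; last exact: measurable_funM.
by apply: measurable_funD; apply: measurable_funM => //; [exact: measurable_11|exact: measurable_12].
Qed.

Lemma measurable_lin3 M : measurable_fun setT (lin3 M).
Proof.
pose row i (z : M3 R) := M i ord0 * z.1.1 + M i (inord 1) * z.1.2 + M i ord_max * z.2 + 0.
rewrite (_ : lin3 M = fun z => ((row ord0 z, row (inord 1) z), row ord_max z)).
  by apply: measurable_fun_pair3; exact: measurable_form3.
by apply/funext => z; rewrite lin3E /row !addr0.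
Qed.

Lemma lin3_sub M z w : lin3 M (sub3 z w) = sub3 (lin3 M z) (lin3 M w).
Proof. by rewrite !lin3E /sub3/=; congr ((_, _), _); ring. Qed.

Lemma lin3VK M : M \in unitmx -> cancel (lin3 (invmx M)) (lin3 M).
Proof. by move=> uM z; rewrite /lin3 unvec3K mulmxA mulmxV// mul1mx vec3K. Qed.

Lemma lin3K M : M \in unitmx -> cancel (lin3 M) (lin3 (invmx M)).
Proof. by move=> uM z; rewrite /lin3 unvec3K mulmxA mulVmx// mul1mx vec3K. Qed.

Definition cube3 : set (M3 R) := (`[0, 1] `*` `[0, 1]) `*` `[0, 1].

Lemma measurable_cube3 : measurable cube3.
Proof. by do 2 apply: measurableX => //. Qed.

Lemma leb3_cube3 : L3 cube3 = 1%E.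
Proof.
have E : L1 (`[0, 1]%classic : set (M1 R)) = 1%E.
  by rewrite lebesgue_measure_itv/= lte_fin ltr01 oppr0 adde0.
have E2 : L2 (`[0, 1] `*` `[0, 1]) = 1%E :> \bar R.
  by apply: etrans (pm_setX _ _ _ _) (etrans (congr2 mule E E) (mule1 _)).
have mc : measurable (`[0, 1] `*` `[0, 1] : set (M2 R)) by exact: measurableX.
by apply: etrans (pm_setX _ _ mc _) (etrans (congr2 mule E2 E) (mule1 _)).
Qed.

(* The scaling factor is |det M|, but only its existence matters, since it
   cancels in the quotient defining a simplex spline. *)
Lemma leb3_lin3 M : M \in unitmx -> exists2 c : R, 0 < c &
  forall A v, measurable A ->
    L3 [set z | exists2 t, A t & z = sub3 (lin3 M t) v] = (c%:E * L3 A)%E.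
Proof.
move=> uM; pose psi := lin3 (invmx M).
pose c := L3 [set z | cube3 (psi z)].
pose d := L3 [set z | cube3 (lin3 M z)].
have mpsi : measurable_fun setT psi := measurable_lin3 _.
have haar A : measurable A -> L3 [set z | A (psi z)] = (c * L3 A)%E.
  move=> mA; rewrite muleC -[LHS]mule1 -leb3_cube3.
  apply: (leb3_haar (phi := lin3 M) mpsi _ mA measurable_cube3) => z t.
  by rewrite /psi lin3_sub lin3K.
(* Scaling the preimage of the cube back to the cube: the relation excludes both [c = 0] and
   [c = +oo]. *)
have cd : (c * d = 1)%E.
  rewrite -haar; last exact: (measurable_comp_set (measurable_lin3 M) measurable_cube3).
  rewrite -leb3_cube3; congr (L3 _); apply/seteqP; split => z /=; by rewrite lin3VK.
have c0 : (0 <= c)%E by exact: measure_ge0.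
have d0 : (0 <= d)%E by exact: measure_ge0.
have [r rE] : exists r : R, c = r%:E.
  case: (c) c0 cd => [r _ _||]; [by exists r| |by []].
  move=> _; have [->|dn] := eqVneq d 0%E; first by rewrite mule0 => -[/eqP]; rewrite eq_sym oner_eq0.
  by rewrite gt0_mulye// lt0e dn.
exists r.
  rewrite lt0r; rewrite rE lee_fin in c0; rewrite c0 andbT.
  by apply: contra_eq_neq cd => r0; rewrite rE r0 mul0e eq_sym; apply/eqP => -[/eqP]; rewrite oner_eq0.
move=> A v mA.
(* [sub3 (sub3 v v) v] is [- v], so that adding [v] can be written as a subtraction. *)
have nv z : sub3 (sub3 z v) (sub3 (sub3 v v) v) = z.
  by case: z => -[z1 z2] z3; rewrite /sub3/=; congr ((_, _), _); ring.
have nv' z : sub3 (sub3 z (sub3 (sub3 v v) v)) v = z.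
  by case: z => -[z1 z2] z3; rewrite /sub3/=; congr ((_, _), _); ring.
have mB : measurable [set z | A (psi z)] by exact: measurable_comp_set mA.
rewrite -rE -haar; last exact: mA.
apply: etrans _ (leb3_shift (sub3 (sub3 v v) v) mB).
congr (L3 _); apply/seteqP; split => z /=.
  by move=> [t At ->]; rewrite nv /psi lin3K.
move=> Az; exists (psi (sub3 z (sub3 (sub3 v v) v))) => //.
by rewrite /psi lin3VK// nv'.
Qed.

(** Measurability of [f] is not assumed, because [f] will be the section measure of an image set.
    The integral is a supremum over simple functions below [f], and these all lie below
    [+oo * \1_N]. *)
Lemma le_integral_set0 d (T : measurableType d) (mu : {measure set T -> \bar R})
  (f : T -> \bar R) (N : set T) : measurable N -> mu N = 0%E ->
  (forall x, (0 <= f x)%E) -> (forall x, ~ N x -> f x = 0%E) ->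
  (\int[mu]_x f x = 0)%E.
Proof.
move=> mN N0 f0 fN; apply/eqP; rewrite eq_le integral_ge0// andbT.
have <- : (\int[mu]_x (+oo * (\1_N x)%:E) = 0)%E.
  rewrite ge0_integralZl//; last by apply/measurable_EFinP; exact: measurable_indic.
  by rewrite integral_indic// setIT N0 mule0.
rewrite !ge0_integralTE//.
apply: ereal_sup_le => /= _ [h hf <-]; exists h => // x.
apply: (le_trans (hf x)); rewrite indicE; have [xN|/negP xN] := boolP (x \in N).
  by rewrite mule1 leey.
by rewrite fN ?mule0//; move=> /mem_set.
Qed.

(** A vector [n] of the left kernel confines the image to a plane [n . z = - k]. If [n3] is nonzero,
    vertical lines meet the plane once; otherwise the plane stands over a line [N], which is null in
    the plane of the first two coordinates. *)
Lemma leb3_lin3_0 M A v : M \notin unitmx ->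
  L3 [set z | exists2 t, A t & z = sub3 (lin3 M t) v] = 0%E.
Proof.
move=> uM.
have /det0P[n n0 nM] : \det M == 0 by move: uM; rewrite unitmxE unitfE negbK.
pose n1 := n 0 ord0; pose n2 := n 0 (inord 1); pose n3 := n 0 ord_max.
pose k := n1 * v.1.1 + n2 * v.1.2 + n3 * v.2.
have nP (t : M3 R) : let z := sub3 (lin3 M t) v in
    n1 * z.1.1 + n2 * z.1.2 + n3 * z.2 = - k.
  rewrite /lin3; have : (n *m (M *m vec3 t)) 0 0 = 0 by rewrite mulmxA nM mul0mx mxE.
  move: (M *m vec3 t) => w; rewrite mxE !big_ord_recl big_ord0 /=.
  have -> : lift ord0 ord0 = inord 1 :> 'I_3 by apply: val_inj; rewrite /= inordK.
  have -> : lift ord0 (lift ord0 ord0) = ord_max :> 'I_3 by apply: val_inj.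
  by rewrite -/n1 -/n2 -/n3 /k => h; lra.
set S := [set z | _].
have SP z : S z -> n1 * z.1.1 + n2 * z.1.2 + n3 * z.2 = - k.
  by move=> [t _ ->]; exact: nP.
have pt0 (B : set (M1 R)) (b : R) : (forall x, B x -> x = b) -> L1 B = 0%E.
  move=> Bb; have [Bb'|Bb'] := pselect (B b).
    rewrite (_ : B = [set b]) ?lebesgue_measure_set1//.
    by apply/seteqP; split => x /=; [exact: Bb|move->].
  rewrite (_ : B = set0) ?measure0//; apply/seteqP; split => x //= Bx.
  by apply: Bb'; rewrite -(Bb _ Bx).
rewrite pm_xE; have [n3z|n3z] := eqVneq n3 0; last first.
  apply: integral0_eq => p _; apply: (pt0 _ ((- k - n1 * p.1 - n2 * p.2) / n3)).
  by move=> x /SP /= h; rewrite -h; field.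
have n12 : n1 != 0 \/ n2 != 0.
  have [n1z|] := eqVneq n1 0; last by left.
  have [n2z|] := eqVneq n2 0; last by right.
  exfalso; move/eqP: n0; apply; apply/matrixP => i j; rewrite (ord1 i) mxE.
  case: j => -[|[|[|//]]] h; [rewrite -n1z|rewrite -n2z|rewrite -n3z];
    congr (n _ _); apply: val_inj => //=; by rewrite inordK.
pose N : set (M2 R) := [set p | n1 * p.1 + n2 * p.2 = - k].
have mN : measurable N.
  have -> : N = (fun p : M2 R => n1 * p.1 + n2 * p.2 + 0 : M1 R) @^-1` [set - k].
    by apply/seteqP; split => p; rewrite /N /= addr0.
  rewrite -[X in measurable X]setTI; apply: measurable_affine => //.
apply: (le_integral_set0 mN) => [||p pN].
- case: n12 => h.
    apply: etrans (pm_yE _ _ mN) _; apply: integral0_eq => y _; apply: (pt0 _ ((- k - n2 * y) / n1)).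
    by move=> x /= <-; rewrite addrK mulrAC mulfV// mul1r.
  apply: etrans (pm_xE _ _ _) _; apply: integral0_eq => y _; apply: (pt0 _ ((- k - n1 * y) / n2)).
  by move=> x /= <-; rewrite addrAC subrr add0r mulrAC mulfV// mul1r.
- by move=> p; exact: measure_ge0.
- apply: (pt0 _ 0) => x /SP/=; rewrite n3z mul0r addr0 => h.
  by case: pN.
Qed.

End Linear3.

(** * Slices of a simplex *)

Lemma measurable_le_set (R : realType) d (T : measurableType d) (f g : T -> M1 R) :
  measurable_fun setT f -> measurable_fun setT g -> measurable [set x | f x <= g x].
Proof.
move=> mf mg; rewrite (_ : [set x | _] = [set x | (0 : R) <= g x - f x]).
  rewrite -[X in measurable X]setTI -preimage_itvcy.
  by apply: measurable_funB => //; exact: measurable_itv.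
by apply/seteqP; split => x /=; rewrite subr_ge0.
Qed.

Lemma measurable_and3 d (T : measurableType d) (P Q S : set T) :
  measurable P -> measurable Q -> measurable S ->
  measurable [set x | [/\ P x, Q x & S x]].
Proof.
move=> mP mQ mS; rewrite (_ : [set x | _] = P `&` Q `&` S).
  by apply: measurableI => //; exact: measurableI.
by apply/seteqP; split => x [] // [].
Qed.

Section StandardSimplex.
Context (R : realType).

Definition std5 : set (M2 R * M3 R) := [set p |
  [/\ 0 <= p.2.1.1, 0 <= p.2.1.2 & 0 <= p.2.2] /\
  [/\ 0 <= p.1.1, 0 <= p.1.2 & p.1.1 + p.1.2 + (p.2.1.1 + p.2.1.2 + p.2.2) <= 1]].

(** The number 1/5!. It ends up in a common positive factor, so only its finiteness and positivity
    are proved, by comparison with cubes of side 1 and 1/5. *)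
Definition kappa : R := fine (L5 std5).

Lemma measurable_std5 : measurable std5.
Proof.
have m1 : measurable_fun setT (fst : M2 R * M3 R -> M2 R) by [].
have m2 : measurable_fun setT (snd : M2 R * M3 R -> M3 R) by [].
have m11 := measurableT_comp (@measurable_fst _ _ (M1 R) (M1 R)) m1.
have m12 := measurableT_comp (@measurable_snd _ _ (M1 R) (M1 R)) m1.
have m211 := measurableT_comp (@measurable_11 R) m2.
have m212 := measurableT_comp (@measurable_12 R) m2.
have m22 := measurableT_comp (@measurable_snd _ _ (M2 R) (M1 R)) m2.
apply: measurableI; apply: measurable_and3; apply: measurable_le_set => //.
by do 2?apply: measurable_funD => //; apply: measurable_funD.
Qed.

Lemma leb5_std5 : L5 std5 = kappa%:E /\ 0 < kappa.
Proof.
pose I (r : R) : set (M1 R) := `[0, r]%classic.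
pose cube r := (I r `*` I r) `*` ((I r `*` I r) `*` I r).
have mI r : measurable (I r) by exact: measurable_itv.
have mI2 r : measurable (I r `*` I r) by exact: measurableX.
have mI3 r : measurable ((I r `*` I r) `*` I r) by exact: measurableX.
have mcube r : measurable (cube r) by exact: measurableX.
have cubeE r : 0 < r -> L5 (cube r) = (r * r * (r * r * r))%:E.
  move=> r0.
  have E : L1 (I r) = r%:E.
    by rewrite lebesgue_measure_itv/= lte_fin r0 oppr0 adde0.
  have E2 : L2 (I r `*` I r) = (r * r)%:E.
    by apply: etrans (pm_setX _ _ (mI r) (mI r)) (congr2 mule E E).
  have E3 : L3 ((I r `*` I r) `*` I r) = (r * r * r)%:E.
    by apply: etrans (pm_setX _ _ (mI2 r) (mI r)) (congr2 mule E2 E).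
  exact: etrans (pm_setX _ _ (mI2 r) (mI3 r)) (congr2 mule E2 E3).
have up : (L5 std5 <= 1%:E)%E.
  apply: (@le_trans _ _ (L5 (cube 1))); last first.
    by rewrite (cubeE _ ltr01) !mulr1.
  apply: le_measure; [by rewrite inE; exact: measurable_std5|by rewrite inE; exact: mcube|].
  move=> [[a b] [[c d] e]] [/= [h1 h2 h3] [h4 h5 h6]].
  by split; [split|split; [split|]] ; rewrite /I /= in_itv/=; apply/andP; split; lra.
have p5 : 0 < 5^-1 :> R by rewrite invr_gt0.
pose r5 : R := 5^-1 * 5^-1 * (5^-1 * 5^-1 * 5^-1).
have r5p : 0 < r5 by rewrite /r5 !mulr_gt0.
have low : (r5%:E <= L5 std5)%E.
  rewrite /r5 -(cubeE _ p5).
  apply: le_measure; [by rewrite inE; exact: mcube|by rewrite inE; exact: measurable_std5|].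
  move=> [[a b] [[c d] e]] [[+ +] [[+ +] +]].
  rewrite /I /= !in_itv/= => /andP[a0 a1] /andP[b0 b1] /andP[c0 c1] /andP[d0 d1] /andP[e0 e1].
  by split; split => //=; lra.
have fin : L5 std5 = kappa%:E.
  rewrite /kappa fineK// ge0_fin_numE; first exact: (le_lt_trans up (ltry _)).
  by apply: (le_trans _ low); rewrite lee_fin ltW.
split => //; rewrite -lte_fin -fin; apply: (lt_le_trans _ low).
by rewrite lte_fin.
Qed.

End StandardSimplex.

Section Simplex.
Context (R : realType).
Implicit Types (p q r x : @pt R).

Definition o6 (k : nat) (h : (k < 6)%N) : 'I_6 := Ordinal h.
Local Notation o k := (@o6 k isT).

Lemma sum6 (F : 'I_6 -> R) :
  \sum_(i < 6) F i = F (o 0) + F (o 1) + F (o 2) + F (o 3) + F (o 4) + F (o 5).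
Proof.
rewrite !big_ord_recl big_ord0 addr0 !addrA.
by do 5?[congr (_ + _)]; congr F; apply: val_inj.
Qed.

(* Twice the signed area. *)
Definition area2 p q r : R :=
  (q.1 - p.1) * (r.2 - p.2) - (r.1 - p.1) * (q.2 - p.2).

Variable xi : 'I_6 -> @pt R.
Hypothesis xi0 : area2 (xi (o 0)) (xi (o 1)) (xi (o 2)) != 0.

Let D := area2 (xi (o 0)) (xi (o 1)) (xi (o 2)).
Let a0 x := area2 x (xi (o 1)) (xi (o 2)) / D.
Let a1 x := area2 (xi (o 0)) x (xi (o 2)) / D.
Let a2 x := area2 (xi (o 0)) (xi (o 1)) x / D.

(* Solving for the weights of the first three knots, which are affinely
   independent, leaves the weights t of the last three as coordinates on a
   slice; the last three inequalities say that the solved weights are >= 0. *)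
Definition cell x : set (M3 R) := [set t |
  [/\ 0 <= t.1.1, 0 <= t.1.2 & 0 <= t.2] /\
  [/\ a0 (xi (o 3)) * t.1.1 + a0 (xi (o 4)) * t.1.2 + a0 (xi (o 5)) * t.2 <= a0 x,
      a1 (xi (o 3)) * t.1.1 + a1 (xi (o 4)) * t.1.2 + a1 (xi (o 5)) * t.2 <= a1 x &
      a2 (xi (o 3)) * t.1.1 + a2 (xi (o 4)) * t.1.2 + a2 (xi (o 5)) * t.2 <= a2 x]].

Section Lift.
Variable y : {ffun 'I_6 -> @R3 R}.

Let cmb (c0 c1 c2 : R) (f : 'I_6 -> R) := c0 * f (o 0) + c1 * f (o 1) + c2 * f (o 2).
Let u (f : 'I_6 -> R) (j : 'I_6) := f j - cmb (a0 (xi j)) (a1 (xi j)) (a2 (xi j)) f.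
Let base x (f : 'I_6 -> R) := cmb (a0 x) (a1 x) (a2 x) f.
Let U (t : M3 R) (f : 'I_6 -> R) : R := u f (o 3) * t.1.1 + u f (o 4) * t.1.2 + u f (o 5) * t.2.
Let y1 i := (y i).1.1.
Let y2 i := (y i).1.2.
Let y3 i := (y i).2.

(** [base x] interpolates the lifts of the first three knots affinely at [x]; [U t] adds the
    deviations [u] of the other three lifts from this interpolation, weighted by [t]. Hence a slice
    is an affine image of the cell. *)
Lemma sliceP x (z : M3 R) : hull6 xi y (x, z) <->
  exists2 t : M3 R, cell x t &
    [/\ z.1.1 = base x y1 + U t y1, z.1.2 = base x y2 + U t y2 & z.2 = base x y3 + U t y3].
Proof.
split.
  move=> [lam [lam0 [lam1 [/= xE zE]]]].
  move: lam1 xE zE; rewrite !sum6 => lam1 xE zE.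
  pose t : M3 R := ((lam (o 3), lam (o 4)), lam (o 5)).
  have x1E : x.1 = _ := congr1 fst xE; have x2E : x.2 = _ := congr1 snd xE.
  rewrite /= in x1E x2E.
  have l0 : lam (o 0) = 1 - lam (o 1) - lam (o 2) - lam (o 3) - lam (o 4) - lam (o 5).
    by rewrite -lam1; ring.
  have e0 : a0 x = lam (o 0) + (a0 (xi (o 3)) * t.1.1 + a0 (xi (o 4)) * t.1.2 + a0 (xi (o 5)) * t.2).
    rewrite /a0 /t/= /D /area2 x1E x2E l0; field; exact: xi0.
  have e1 : a1 x = lam (o 1) + (a1 (xi (o 3)) * t.1.1 + a1 (xi (o 4)) * t.1.2 + a1 (xi (o 5)) * t.2).
    rewrite /a1 /t/= /D /area2 x1E x2E l0; field; exact: xi0.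
  have e2 : a2 x = lam (o 2) + (a2 (xi (o 3)) * t.1.1 + a2 (xi (o 4)) * t.1.2 + a2 (xi (o 5)) * t.2).
    rewrite /a2 /t/= /D /area2 x1E x2E l0; field; exact: xi0.
  exists t; first by split; split; rewrite ?e0 ?e1 ?e2 ?lerDr; exact: lam0.
  have fE f : base x f + U t f = lam (o 0) * f (o 0) + lam (o 1) * f (o 1) +
      lam (o 2) * f (o 2) + lam (o 3) * f (o 3) + lam (o 4) * f (o 4) + lam (o 5) * f (o 5).
    by rewrite /base /cmb e0 e1 e2 /U /u /cmb /t/=; ring.
  by rewrite !fE zE.
move=> [t [[t1 t2 t3] [r0 r1 r2]] [z1 z2 z3]].
pose l k := nth 0 [:: a0 x - (a0 (xi (o 3)) * t.1.1 + a0 (xi (o 4)) * t.1.2 + a0 (xi (o 5)) * t.2);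
  a1 x - (a1 (xi (o 3)) * t.1.1 + a1 (xi (o 4)) * t.1.2 + a1 (xi (o 5)) * t.2);
  a2 x - (a2 (xi (o 3)) * t.1.1 + a2 (xi (o 4)) * t.1.2 + a2 (xi (o 5)) * t.2);
  t.1.1; t.1.2; t.2] k : R.
exists (fun i : 'I_6 => l i); split.
  by case=> -[|[|[|[|[|[|//]]]]]] /= _; rewrite /l/= ?subr_ge0.
rewrite !sum6 /l/=; split.
  rewrite /a0 /a1 /a2 /D /area2; field; exact: xi0.
split.
  rewrite [LHS]surjective_pairing; congr (_, _);
  rewrite /a0 /a1 /a2 /D /area2; field; exact: xi0.
rewrite [LHS]surjective_pairing [z.1]surjective_pairing z1 z2 z3.
by rewrite /base /U /u /cmb /y1 /y2 /y3; congr ((_, _), _); ring.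
Qed.

Let Mx : 'M[R]_3 := \matrix_(c < 3, j < 3)
  u (nth y1 [:: y1; y2; y3] c) (nth (o 3) [:: o 3; o 4; o 5] j).

Lemma sliceE x : slice xi y x =
  [set z | exists2 t, cell x t &
     z = sub3 (lin3 Mx t) ((- base x y1, - base x y2), - base x y3)].
Proof.
have E t : sub3 (lin3 Mx t) ((- base x y1, - base x y2), - base x y3) =
    ((base x y1 + U t y1, base x y2 + U t y2), base x y3 + U t y3).
  by rewrite lin3E !mxE !inordK //= /sub3 /= !opprK !(addrC (base _ _)).
apply/seteqP; split => z /=.
  move=> /sliceP[t ct [z1 z2 z3]]; exists t => //.
  by rewrite E -z1 -z2 -z3; case: (z) => -[].
by move=> [t ct ->]; apply/sliceP; exists t => //; rewrite E.
Qed.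

End Lift.

Lemma measurable_area2 d (T : measurableType d) (f g h : T -> M2 R) :
  measurable_fun setT f -> measurable_fun setT g -> measurable_fun setT h ->
  measurable_fun setT (fun w => area2 (f w) (g w) (h w) : M1 R).
Proof.
have m1 k : measurable_fun setT k -> measurable_fun setT (fun w : T => (k w : M2 R).1).
  by move=> mk; exact: (measurableT_comp (@measurable_fst _ _ (M1 R) (M1 R)) mk).
have m2 k : measurable_fun setT k -> measurable_fun setT (fun w : T => (k w : M2 R).2).
  by move=> mk; exact: (measurableT_comp (@measurable_snd _ _ (M1 R) (M1 R)) mk).
move=> mf mg mh.
by apply: measurable_funB; apply: measurable_funM; apply: measurable_funB;
  [exact: m1|exact: m1|exact: m2|exact: m2|exact: m1|exact: m1|exact: m2|exact: m2].
Qed.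

Lemma measurable_cells : measurable [set p : M2 R * M3 R | cell p.1 p.2].
Proof.
have m1 : measurable_fun setT (fst : M2 R * M3 R -> M2 R) by [].
have m2 : measurable_fun setT (snd : M2 R * M3 R -> M3 R) by [].
have m211 := measurableT_comp (@measurable_11 R) m2.
have m212 := measurableT_comp (@measurable_12 R) m2.
have m22 := measurableT_comp (@measurable_snd _ _ (M2 R) (M1 R)) m2.
have row (a b c : R) : measurable_fun setT
    (fun p : M2 R * M3 R => a * p.2.1.1 + b * p.2.1.2 + c * p.2.2 : M1 R).
  by apply: measurable_funD; [apply: measurable_funD|]; apply: measurable_funM.
apply: measurableI; apply: measurable_and3; apply: measurable_le_set => //;
  apply: measurable_funM => //; exact: measurable_area2.
Qed.

Lemma measurable_cell x : measurable (cell x).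
Proof. by have /(measurable_xsec x) := measurable_cells. Qed.

(** Slicing at fixed [t] instead of fixed [x]: the remaining weights [a1 q - s1] and [a2 q - s2] of
    the second and third knots are affine coordinates on the plane, of determinant [D^-1], and they
    carry the fibre onto the fibre of [std5]. *)
Lemma leb5_cells : L5 [set p : M2 R * M3 R | cell p.1 p.2] = (`|D| * kappa R)%:E.
Proof.
have [kE k0] := @leb5_std5 R.
apply: etrans (pm_yE _ _ measurable_cells) _.
rewrite EFinM -kE; apply: etrans _ (congr1 (mule _) (esym (pm_yE _ _ (@measurable_std5 R)))).
rewrite -ge0_integralZl//; last exact: (measurable_fun_ysec L2 (@measurable_std5 R)).
apply: eq_integral => t _.
have mt : measurable [set q : M2 R | std5 (q, t)].
  exact: (measurable_ysec t (@measurable_std5 R)).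
pose p0 := xi (o 0); pose p1 := xi (o 1); pose p2 := xi (o 2).
pose s1 := a1 (xi (o 3)) * t.1.1 + a1 (xi (o 4)) * t.1.2 + a1 (xi (o 5)) * t.2.
pose s2 := a2 (xi (o 3)) * t.1.1 + a2 (xi (o 4)) * t.1.2 + a2 (xi (o 5)) * t.2.
pose a := (p2.2 - p0.2) / D; pose b := - (p2.1 - p0.1) / D.
pose c := - (p1.2 - p0.2) / D; pose d := (p1.1 - p0.1) / D.
pose e := (- p0.1 * (p2.2 - p0.2) + (p2.1 - p0.1) * p0.2) / D - s1.
pose f := (- (p1.1 - p0.1) * p0.2 + p0.1 * (p1.2 - p0.2)) / D - s2.
have D0 : D != 0 by exact: xi0.
have asum w : a0 w = 1 - a1 w - a2 w.
  by rewrite /a0 /a1 /a2 /D /area2; field; exact: xi0.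
have det : a * d - b * c = D^-1.
  rewrite /a /b /c /d /p0 /p1 /p2 /D /area2.
  by field; exact: xi0.
have detn0 : a * d - b * c != 0 by rewrite det invr_neq0.
have := leb2_affine e f detn0 mt.
rewrite det => detE; apply: etrans _ (congr1 (mule _) detE).
rewrite muleA -EFinM -normrM mulfV// normr1 mul1e.
congr (L2 _); apply/seteqP; split => q; rewrite /cell /std5 /=.
all: have -> : a * q.1 + b * q.2 + e = a1 q - s1 by
  rewrite /a /b /e /a1 /p0 /p2 /D /area2; field; exact: xi0.
all: have -> : c * q.1 + d * q.2 + f = a2 q - s2 by
  rewrite /c /d /f /a2 /p0 /p1 /D /area2; field; exact: xi0.
all: have -> : a1 q - s1 + (a2 q - s2) + (t.1.1 + t.1.2 + t.2) =
  1 - a0 q + (a0 (xi (o 3)) * t.1.1 + a0 (xi (o 4)) * t.1.2 + a0 (xi (o 5)) * t.2) by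
  by rewrite /s1 /s2 !asum; ring.
- by move=> [h [h0 h1 h2]]; split => //; rewrite !subr_ge0; split => //; lra.
- by move=> [h []]; rewrite !subr_ge0 => h1 h2 h0; split => //; split => //; lra.
Qed.

Lemma fine_mulr_pos (c : R) (x : \bar R) : 0 < c -> fine (c%:E * x) = c * fine x.
Proof.
move=> c0; case: x => [r| |] //=; first by rewrite gt0_muley ?lte_fin//= mulr0.
by rewrite gt0_muleNy ?lte_fin//= mulr0.
Qed.

(** All slices of one lift are images of the cells under the same linear part [Mx], so numerator and
    denominator carry the same factor [c]. A singular [Mx] would give volume 0, against
    admissibility. *)
Lemma lift_ratio y x : admissible_lift xi y ->
  fine (vol3 (slice xi y x)) / fine (vol5 (hull6 xi y)) =
  fine (L3 (cell x)) / (`|D| * kappa R).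
Proof.
have vE : vol5 (hull6 xi y) = (\int[L2]_x vol3 (slice xi y x))%E.
  by rewrite vol5E pm_xE.
rewrite /admissible_lift; pose Mx : 'M[R]_3 := \matrix_(c < 3, j < 3)
  (let f := nth (fun i => (y i).1.1) [:: fun i => (y i).1.1; fun i => (y i).1.2; fun i => (y i).2] c in
   let i := nth (o 3) [:: o 3; o 4; o 5] j in
   f i - (a0 (xi i) * f (o 0) + a1 (xi i) * f (o 1) + a2 (xi i) * f (o 2))).
have [uM|uM] := boolP (Mx \in unitmx); last first.
  have -> : vol5 (hull6 xi y) = 0%E.
    rewrite vE; apply: integral0_eq => q _; rewrite vol3E sliceE.
    exact: leb3_lin3_0.
  by rewrite ltxx.
have [c c0 cE] := leb3_lin3 uM.
have sE q : vol3 (slice xi y q) = (c%:E * L3 (cell q))%E.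
  by rewrite vol3E sliceE; apply: cE; exact: measurable_cell.
have VE : vol5 (hull6 xi y) = (c * (`|D| * kappa R))%:E.
  rewrite vE; transitivity (\int[L2]_q (c%:E * L3 (cell q)))%E.
    by apply: eq_integral => q _; exact: sE.
  have mc : measurable_fun setT (fun q => L3 (cell q)).
    exact: (measurable_fun_xsec L3 measurable_cells).
  have c0' : (0 <= c%:E)%E by rewrite lee_fin ltW.
  apply: etrans (ge0_integralZl L2 measurableT mc (fun q _ => measure_ge0 L3 _) c0') _.
  by rewrite EFinM -leb5_cells pm_xE.
have cc : c / c = 1 := divff (lt0r_neq0 c0).
move=> _; rewrite VE sE (fine_mulr_pos _ c0).
rewrite -[fine (_%:E)]/(c * (`|D| * kappa R)) -mulf_div cc.
exact: mul1r.
Qed.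

Lemma ex_admissible_lift : exists y, admissible_lift xi y.
Proof.
(* Three vertices at the origin and three at the unit vectors: [base] vanishes and [U t] is [t], so
   each slice is the cell itself. *)
pose y : {ffun 'I_6 -> @R3 R} := [ffun i : 'I_6 => nth ((0, 0), 0)
  [:: ((0, 0), 0); ((0, 0), 0); ((0, 0), 0); ((1, 0), 0); ((0, 1), 0); ((0, 0), 1)] i].
exists y; rewrite /admissible_lift vol5E pm_xE.
have -> : (\int[L2]_q L3 [set z | hull6 xi y (q, z)])%E = (`|D| * kappa R)%:E.
  rewrite -leb5_cells pm_xE; apply: eq_integral => q _; congr (L3 _).
  apply/seteqP; split => z.
    move=> /sliceP[t ct []]; rewrite !ffunE/=.
    rewrite !(mulr0, mulr1, mul1r, mul0r, addr0, add0r, subr0, oppr0).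
    by case: z => -[z1 z2] z3 /= -> -> ->; case: t ct => -[].
  move=> cz; apply/sliceP; exists z => //; rewrite !ffunE/=.
  by rewrite !(mulr0, mulr1, mul1r, mul0r, addr0, add0r, subr0, oppr0).
rewrite lte_fin mulr_gt0 ?normr_gt0//; by have [] := @leb5_std5 R.
Qed.

End Simplex.

Lemma reindex_nth (s : seq 'I_6) : size s = 6%N -> uniq s ->
  injective (fun i : 'I_6 => nth ord0 s i).
Proof.
move=> sz us i j /eqP; rewrite nth_uniq ?sz//.
by move/eqP/val_inj.
Qed.

(** * Reordering the knots *)

Section Permutation.
Context (R : realType) (xi : 'I_6 -> @pt R) (s : 'I_6 -> 'I_6).
Hypothesis s_inj : injective s.

Lemma hull6_perm (y : {ffun 'I_6 -> @R3 R}) :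
  hull6 (xi \o s) [ffun i => y (s i)] = hull6 xi y.
Proof.
have [t ts st] : bijective s by exact: injF_bij.
have E (lam F : 'I_6 -> R) :
    \sum_(i < 6) lam (t i) * F i = \sum_(i < 6) lam i * F (s i).
  by rewrite (reindex_inj s_inj); apply: eq_bigr => i _; rewrite ts.
have E1 (lam : 'I_6 -> R) : \sum_(i < 6) lam (t i) = \sum_(i < 6) lam i.
  by rewrite (reindex_inj s_inj); apply: eq_bigr => i _; rewrite ts.
have E2 (lam F : 'I_6 -> R) :
    \sum_(i < 6) lam i * F i = \sum_(i < 6) lam (s i) * F (s i).
  by rewrite (reindex_inj s_inj).
have E3 (lam : 'I_6 -> R) : \sum_(i < 6) lam i = \sum_(i < 6) lam (s i).
  by rewrite (reindex_inj s_inj).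
apply/seteqP; split => w [lam [l0 [l1 [w1 w2]]]].
  exists (fun i => lam (t i)); split; first by move=> i.
  rewrite E1 (E _ (fun i => (xi i).1)) (E _ (fun i => (xi i).2)).
  rewrite (E _ (fun i => (y i).1.1)) (E _ (fun i => (y i).1.2)) (E _ (fun i => (y i).2)).
  rewrite w1 w2 l1; split => //; split => //.
  by congr ((_, _), _); apply: eq_bigr => i _; rewrite ffunE.
exists (fun i => lam (s i)); split; first by move=> i.
rewrite -E3 l1 w1 w2; split => //; split.
  by rewrite (E2 _ (fun i => (xi i).1)) (E2 _ (fun i => (xi i).2)).
rewrite (E2 _ (fun i => (y i).1.1)) (E2 _ (fun i => (y i).1.2)) (E2 _ (fun i => (y i).2)).
by congr ((_, _), _); apply: eq_bigr => i _; rewrite ffunE.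
Qed.

Local Notation o k := (@o6 k isT).
Hypothesis xi0 : area2 (xi (s (o 0))) (xi (s (o 1))) (xi (s (o 2))) != 0.

Lemma simplex_spline_permE x : simplex_spline xi x =
  fine (L3 (cell (xi \o s) x)) /
    (`|area2 (xi (s (o 0))) (xi (s (o 1))) (xi (s (o 2)))| * kappa R).
Proof.
have adm y : admissible_lift xi y ->
    fine (vol3 (slice xi y x)) / fine (vol5 (hull6 xi y)) =
    fine (L3 (cell (xi \o s) x)) /
    (`|area2 (xi (s (o 0))) (xi (s (o 1))) (xi (s (o 2)))| * kappa R).
  move=> ya; have ys : admissible_lift (xi \o s) [ffun i => y (s i)].
    by rewrite /admissible_lift hull6_perm.
  have := lift_ratio (xi0 : area2 ((xi \o s) _) ((xi \o s) _) ((xi \o s) _) != 0) x ys.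
  by rewrite /slice hull6_perm.
(* The default [lift0] cannot be returned for lack of candidates: an admissible lift of the
   reordered knots is carried back by the inverse permutation [t]. *)
apply: adm; rewrite /the_lift; case: xgetP => [y _ //|/(_ _) nP].
have [y ya] := ex_admissible_lift (xi0 : area2 ((xi \o s) _) ((xi \o s) _) ((xi \o s) _) != 0).
have [t ts st] : bijective s by exact: injF_bij.
case: (nP [ffun i => y (t i)]); rewrite /admissible_lift -hull6_perm.
rewrite (_ : [ffun i => _] = y)//.
by apply/ffunP => i; rewrite !ffunE ts.
Qed.

End Permutation.

(** * The knot multisets in a reference triangle *)

Section Reference.
Context (R : realType).
Implicit Types (p q r x X : @pt R) (i : nat).
Local Notation o k := (@o6 k isT).

Definition e1 : @pt R := (1, 0).
Definition e2 : @pt R := (0, 1).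
Definition e3 : @pt R := (0, 0).

(** Points of the reference plane serve as pairs of barycentric coordinates, the third coordinate
    being implicit. *)
Definition amap (v1 v2 v3 : @pt R) p : @pt R := comb3 p.1 v1 p.2 v2 (1 - p.1 - p.2) v3.

Lemma area2_amap (v1 v2 v3 : @pt R) p q r :
  area2 (amap v1 v2 v3 p) (amap v1 v2 v3 q) (amap v1 v2 v3 r) = area2 v1 v2 v3 * area2 p q r.
Proof. by rewrite /area2 /amap /comb3 /comb2 /padd /pscale /=; ring. Qed.

Lemma cell_amap (v1 v2 v3 : @pt R) (xi : 'I_6 -> @pt R) X : area2 v1 v2 v3 != 0 ->
  cell (amap v1 v2 v3 \o xi) (amap v1 v2 v3 X) = cell xi X.
Proof.
move=> v0; rewrite /cell /= !area2_amap.
have E (u w : R) : (area2 v1 v2 v3 * u) / (area2 v1 v2 v3 * w) = u / w by rewrite -mulf_div divff// mul1r.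
by rewrite !E.
Qed.

Lemma Xi_amap (v1 v2 v3 : @pt R) i : Xi v1 v2 v3 i = map (amap v1 v2 v3) (Xi e1 e2 e3 i).
Proof.
have H1 : amap v1 v2 v3 e1 = v1.
  by rewrite [RHS]surjective_pairing; congr (_, _); rewrite /e1 /=; ring.
have H2 : amap v1 v2 v3 e2 = v2.
  by rewrite [RHS]surjective_pairing; congr (_, _); rewrite /e2 /=; ring.
have H3 : amap v1 v2 v3 e3 = v3.
  by rewrite [RHS]surjective_pairing; congr (_, _); rewrite /e3 /=; ring.
have H a b p q : a + b = 1 -> comb2 a (amap v1 v2 v3 p) b (amap v1 v2 v3 q) =
    amap v1 v2 v3 (comb2 a p b q).
  move=> /(canRL (addrK _)) ->; rewrite /amap /comb3 /comb2 /padd /pscale/=.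
  by congr (_, _); ring.
have h1 : 2 / 3 + 1 / 3 = 1 :> R by field.
have h2 : 1 / 3 + 2 / 3 = 1 :> R by field.
have K12 := H _ _ e2 e3 h1; have K13 := H _ _ e2 e3 h2.
have K21 := H _ _ e1 e3 h1; have K23 := H _ _ e1 e3 h2.
have K31 := H _ _ e1 e2 h1; have K32 := H _ _ e1 e2 h2.
rewrite H1 H2 in K31 K32; rewrite H1 H3 in K21 K23; rewrite H2 H3 in K12 K13.
rewrite /Xi K12 K13 K21 K23 K31 K32.
by do 28?[case: i => [|i]]; rewrite /= ?H1 ?H2 ?H3.
Qed.

(* Reorderings of the knots for which the first three are affinely independent
   and the cell is, in suitable regions, an instance of [nested]. *)
Definition ptab i : seq 'I_6 :=
  match i with
  | 1 | 2 | 3 => [:: o 0; o 4; o 5; o 1; o 2; o 3]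
  | 4 | 7 => [:: o 0; o 3; o 5; o 4; o 1; o 2]
  | 5 | 6 => [:: o 0; o 5; o 3; o 4; o 1; o 2]
  | 8 | 9 => [:: o 0; o 3; o 5; o 4; o 1; o 2]
  | 10 | 13 => [:: o 0; o 2; o 5; o 4; o 3; o 1]
  | 11 | 12 => [:: o 0; o 5; o 2; o 4; o 3; o 1]
  | 14 | 15 => [:: o 0; o 2; o 5; o 3; o 4; o 1]
  | 16 | 17 => [:: o 0; o 2; o 4; o 5; o 3; o 1]
  | 18 => [:: o 0; o 2; o 4; o 3; o 5; o 1]
  | 19 => [:: o 0; o 2; o 4; o 5; o 1; o 3]
  | 20 => [:: o 0; o 4; o 2; o 1; o 5; o 3]
  | 21 => [:: o 1; o 5; o 3; o 0; o 4; o 2]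
  | 22 => [:: o 0; o 1; o 5; o 4; o 3; o 2]
  | 23 | 24 => [:: o 0; o 5; o 1; o 3; o 2; o 4]
  | 25 => [:: o 0; o 2; o 3; o 4; o 5; o 1]
  | 26 => [:: o 3; o 2; o 1; o 0; o 5; o 4]
  | 27 => [:: o 5; o 1; o 2; o 0; o 3; o 4]
  | _ => [:: o 0; o 1; o 5; o 4; o 3; o 2]
  end.

Definition pfun i (k : 'I_6) : 'I_6 := nth ord0 (ptab i) k.

Lemma pfun_inj i : injective (pfun i).
Proof. by apply: reindex_nth; do 28?[case: i => [//|i]]. Qed.

Definition gk i : 'I_6 -> @pt R := knots (Xi e1 e2 e3 i) \o pfun i.

Lemma gkE i : gk i =1 fun k => nth (0, 0) [seq nth (0, 0) (Xi e1 e2 e3 i) (j : 'I_6) | j <- ptab i] k.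
Proof.
move=> k; rewrite /gk /= /knots /pfun (nth_map ord0)//.
by move: (ltn_ord k); do 28?[case: i => [//|i]].
Qed.

(** [ptab] always puts first a triple spanning a ninth of the reference triangle, which makes the
    normalising denominator independent of [i]. *)
Lemma area2_gk i : `|area2 (gk i (o 0)) (gk i (o 1)) (gk i (o 2))| = 9^-1.
Proof.
have p9 : 0 <= 9^-1 :> R by rewrite invr_ge0.
have [h|h] : area2 (gk i (o 0)) (gk i (o 1)) (gk i (o 2)) = 9^-1 \/
   area2 (gk i (o 0)) (gk i (o 1)) (gk i (o 2)) = - 9^-1.
  rewrite !gkE.
  do 28?[case: i => [|i]]; rewrite /= /area2 /comb2 /padd /pscale /e1 /e2 /e3 /=;
    by [left; field|right; field].
- by rewrite h ger0_norm.
- by rewrite h normrN ger0_norm.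
Qed.

Lemma gk_det i : area2 (gk i (o 0)) (gk i (o 1)) (gk i (o 2)) != 0.
Proof. by rewrite -normr_eq0 area2_gk invr_neq0. Qed.

Definition V i X : R := fine (L3 (cell (gk i) X)).

(** The area of the triangle cancels: the weight contains [|area2| / (2 * 15)], the denominator
    [|area2| / 9], and 9/30 is 3/10. So the factor is the same for both triangles. *)
Lemma wgt_spline (v1 v2 v3 : @pt R) i X : area2 v1 v2 v3 != 0 ->
  wgt v1 v2 v3 i * simplex_spline (knots (Xi v1 v2 v3 i)) (amap v1 v2 v3 X) =
  3 / (10 * kappa R) * (cw i * V i X).
Proof.
move=> v0.
have kE (k : 'I_6) : knots (Xi v1 v2 v3 i) k = amap v1 v2 v3 (knots (Xi e1 e2 e3 i) k).
  rewrite /knots Xi_amap (nth_map (0, 0))//.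
  by move: (ltn_ord k); do 28?[case: i => [//|i]].
have d0 := gk_det i.
have dE : area2 (knots (Xi v1 v2 v3 i) (pfun i (o 0))) (knots (Xi v1 v2 v3 i) (pfun i (o 1)))
   (knots (Xi v1 v2 v3 i) (pfun i (o 2))) =
   area2 v1 v2 v3 * area2 (gk i (o 0)) (gk i (o 1)) (gk i (o 2)).
  by rewrite !kE area2_amap.
rewrite (simplex_spline_permE (@pfun_inj i)); last by rewrite dE mulf_neq0.
rewrite dE normrM area2_gk.
have -> : knots (Xi v1 v2 v3 i) \o pfun i = amap v1 v2 v3 \o gk i.
  by apply/funext => k; rewrite /= kE.
rewrite cell_amap// /wgt /tri_area -[`|_ - _|]/(`|area2 v1 v2 v3|) -/(V i X).
have [_ k0] := @leb5_std5 R.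
field; rewrite normr_eq0 v0 gt_eqF//.
Qed.

End Reference.

(** * Truncated powers and nested integrals *)

Lemma is_derive_cvg (R : realType) (V : normedModType R) (f : V -> R) (a v : V) (df : R) :
  (fun h : R => h^-1 * (f (h *: v + a) - f a)) @ 0^' --> df -> is_derive a v f df.
Proof.
move=> h; apply: DeriveDef; first by apply/cvg_ex; exists df.
exact: cvg_lim.
Qed.

Lemma cvg_is_derive (R : realType) (V : normedModType R) (f : V -> R) (a v : V) (df : R) :
  is_derive a v f df -> (fun h : R => h^-1 * (f (h *: v + a) - f a)) @ 0^' --> df.
Proof. by move=> [df1 <-]. Qed.

Section TruncatedPower.
Context (R : realType).

Definition ppow (k : nat) (x : R) : R := if 0 <= x then x ^+ k else 0.

Lemma ppow_ge k (x : R) : 0 <= x -> ppow k x = x ^+ k.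
Proof. by rewrite /ppow => ->. Qed.

Lemma ppow_lt k (x : R) : x < 0 -> ppow k x = 0.
Proof. by rewrite /ppow leNgt => ->. Qed.

Lemma ppow_le k (x : R) : x <= 0 -> ppow k.+1 x = 0.
Proof.
by rewrite le_eqVlt => /predU1P[->|/ppow_lt//]; rewrite ppow_ge// expr0n.
Qed.

Lemma ppowS k (x : R) : ppow k.+1 x = x * ppow k x.
Proof. by rewrite /ppow; case: ifP => _; rewrite ?exprS ?mulr0. Qed.

Lemma continuous_ppow k : continuous (ppow k.+1).
Proof.
elim: k => [|k IH].
  rewrite (_ : ppow 1 = fun y => Order.max y 0).
    by move=> x; apply: continuous_max => //; exact: cvg_cst.
  apply/funext => y; rewrite /ppow expr1.
  by case: (leP 0 y).
rewrite (_ : ppow k.+2 = fun x => x * ppow k.+1 x); last by apply/funext => x; rewrite ppowS.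
by move=> x; apply: continuousM; [exact: cvg_id|exact: IH].
Qed.

Lemma is_derive_ppow k (x : R) : is_derive x 1 (ppow k.+2) (k.+2%:R * ppow k.+1 x).
Proof.
have [x0|x0|<-] := ltrgtP 0 x.
- apply: (near_eq_is_derive (f := fun y : R => y ^+ k.+2)).
    by near=> y; rewrite ppow_ge//; apply: ltW; near: y; exact: lt_nbhsr.
  apply: DeriveDef; first exact: exprn_derivable.
  by rewrite exp_derive ppow_ge ?ltW// [LHS]mulr1.
- apply: (near_eq_is_derive (f := cst 0)).
    by near=> y; rewrite ppow_lt//; near: y; exact: lt_nbhsl.
  by rewrite ppow_lt// mulr0; exact: is_derive_cst.
(* At the kink the difference quotient is [ppow k.+1 h], which tends to 0. *)
- apply: is_derive_cvg; rewrite (@ppow_le k 0)// mulr0.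
  have c0 : ppow k.+1 @ 0^' --> (0 : R).
    apply: cvg_within_filter; have := @continuous_ppow k 0.
    by rewrite /continuous_at (@ppow_le k 0).
  apply: cvg_trans c0; apply: near_eq_cvg; near=> h.
  rewrite /= addr0 [h *: _]mulr1 (@ppow_le k.+1 0)// subr0 (ppowS k.+1 h) mulKf//.
  by near: h; exact: nbhs_dnbhs_neq.
Unshelve. all: by end_near. Qed.

Definition prim (F f : R -> R) := (forall x : R, is_derive x 1 F (f x)) /\ continuous f.

Lemma prim_ppow k (a b : R) : b != 0 ->
  prim (fun t => (k.+2%:R * b)^-1 * ppow k.+2 (a + b * t)) (fun t => ppow k.+1 (a + b * t)).
Proof.
move=> b0; have dl (x : R) : is_derive x 1 (fun t => a + b * t) b.
  have d := is_deriveD (is_derive_cst a x (1 : R)) (is_deriveZ b (is_derive_id x (1 : R))).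
  by apply: is_derive_eq d _; rewrite add0r [LHS]mulr1.
split=> x.
  apply: is_derive_eq.
    apply: is_deriveZ; exact: (is_derive1_comp (is_derive_ppow k _) (dl x)).
  have kb : k.+2%:R * b != 0 by rewrite mulf_neq0// pnatr_eq0.
  by rewrite -[_ *: _]/(_ * _) mulrAC mulKf.
apply: (@continuous_comp _ _ _ (fun t => a + b * t) (ppow k.+1)).
  by apply/differentiable_continuous/derivable1_diffP; case: (dl x).
exact: continuous_ppow.
Qed.

Lemma primB F f G g : prim F f -> prim G g -> prim (F \- G) (f \- g).
Proof.
move=> [dF cf] [dG cg]; split=> x; first by apply: is_deriveB.
by apply: continuousB; [exact: cf|exact: cg].
Qed.

Lemma primZ F f k : prim F f -> prim (fun t => k * F t) (fun t => k * f t).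
Proof.
move=> [dF cf]; split=> x; first by apply: is_deriveZ.
by apply: continuousM; [exact: cvg_cst|exact: cf].
Qed.

Lemma integral_prim F f (r : R) : prim F f -> 0 <= r ->
  (\int[lebesgue_measure]_(t in `[0%R, r]) (f t)%:E = (F r - F 0)%:E)%E.
Proof.
move=> [dF cf]; rewrite le_eqVlt => /predU1P[<-|r0].
  by rewrite set_itv1 integral_set1 subrr.
have cF : continuous F.
  by move=> x; apply/differentiable_continuous/derivable1_diffP; case: (dF x).
rewrite (@continuous_FTC2 _ f F 0 r)// ?EFinB//.
- exact: continuous_subspaceT.
- split; first by move=> x _; case: (dF x).
  + by apply: cvg_at_right_filter; exact: cF.
  + by apply: cvg_at_left_filter; exact: cF.
- by move=> x _; rewrite derive1E; case: (dF x).
Qed.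

(** The innermost integral: the indicator of a half-line has [m^-1 * ppow 1 (a + m * t)] as a
    primitive away from its jump, for either sign of [m]. Two further integrations raise the
    exponent to 3. *)
Lemma leb1_trunc (tau a m : R) : 0 <= tau -> m != 0 ->
  lebesgue_measure [set t : M1 R | [/\ 0 <= t, t <= tau & 0 <= a + m * t]] =
  (m^-1 * (ppow 1 (a + m * tau) - ppow 1 a))%:E.
Proof.
move=> tau0 m0.
have L (u v : R) : u <= v -> lebesgue_measure (`[u, v]%classic : set (M1 R)) = (v - u)%:E.
  move=> uv; rewrite lebesgue_measure_itv/= lte_fin; case: ltP => [|vu]; first by rewrite EFinB.
  by congr (_%:E); lra.
have N1 (x : R) : ppow 1 x = Order.max x 0.
  by rewrite /ppow expr1; case: (leP 0 x).
pose lo := if 0 < m then Order.max 0 (- a / m) else 0.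
pose hi := if 0 < m then tau else Order.min tau (- a / m).
have -> : [set t : M1 R | [/\ 0 <= t, t <= tau & 0 <= a + m * t]] = `[lo, hi]%classic.
  apply/seteqP; split => t /=; rewrite in_itv/= /lo /hi; case: ltrP => m1.
  - move=> [t0 t1 t2]; rewrite ge_max t0 t1 andbT /= ler_pdivrMr//; lra.
  - have {}m1 : m < 0 by rewrite lt_neqAle m0.
    move=> [t0 t1 t2]; rewrite t0 le_min t1 /= ler_ndivlMr//; lra.
  - rewrite ge_max ler_pdivrMr// => /andP[/andP[h1 h2] h3]; split => //; lra.
  - have {}m1 : m < 0 by rewrite lt_neqAle m0.
    rewrite le_min ler_ndivlMr// => /andP[h1 /andP[h2 h3]]; split => //; lra.
transitivity ((Order.max (hi - lo) 0)%:E); last first.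
  congr (_%:E); rewrite !N1 /lo /hi.
  (* [d] is the zero of [a + m * t]; the cases below compare it with 0 and [tau]. *)
  have [d ->] : exists d, a = - (m * d) by exists (- a / m); field.
  have -> : - - (m * d) / m = d by field.
  have [m1|m1] := ltrP 0 m.
    have [d0|d0] := leP 0 d.
      have md : 0 <= m * d by rewrite mulr_ge0// ltW.
      rewrite [X in _ * (_ - X)]max_r; last by lra.
      have [area2|area2] := leP d tau.
        have mdt : 0 <= m * (tau - d) by rewrite mulr_ge0 ?subr_ge0// ltW.
        by rewrite !max_l; [field| lra|lra].
      have mdt : 0 <= m * (d - tau) by rewrite mulr_ge0 ?subr_ge0// ltW.
      by rewrite !max_r; [field| lra|lra].
    have md : 0 <= m * - d by rewrite mulr_ge0 ?oppr_ge0// ltW.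
    have mt : 0 <= m * tau by rewrite mulr_ge0// ltW.
    by rewrite !max_l; [field|lra|lra|lra].
  have {}m1 : m < 0 by rewrite lt_neqAle m0.
  have [d0|d0] := leP 0 d.
    have md : m * d <= 0 by rewrite mulr_le0_ge0// ltW.
    rewrite [X in _ * (_ - X)]max_l; last by lra.
    have [area2|area2] := leP tau d.
      have mdt : m * (d - tau) <= 0 by rewrite mulr_le0_ge0 ?subr_ge0// ltW.
      by rewrite !max_l; [field| lra|lra].
    have mdt : m * (tau - d) <= 0 by rewrite mulr_le0_ge0 ?subr_ge0// ltW.
    by rewrite max_l ?subr0// max_r; [field|lra].
  have md : m * - d <= 0 by rewrite mulr_le0_ge0 ?oppr_ge0// ltW.
  have mt : m * tau <= 0 by rewrite mulr_le0_ge0// ltW.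
  have [area2|area2] := leP tau d; first by lra.
  by rewrite !max_r; [field|lra|lra|lra].
have [lh|hl] := leP lo hi.
  by rewrite L// max_l// subr_ge0.
rewrite set_itv_ge ?measure0; last by rewrite bnd_simp -ltNge.
by rewrite max_r// subr_le0 ltW.
Qed.

End TruncatedPower.

Lemma measurable_and4 d (T : measurableType d) (P Q S U : set T) :
  measurable P -> measurable Q -> measurable S -> measurable U ->
  measurable [set x | [/\ P x, Q x, S x & U x]].
Proof.
move=> mP mQ mS mU; rewrite (_ : [set x | _] = P `&` Q `&` S `&` U).
  by do 3 apply: measurableI => //.
by apply/seteqP; split => x; [case|case=> -[[]]].
Qed.

(** * Iterated integration over a truncated region *)

Section Nested.
Context (R : realType).
Variables al m1 m2 m3 r p0 p1 q0 q1 q2 : R.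
Let s2 := m2 - m3 * q2.
Let k1 := m1 - m3 * q1 - s2 * p1.
Let k2 := m1 - m3 * q1.
Let k3 := m1 - m2 * p1.

(** The upper bounds are triangular, so the variables can be integrated one by one, and a single
    half-space does the truncating. [s2] and [k2] are the slopes of its form once the last variable
    sits at its upper bound; [k1] and [k3] arise when the middle one does so as well. They become
    denominators. *)
Definition nested : set (M3 R) := [set t |
  [/\ 0 <= t.1.1, 0 <= t.1.2 & 0 <= t.2] /\
  [/\ t.1.1 <= r, t.1.2 <= p0 - p1 * t.1.1, t.2 <= q0 - q1 * t.1.1 - q2 * t.1.2 &
      0 <= al + m1 * t.1.1 + m2 * t.1.2 + m3 * t.2]].

Lemma measurable_nested : measurable nested.
Proof.
have m11 := @measurable_11 R.
have m12 := @measurable_12 R.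
have mZ (c : R) (f : M3 R -> M1 R) : measurable_fun setT f ->
  measurable_fun setT (fun t => c * f t : M1 R) by move=> mf; exact: measurable_funM.
apply: measurableI; first by apply: measurable_and3; apply: measurable_le_set.
apply: measurable_and4; apply: measurable_le_set => //.
- by apply: measurable_funB => //; exact: mZ.
- by apply: measurable_funB => //; [apply: measurable_funB => //|]; exact: mZ.
- by apply: measurable_funD; [apply: measurable_funD; [apply: measurable_funD|]|] => //; exact: mZ.
Qed.

Hypothesis r0 : 0 <= r.
Hypothesis rho0 : forall t1, 0 <= t1 -> t1 <= r -> 0 <= p0 - p1 * t1.
Hypothesis tau0 : forall t1 t2, 0 <= t1 -> t1 <= r -> 0 <= t2 ->
  t2 <= p0 - p1 * t1 -> 0 <= q0 - q1 * t1 - q2 * t2.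
Hypotheses (m30 : m3 != 0) (m20 : m2 != 0) (m10 : m1 != 0) (s20 : s2 != 0).
Hypotheses (k10 : k1 != 0) (k20 : k2 != 0) (k30 : k3 != 0).

Definition nested_vol : R :=
  m3^-1 * (
    (2 * s2)^-1 * ((3 * k1)^-1 * (ppow 3 (al + m3 * q0 + s2 * p0 + k1 * r) -
                                  ppow 3 (al + m3 * q0 + s2 * p0)) -
                   (3 * k2)^-1 * (ppow 3 (al + m3 * q0 + k2 * r) - ppow 3 (al + m3 * q0))) -
    (2 * m2)^-1 * ((3 * k3)^-1 * (ppow 3 (al + m2 * p0 + k3 * r) - ppow 3 (al + m2 * p0)) -
                   (3 * m1)^-1 * (ppow 3 (al + m1 * r) - ppow 3 al))).

Lemma leb3_nested : L3 nested = nested_vol%:E.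
Proof.
pose F1 t1 t2 := m3^-1 * ((2 * s2)^-1 * ppow 2 (al + m3 * q0 + k2 * t1 + s2 * t2) -
                         (2 * m2)^-1 * ppow 2 (al + m1 * t1 + m2 * t2)).
pose f1 t1 t2 := m3^-1 * (ppow 1 (al + m3 * q0 + k2 * t1 + s2 * t2) -
                         ppow 1 (al + m1 * t1 + m2 * t2)).
have P1 t1 : prim (F1 t1) (f1 t1) by apply: primZ; apply: primB; exact: prim_ppow.
pose f2 t1 := m3^-1 * (
   (2 * s2)^-1 * (ppow 2 (al + m3 * q0 + s2 * p0 + k1 * t1) -
                  ppow 2 (al + m3 * q0 + k2 * t1)) -
   (2 * m2)^-1 * (ppow 2 (al + m2 * p0 + k3 * t1) - ppow 2 (al + m1 * t1))).
pose F2 t1 := m3^-1 * (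
   (2 * s2)^-1 * ((3 * k1)^-1 * ppow 3 (al + m3 * q0 + s2 * p0 + k1 * t1) -
                  (3 * k2)^-1 * ppow 3 (al + m3 * q0 + k2 * t1)) -
   (2 * m2)^-1 * ((3 * k3)^-1 * ppow 3 (al + m2 * p0 + k3 * t1) -
                  (3 * m1)^-1 * ppow 3 (al + m1 * t1))).
have P2 : prim F2 f2.
  by apply: primZ; apply: primB; apply: primZ; apply: primB; exact: prim_ppow.
have F12 t1 : F1 t1 (p0 - p1 * t1) - F1 t1 0 = f2 t1.
  rewrite /F1 /f2 !mulr0 !addr0.
  have -> : al + m3 * q0 + k2 * t1 + s2 * (p0 - p1 * t1) =
    al + m3 * q0 + s2 * p0 + k1 * t1 by rewrite /k1 /k2 /s2; ring.
  have -> : al + m1 * t1 + m2 * (p0 - p1 * t1) = al + m2 * p0 + k3 * t1.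
    by rewrite /k3; ring.
  by ring.
have -> : nested_vol = F2 r - F2 0.
  by rewrite /F2 /nested_vol !mulr0 !addr0; ring.
rewrite -(integral_prim P2 r0).
apply: etrans (pm_xE _ _ _) _.
have mf : measurable_fun setT (fun p : M2 R => L1 [set y | nested (p, y)]).
  exact: (measurable_fun_xsec L1 measurable_nested).
have f0 (p : M2 R) : (0 <= L1 [set y | nested (p, y)])%E by exact: measure_ge0.
apply: etrans (@pm_fubini _ _ (M1 R) (M1 R) _ L1 L1 _ mf f0) _.
rewrite [RHS]integral_mkcond; apply: eq_integral => t1 _; rewrite patchE mem_setE in_itv/=.
case: ifP => [/andP[t10 t1r]|t1n]; last first.
  apply: integral0_eq => t2 _; rewrite (_ : [set y | _] = set0) ?measure0//.
  by apply/seteqP; split => // t3 [[/= h _ _] [h' _ _ _]]; rewrite h h' in t1n.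
rewrite -F12 -(integral_prim (P1 t1) (rho0 t10 t1r)).
rewrite [RHS]integral_mkcond; apply: eq_integral => t2 _; rewrite patchE mem_setE in_itv/=.
case: ifP => [/andP[t20 t2r]|t2n]; last first.
  rewrite (_ : [set y | _] = set0) ?measure0//.
  by apply/seteqP; split => // t3 [[/= _ h _] [_ h' _ _]]; rewrite h h' in t2n.
have := leb1_trunc (al + m1 * t1 + m2 * t2) (tau0 t10 t1r t20 t2r) m30.
rewrite (_ : al + m1 * t1 + m2 * t2 + m3 * (q0 - q1 * t1 - q2 * t2) =
  al + m3 * q0 + k2 * t1 + s2 * t2); last by rewrite /k2 /s2; ring.
move=> <-; congr (L1 _); apply/seteqP; split => t3 /=.
  by move=> [[_ _ h] [_ _ h1 h2]].
by move=> [h h1 h2].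
Qed.

End Nested.

(** * The basis functions near an edge *)

Section Cells.
Context (R : realType).
Local Notation o k := (@o6 k isT).

Definition aff (l : R * R * R) (p : @pt R) : R :=
  l.1.1 * p.1 + l.1.2 * p.2 + l.2 * (1 - p.1 - p.2).

Lemma cell_rows (xi : 'I_6 -> @pt R) (l0 l1 l2 : R * R * R) (c : seq R) X :
  area2 (xi (o 0)) (xi (o 1)) (xi (o 2)) != 0 ->
  [/\ aff l0 (xi (o 0)) = 1, aff l0 (xi (o 1)) = 0 & aff l0 (xi (o 2)) = 0] ->
  [/\ aff l1 (xi (o 0)) = 0, aff l1 (xi (o 1)) = 1 & aff l1 (xi (o 2)) = 0] ->
  [/\ aff l2 (xi (o 0)) = 0, aff l2 (xi (o 1)) = 0 & aff l2 (xi (o 2)) = 1] ->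
  [/\ aff l0 (xi (o 3)) = nth 0 c 0, aff l0 (xi (o 4)) = nth 0 c 1 & aff l0 (xi (o 5)) = nth 0 c 2] ->
  [/\ aff l1 (xi (o 3)) = nth 0 c 3, aff l1 (xi (o 4)) = nth 0 c 4 & aff l1 (xi (o 5)) = nth 0 c 5] ->
  [/\ aff l2 (xi (o 3)) = nth 0 c 6, aff l2 (xi (o 4)) = nth 0 c 7 & aff l2 (xi (o 5)) = nth 0 c 8] ->
  cell xi X = [set t |
  [/\ 0 <= t.1.1, 0 <= t.1.2 & 0 <= t.2] /\
  [/\ nth 0 c 0 * t.1.1 + nth 0 c 1 * t.1.2 + nth 0 c 2 * t.2 <= aff l0 X,
      nth 0 c 3 * t.1.1 + nth 0 c 4 * t.1.2 + nth 0 c 5 * t.2 <= aff l1 X &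
      nth 0 c 6 * t.1.1 + nth 0 c 7 * t.1.2 + nth 0 c 8 * t.2 <= aff l2 X]].
Proof.
move=> d0 [k00 k01 k02] [k10 k11 k12] [k20 k21 k22] [<- <- <-] [<- <- <-] [<- <- <-].
pose p0 := xi (o 0); pose p1 := xi (o 1); pose p2 := xi (o 2).
have key (l : R * R * R) q : aff l q * area2 p0 p1 p2 =
    aff l p0 * area2 q p1 p2 + aff l p1 * area2 p0 q p2 + aff l p2 * area2 p0 p1 q.
  by rewrite /aff /area2; ring.
have E0 q : area2 q p1 p2 / area2 p0 p1 p2 = aff l0 q.
  by rewrite -[RHS](mulfK d0) key k00 k01 k02 mul1r !mul0r !addr0.
have E1 q : area2 p0 q p2 / area2 p0 p1 p2 = aff l1 q.
  by rewrite -[RHS](mulfK d0) key k10 k11 k12 mul1r !mul0r addr0 add0r.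
have E2 q : area2 p0 p1 q / area2 p0 p1 p2 = aff l2 q.
  by rewrite -[RHS](mulfK d0) key k20 k21 k22 mul1r !mul0r !add0r.
by rewrite /cell -/p0 -/p1 -/p2 !E0 !E1 !E2.
Qed.

Definition seval (s : seq (R * (R * R * R))) X : R :=
  \sum_(e <- s) e.1 * ppow 3 (aff e.2 X).

(* The pairs (c, l) for which, close to the edge X3 = 0 of the reference
   triangle, V i X is the sum of the terms c * (l X)_+ ^+ 3; l lists the
   coefficients of a linear form in the barycentric coordinates. *)
Definition edge_terms (i : nat) : seq (R * (R * R * R)) :=
  match i with
  | 1 => [:: (1/6, (1, -2, -2))]
  | 2 => [:: (1/6, (-2, 1, -2))]
  | 4 => [:: (1/6, (1, -(1/2), -2)); (-(1/6), (1, -2, -2))]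
  | 7 => [:: (1/6, (-(1/2), 1, -2)); (-(1/6), (-2, 1, -2))]
  | 5 => [:: (1/6, (1, -2, -(1/2))); (-(1/6), (1, -2, -2))]
  | 6 => [:: (1/6, (-2, 1, -(1/2))); (-(1/6), (-2, 1, -2))]
  | 10 => [:: (1/4, (1, 0, -2)); (-(1/3), (1, -(1/2), -2)); (1/12, (1, -2, -2))]
  | 13 => [:: (1/4, (0, 1, -2)); (-(1/3), (-(1/2), 1, -2)); (1/12, (-2, 1, -2))]
  | 11 => [:: (1/4, (1, -2, 0)); (-(1/3), (1, -2, -(1/2))); (1/12, (1, -2, -2))]
  | 12 => [:: (1/4, (-2, 1, 0)); (-(1/3), (-2, 1, -(1/2))); (1/12, (-2, 1, -2))]
  | 16 => [:: (1/6, (1, -(1/2), -(1/2))); (-(1/6), (1, -(1/2), -2));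
              (-(1/6), (1, -2, -(1/2))); (1/6, (1, -2, -2))]
  | 17 => [:: (1/6, (-(1/2), 1, -(1/2))); (-(1/6), (-(1/2), 1, -2));
              (-(1/6), (-2, 1, -(1/2))); (1/6, (-2, 1, -2))]
  | 19 => [:: (3/8, (1, 0, 0)); (-(3/8), (1, 0, -2)); (-(1/3), (1, -(1/2), 1));
              (1/3, (1, -(1/2), -2)); (1/24, (1, -2, 4)); (-(1/24), (1, -2, -2))]
  | 22 => [:: (-(1/3), (1, -(1/2), -(1/2))); (1/6, (1, -(1/2), 1)); (1/6, (1, -(1/2), -2));
              (1/9, (1, -2, -(1/2))); (-(1/36), (1, -2, 4)); (-(1/12), (1, -2, -2))]
  | 25 => [:: (-(1/3), (-(1/2), 1, -(1/2))); (1/6, (-(1/2), 1, 1)); (1/6, (-(1/2), 1, -2));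
              (1/9, (-2, 1, -(1/2))); (-(1/36), (-2, 1, 4)); (-(1/12), (-2, 1, -2))]
  | 23 => [:: (2/9, (1, -(1/2), 1/4)); (-(1/3), (1, -(1/2), -(1/2))); (1/9, (1, -(1/2), -2));
              (-(1/12), (1, -2, 1)); (1/6, (1, -2, -(1/2))); (-(1/12), (1, -2, -2))]
  | 24 => [:: (2/9, (-(1/2), 1, 1/4)); (-(1/3), (-(1/2), 1, -(1/2))); (1/9, (-(1/2), 1, -2));
              (-(1/12), (-2, 1, 1)); (1/6, (-2, 1, -(1/2))); (-(1/12), (-2, 1, -2))]
  | 21 => [:: (-(3/8), (1, -2, 0)); (1/12, (1, -2, 1)); (1/3, (1, -2, -(1/2)));
              (-(1/24), (1, -2, -2))]
  | 20 => [:: (-(3/8), (-2, 1, 0)); (1/12, (-2, 1, 1)); (1/3, (-2, 1, -(1/2)));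
              (-(1/24), (-2, 1, -2))]
  | 26 => [:: (-(1/36), (2, -4, -1)); (1/12, (3/2, -3, 0)); (-(1/12), (1, -2, 1));
              (1/36, (1/2, -1, 2)); (1/48, (1, -2, -2))]
  | 27 => [:: (-(1/36), (-4, 2, -1)); (1/12, (-3, 3/2, 0)); (-(1/12), (-2, 1, 1));
              (1/36, (-1, 1/2, 2)); (1/48, (-2, 1, -2))]
  | 28 => [:: (1/12, (2, -1, -1)); (-(1/9), (2, -1, 1/2)); (1/24, (2, -1, 2));
              (-(1/72), (2, -1, -4)); (-(1/9), (-1, 2, 1/2)); (1/12, (-1, 2, -1));
              (1/24, (-1, 2, 2)); (-(1/72), (-1, 2, -4)); (-(9/8), (0, 0, 1))]
  | _ => [::]
  end.

(** The certificate format for one index: [l0], [l1], [l2] are the barycentric forms of the first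
    three knots, [c] their values at the last three, and the rest presents the cell as a [nested]
    region. *)
Lemma V_nested i (l0 l1 l2 : R * R * R) (c : seq R) X al m1 m2 m3 r p0 p1 q0 q1 q2 :
  [/\ aff l0 (gk R i (o 0)) = 1, aff l0 (gk R i (o 1)) = 0 & aff l0 (gk R i (o 2)) = 0] ->
  [/\ aff l1 (gk R i (o 0)) = 0, aff l1 (gk R i (o 1)) = 1 & aff l1 (gk R i (o 2)) = 0] ->
  [/\ aff l2 (gk R i (o 0)) = 0, aff l2 (gk R i (o 1)) = 0 & aff l2 (gk R i (o 2)) = 1] ->
  [/\ aff l0 (gk R i (o 3)) = nth 0 c 0, aff l0 (gk R i (o 4)) = nth 0 c 1 & aff l0 (gk R i (o 5)) = nth 0 c 2] ->
  [/\ aff l1 (gk R i (o 3)) = nth 0 c 3, aff l1 (gk R i (o 4)) = nth 0 c 4 & aff l1 (gk R i (o 5)) = nth 0 c 5] ->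
  [/\ aff l2 (gk R i (o 3)) = nth 0 c 6, aff l2 (gk R i (o 4)) = nth 0 c 7 & aff l2 (gk R i (o 5)) = nth 0 c 8] ->
  (forall u v w : R, 0 <= u -> 0 <= v -> 0 <= w ->
    [/\ nth 0 c 0 * u + nth 0 c 1 * v + nth 0 c 2 * w <= aff l0 X,
        nth 0 c 3 * u + nth 0 c 4 * v + nth 0 c 5 * w <= aff l1 X &
        nth 0 c 6 * u + nth 0 c 7 * v + nth 0 c 8 * w <= aff l2 X] <->
    [/\ u <= r, v <= p0 - p1 * u, w <= q0 - q1 * u - q2 * v &
        0 <= al + m1 * u + m2 * v + m3 * w]) ->
  0 <= r ->
  (forall u, 0 <= u -> u <= r -> 0 <= p0 - p1 * u) ->
  (forall u v, 0 <= u -> u <= r -> 0 <= v -> v <= p0 - p1 * u -> 0 <= q0 - q1 * u - q2 * v) ->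
  [/\ m3 != 0, m2 != 0, m1 != 0 & m2 - m3 * q2 != 0] ->
  [/\ m1 - m3 * q1 - (m2 - m3 * q2) * p1 != 0, m1 - m3 * q1 != 0 & m1 - m2 * p1 != 0] ->
  V i X = nested_vol al m1 m2 m3 r p0 p1 q0 q1 q2.
Proof.
move=> h0 h1 h2 h3 h4 h5 eqv r0 rho0 tau0 [m30 m20 m10 s20] [k10 k20 k30].
have d0 := gk_det R i.
rewrite /V (cell_rows X d0 h0 h1 h2 h3 h4 h5).
rewrite (_ : [set t | _] = nested al m1 m2 m3 r p0 p1 q0 q1 q2).
  by rewrite leb3_nested.
apply/seteqP; split => -[[u v] w] [[/= u0 v0 w0]] /(eqv _ _ _ u0 v0 w0) h; by split.
Qed.

End Cells.

Ltac ppow0 := repeat match goal with |- context [ppow 3 ?x] =>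
  rewrite (@ppow_le _ 2 x); [|lra] end.
Ltac ppow_eq := repeat match goal with |- context [ppow 3 ?x] =>
  match goal with |- context [ppow 3 ?y] =>
    tryif constr_eq x y then fail else
    (let H := fresh in assert (H : y = x) by (clear; by field); rewrite H; clear H) end end.

Ltac gk_eq := split; rewrite /aff /gk /pfun /knots /= /comb2 /padd /pscale /e1 /e2 /e3 /=; lra.
Ltac num_neq := split; apply/eqP => ?; lra.
(** In the main goal, truncated powers with nonpositive argument are dropped and equal arguments are
    unified; what remains is a rational identity in which the powers are atoms. *)
Ltac V_tac_with pre l0 l1 l2 c al m1 m2 m3 r p0 p1 q0 q1 q2 :=
  rewrite (@V_nested _ _ l0 l1 l2 c _ al m1 m2 m3 r p0 p1 q0 q1 q2);
  [rewrite /nested_vol /seval /aff /= ?big_cons ?big_nil /=; pre; try ppow0; ppow_eq; field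
  |gk_eq|gk_eq|gk_eq|gk_eq|gk_eq|gk_eq
  |move=> u v w u0 v0 w0; rewrite /aff /=; split => -[h h' h'']; [split|move=> h''']; try split; lra
  |try lra|try (move=> u u0 ur; lra)|try (move=> u v u0 ur v0 vr; lra)|try num_neq|try num_neq]; try done.
Ltac V_tac := V_tac_with ltac:(idtac).

(** * Closed forms, one index of each mirror pair *)

Section Types.
Context (R : realType).
Local Notation o k := (@o6 k isT).

Lemma V_1 (X : @pt R) : 0 <= X.2 -> 0 <= 1 - X.1 - X.2 ->
  V 1 X = seval (edge_terms R 1) X.
Proof.
case: X => X1 X2 /=; move=> h2 h3.
(* The bounds 2 are dummies: at them the truncating form is already negative, so the corresponding
   powers vanish. *)
V_tac ((1, -2, -2) : R * R * R) ((0, 3, 0) : R * R * R) ((0, 0, 3) : R * R * R)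
  ([:: 1; 1; 1; 0; 0; 0; 0; 0; 0] : seq R)
  (3 * X1 - 2) (-1 : R) (-1 : R) (-1 : R)  (2 : R) (2 : R) (0 : R) (2 : R) (0 : R) (0 : R).
Qed.

Lemma V_4 (X : @pt R) : 0 <= X.2 -> 0 <= 1 - X.1 - X.2 ->
  V 4 X = seval (edge_terms R 4) X.
Proof.
case: X => X1 X2 /=; move=> h2 h3.
V_tac ((1, -2, -2) : R * R * R) ((0, 3, 0) : R * R * R) ((0, 0, 3) : R * R * R)
  ([:: -1; 1; 1; 2; 0; 0; 0; 0; 0] : seq R)
  (3 * X1 - 2) (1 : R) (-1 : R) (-1 : R)  ((3 * X2) / 2) (2 : R) (0 : R) (2 : R) (0 : R) (0 : R).
Qed.

Lemma V_5 (X : @pt R) : 0 <= X.2 -> 0 <= 1 - X.1 - X.2 ->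
  V 5 X = seval (edge_terms R 5) X.
Proof.
case: X => X1 X2 /=; move=> h2 h3.
V_tac ((1, -2, -2) : R * R * R) ((0, 3, 0) : R * R * R) ((0, 0, 3) : R * R * R)
  ([:: -1; 1; 1; 0; 0; 0; 2; 0; 0] : seq R)
  (3 * X1 - 2) (1 : R) (-1 : R) (-1 : R)  ((3 * (1 - X1 - X2)) / 2) (2 : R) (0 : R) (2 : R) (0 : R) (0 : R).
Qed.

Lemma V_10 (X : @pt R) : 0 <= X.2 -> 0 <= 1 - X.1 - X.2 ->
  V 10 X = seval (edge_terms R 10) X.
Proof.
case: X => X1 X2 /=; move=> h2 h3.
V_tac ((1, -2, -2) : R * R * R) ((0, 3, 0) : R * R * R) ((0, 0, 3) : R * R * R)
  ([:: -2; -1; 1; 3; 2; 0; 0; 0; 0] : seq R)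
  (3 * X1 - 2) (2 : R) (1 : R) (-1 : R)  ((3 * X2) / 3) ((3 * X2) / 2) (3 / 2 : R) (2 : R) (0 : R) (0 : R).
Qed.

Lemma V_11 (X : @pt R) : 0 <= X.2 -> 0 <= 1 - X.1 - X.2 ->
  V 11 X = seval (edge_terms R 11) X.
Proof.
case: X => X1 X2 /=; move=> h2 h3.
V_tac ((1, -2, -2) : R * R * R) ((0, 3, 0) : R * R * R) ((0, 0, 3) : R * R * R)
  ([:: -2; -1; 1; 0; 0; 0; 3; 2; 0] : seq R)
  (3 * X1 - 2) (2 : R) (1 : R) (-1 : R)  ((3 * (1 - X1 - X2)) / 3) ((3 * (1 - X1 - X2)) / 2) (3 / 2 : R) (2 : R) (0 : R) (0 : R).
Qed.

Lemma V_16 (X : @pt R) : 0 <= X.2 -> 0 <= 1 - X.1 - X.2 ->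
  V 16 X = seval (edge_terms R 16) X.
Proof.
case: X => X1 X2 /=; move=> h2 h3.
V_tac ((1, -2, -2) : R * R * R) ((0, 3, 0) : R * R * R) ((0, 0, 3) : R * R * R)
  ([:: -1; -1; 1; 0; 2; 0; 2; 0; 0] : seq R)
  (3 * X1 - 2) (1 : R) (1 : R) (-1 : R)  ((3 * (1 - X1 - X2)) / 2) ((3 * X2) / 2) (0 : R) (2 : R) (0 : R) (0 : R).
Qed.

Lemma V_19 (X : @pt R) : 0 <= 1 - X.1 - X.2 -> 8 * (1 - X.1 - X.2) < X.1 -> 8 * (1 - X.1 - X.2) < X.2 ->
  V 19 X = seval (edge_terms R 19) X.
Proof.
case: X => X1 X2 /=; move=> h3 h1 h2.
(* The row [2 u + 3 v + 2 w <= 3 X2] bounds [w]. The bound on [v] is its consequence for [w >= 0];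
   it stays nonnegative for [u <= 3 X3] because X3 is small against X2. *)
V_tac ((1, -2, -2) : R * R * R) ((0, 3, 0) : R * R * R) ((0, 0, 3) : R * R * R)
  ([:: -2; -2; -1; 2; 3; 2; 1; 0; 0] : seq R)
  (3 * X1 - 2) (2 : R) (2 : R) (1 : R)  ((3 * (1 - X1 - X2))) ((3 * X2) / 3) (2 / 3 : R) ((3 * X2) / 2) (1 : R) (3 / 2 : R).
Qed.

Lemma V_21 (X : @pt R) : 0 <= 1 - X.1 - X.2 -> 8 * (1 - X.1 - X.2) < X.1 -> 8 * (1 - X.1 - X.2) < X.2 ->
  V 21 X = seval (edge_terms R 21) X.
Proof.
case: X => X1 X2 /=; move=> h3 h1 h2.
V_tac ((1, -2, -2) : R * R * R) ((0, 3, 0) : R * R * R) ((0, 0, 3) : R * R * R)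
  ([:: -2; -2; -1; 0; 1; 0; 3; 2; 2] : seq R)
  (3 * X1 - 2) (2 : R) (2 : R) (1 : R)  ((3 * (1 - X1 - X2)) / 3) ((3 * (1 - X1 - X2)) / 2) (3 / 2 : R) ((3 * (1 - X1 - X2)) / 2) (3 / 2 : R) (1 : R).
Qed.

Lemma V_22 (X : @pt R) : 0 <= 1 - X.1 - X.2 -> 8 * (1 - X.1 - X.2) < X.1 -> 8 * (1 - X.1 - X.2) < X.2 ->
  V 22 X = seval (edge_terms R 22) X.
Proof.
case: X => X1 X2 /=; move=> h3 h1 h2.
V_tac ((1, -2, -2) : R * R * R) ((0, 3, 0) : R * R * R) ((0, 0, 3) : R * R * R)
  ([:: -1; -2; -1; 0; 2; 2; 2; 1; 0] : seq R)
  (3 * X1 - 2) (1 : R) (2 : R) (1 : R)  ((3 * (1 - X1 - X2)) / 2) ((3 * (1 - X1 - X2))) (2 : R) ((3 * X2) / 2) (0 : R) (1 : R).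
Qed.

Lemma V_23 (X : @pt R) : 0 <= 1 - X.1 - X.2 -> 8 * (1 - X.1 - X.2) < X.1 -> 8 * (1 - X.1 - X.2) < X.2 ->
  V 23 X = seval (edge_terms R 23) X.
Proof.
case: X => X1 X2 /=; move=> h3 h1 h2.
V_tac ((1, -2, -2) : R * R * R) ((0, 3, 0) : R * R * R) ((0, 0, 3) : R * R * R)
  ([:: -2; -1; -1; 1; 0; 2; 2; 2; 0] : seq R)
  (3 * X1 - 2) (2 : R) (1 : R) (1 : R)  ((3 * (1 - X1 - X2)) / 2) ((3 * (1 - X1 - X2)) / 2) (1 : R) ((3 * X2) / 2) (1 / 2 : R) (0 : R).
Qed.

End Types.

Ltac ppowge := repeat match goal with |- context [ppow 3 ?x] =>
  rewrite (@ppow_ge _ 3 x); [|lra] end.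
Ltac V_tac' := V_tac_with ltac:(try ppowge).

Section Types2.
Context (R : realType).
Local Notation o k := (@o6 k isT).

Lemma V_26 (X : @pt R) : 0 <= 1 - X.1 - X.2 -> 8 * (1 - X.1 - X.2) < X.1 ->
  8 * (1 - X.1 - X.2) < X.2 -> V 26 X = seval (edge_terms R 26) X.
Proof.
(* A row of the cell reads [2 (u + v + w) <= 2 - 3 X1]. Past [X1 = 2/3] the cell is empty, and there
   all powers are genuine cubes whose sum is identically 0. *)
case: X => X1 X2 /= h3 h1 h2; have [g0|g0] := leP 0 (2 - 3 * X1).
  V_tac ((0, 3, 0) : R * R * R) ((2, -4, -1) : R * R * R) ((-1, 2, 2) : R * R * R)
    ([:: 0; 1; 2; -1; -2; -3; 2; 2; 2] : seq R)
    (3 * X1 - 3 * X2 - 1) (1 : R) (2 : R) (3 : R) ((2 - 3 * X1) / 2) ((2 - 3 * X1) / 2) (1 : R)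
    ((2 - 3 * X1) / 2) (1 : R) (1 : R).
have -> : V 26 (X1, X2) = 0.
  have d0 := gk_det R 26.
  rewrite /V (@cell_rows _ _ (0, 3, 0) (2, -4, -1) (-1, 2, 2) [:: 0; 1; 2; -1; -2; -3; 2; 2; 2])//.
  - rewrite (_ : [set t | _] = set0) ?measure0//.
    by apply/seteqP; split => // -[[u v] w] [[/= u0 v0 w0]]; rewrite /aff /= => -[_ _ h]; lra.
  - by gk_eq.
  - by gk_eq.
  - by gk_eq.
  - by gk_eq.
  - by gk_eq.
  - by gk_eq.
by rewrite /seval /aff /= !big_cons big_nil /=; ppowge; field.
Qed.

Lemma V_28 (X : @pt R) : 0 <= 1 - X.1 - X.2 -> 8 * (1 - X.1 - X.2) < X.1 ->
  8 * (1 - X.1 - X.2) < X.2 -> V 28 X = seval (edge_terms R 28) X.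
Proof.
(* Two rows compete for the role of the truncating half-space. Close to the edge one of them always
   holds: the first if [6 X1 + 3 X2 - 4 >= 0], the second otherwise. *)
case: X => X1 X2 /= h3 h1 h2; have [g0|g0] := leP 0 (6 * X1 + 3 * X2 - 4).
  V_tac' ((2, -1, -4) : R * R * R) ((-1, 2, 2) : R * R * R) ((0, 0, 3) : R * R * R)
    ([:: -2; -3; -2; 1; 2; 2; 2; 2; 1] : seq R)
    (2 - 3 * X1) (-1 : R) (-2 : R) (-2 : R) (3 * (1 - X1 - X2) / 2) (3 * (1 - X1 - X2) / 2) (1 : R)
    (3 * (1 - X1 - X2)) (2 : R) (2 : R).
V_tac' ((2, -1, -4) : R * R * R) ((-1, 2, 2) : R * R * R) ((0, 0, 3) : R * R * R)
  ([:: -2; -3; -2; 1; 2; 2; 2; 2; 1] : seq R)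
  (6 * X1 + 3 * X2 - 4) (2 : R) (3 : R) (2 : R) (3 * (1 - X1 - X2) / 2) (3 * (1 - X1 - X2) / 2) (1 : R)
  (3 * (1 - X1 - X2)) (2 : R) (2 : R).
Qed.

End Types2.

(** * Exchange of the two vertices of the edge *)

Section Mirror.
Context (R : realType).
Local Notation o k := (@o6 k isT).

Definition swap (X : @pt R) : @pt R := (X.2, X.1).

Lemma V_swap i i' X : (forall k, gk R i' k = swap (gk R i k)) -> V i' (swap X) = V i X.
Proof.
move=> h.
have sE p : amap (e2 R) (e1 R) (e3 R) p = swap p.
  by rewrite /amap /comb3 /comb2 /padd /pscale /swap /=; congr (_, _); ring.
have d0 : area2 (e2 R) (e1 R) (e3 R) != 0.
  by rewrite /area2 /= (_ : _ - _ = -1) ?oppr_eq0 ?oner_eq0//; ring.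
rewrite /V -sE -(cell_amap (gk R i) X d0).
rewrite (_ : gk R i' = amap (e2 R) (e1 R) (e3 R) \o gk R i)//.
by apply/funext => k; rewrite h /= sE.
Qed.

(** [ptab] is arranged so that exchanging the first two vertices takes the reordered knots of [i] to
    those of [i'] position by position. *)
Lemma V_mirror i i' X : (i, i') \in [:: (1, 2); (4, 7); (5, 6); (10, 13); (11, 12); (16, 17);
    (21, 20); (22, 25); (23, 24); (26, 27)]%N -> V i' X = V i (swap X).
Proof.
have XE : swap (swap X) = X by case: X.
move=> h; rewrite -{1}XE; apply: V_swap.
move: h; rewrite !inE => h.
by do 9?[case/orP: h => h]; case/eqP: h => -> -> k;
  rewrite !gkE; case: k => -[|[|[|[|[|[|//]]]]]] /= _;
  rewrite /swap /comb2 /padd /pscale /e1 /e2 /e3 /=; congr (_, _); ring.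
Qed.

End Mirror.

(** * Vanishing and bounds without closed forms *)

Section Bounds.
Context (R : realType).
Local Notation o k := (@o6 k isT).

Lemma aff_bary (l : R * R * R) (p0 p1 p2 q : @pt R) : area2 p0 p1 p2 != 0 ->
  aff l q = area2 q p1 p2 / area2 p0 p1 p2 * aff l p0 + area2 p0 q p2 / area2 p0 p1 p2 * aff l p1 +
    area2 p0 p1 q / area2 p0 p1 p2 * aff l p2.
Proof.
move=> d0; have key : aff l q * area2 p0 p1 p2 =
    aff l p0 * area2 q p1 p2 + aff l p1 * area2 p0 q p2 + aff l p2 * area2 p0 p1 q.
  by rewrite /aff /area2; ring.
rewrite -[LHS](mulfK d0) key mulrDl mulrDl (mulrC (aff l p0)) (mulrC (aff l p1)).
by rewrite (mulrC (aff l p2)) !(mulrAC _ (aff l _)).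
Qed.

Lemma cell_aff (xi : 'I_6 -> @pt R) X t :
  area2 (xi (o 0)) (xi (o 1)) (xi (o 2)) != 0 -> cell xi X t ->
  [/\ 0 <= t.1.1, 0 <= t.1.2 & 0 <= t.2] /\
  exists c0 c1 c2 : R, [/\ 0 <= c0, 0 <= c1 & 0 <= c2] /\
  forall l, aff l X = c0 * aff l (xi (o 0)) + c1 * aff l (xi (o 1)) + c2 * aff l (xi (o 2)) +
    t.1.1 * aff l (xi (o 3)) + t.1.2 * aff l (xi (o 4)) + t.2 * aff l (xi (o 5)).
Proof.
move=> d0 [t0]; split => //; move: b; rewrite /=.
pose p0 := xi (o 0); pose p1 := xi (o 1); pose p2 := xi (o 2).
rewrite -/p0 -/p1 -/p2 in d0 *.
set D := area2 p0 p1 p2 in d0 *; move=> [h0 h1 h2].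
exists (area2 X p1 p2 / D - (area2 (xi (o 3)) p1 p2 / D * t.1.1 + area2 (xi (o 4)) p1 p2 / D * t.1.2 +
                          area2 (xi (o 5)) p1 p2 / D * t.2)).
exists (area2 p0 X p2 / D - (area2 p0 (xi (o 3)) p2 / D * t.1.1 + area2 p0 (xi (o 4)) p2 / D * t.1.2 +
                          area2 p0 (xi (o 5)) p2 / D * t.2)).
exists (area2 p0 p1 X / D - (area2 p0 p1 (xi (o 3)) / D * t.1.1 + area2 p0 p1 (xi (o 4)) / D * t.1.2 +
                          area2 p0 p1 (xi (o 5)) / D * t.2)).
split; first by rewrite !subr_ge0.
move=> l.
have key q := aff_bary l q d0.
by rewrite (key X) (key (xi (o 3))) (key (xi (o 4))) (key (xi (o 5))); ring.
Qed.

(** The form separates [X] from the knots: a point of the cell would write [aff l X] as a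
    nonnegative combination of nonpositive numbers. *)
Lemma V_eq0 i l (X : @pt R) : (forall k, aff l (gk R i k) <= 0) -> 0 < aff l X -> V i X = 0.
Proof.
move=> hl lX; rewrite /V (_ : cell _ _ = set0) ?measure0//.
apply/seteqP; split => // t /(cell_aff (gk_det R i))[[t1 t2 t3] [c0 [c1 [c2 [[h0 h1 h2] E]]]]].
suff : aff l X <= 0 by rewrite leNgt lX.
have g0 := mulr_ge0_le0 h0 (hl (o 0)); have g1 := mulr_ge0_le0 h1 (hl (o 1)).
have g2 := mulr_ge0_le0 h2 (hl (o 2)); have g3 := mulr_ge0_le0 t1 (hl (o 3)).
have g4 := mulr_ge0_le0 t2 (hl (o 4)); have g5 := mulr_ge0_le0 t3 (hl (o 5)).
rewrite E; lra.
Qed.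

Lemma V_ge0 i (X : @pt R) : (0 <= V i X :> R).
Proof. by rewrite /V fine_ge0. Qed.

(** The cell lies in a box. Its coordinates are weights, hence at most 1, and the first belongs to a
    knot of height at least 1/3, hence is at most three times the height of [X]. *)
Lemma V_bound i (X : @pt R) : (forall k, 0 <= aff (0, 0, 1) (gk R i k)) ->
  3^-1 <= aff (0, 0, 1) (gk R i (o 3)) -> 0 <= aff (0, 0, 1) X ->
  V i X <= 3 * aff (0, 0, 1) X.
Proof.
move=> h h3 X0; set b := aff _ X in X0 *.
pose I (r : R) : set (M1 R) := `[0, r]%classic.
have mI r : measurable (I r) by exact: measurable_itv.
have mI2 : measurable (I (3 * b) `*` I 1) by exact: measurableX.
have E (r : R) : 0 <= r -> L1 (I r) = r%:E.
  rewrite le_eqVlt => /predU1P[<-|r0]; first by rewrite /I set_itv1 lebesgue_measure_set1.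
  by rewrite lebesgue_measure_itv/= lte_fin r0 oppr0 adde0.
have b3 : 0 <= 3 * b by rewrite mulr_ge0.
have EB : L3 ((I (3 * b) `*` I 1) `*` I 1) = (3 * b)%:E.
  apply: etrans (pm_setX _ _ mI2 (mI 1)) (etrans (congr2 mule _ (E 1 ler01)) (mule1 _)).
  exact: etrans (pm_setX _ _ (mI (3 * b)) (mI 1)) (etrans (congr2 mule (E _ b3) (E 1 ler01)) (mule1 _)).
have sub : cell (gk R i) X `<=` (I (3 * b) `*` I 1) `*` I 1.
  move=> -[[u v] w] /(cell_aff (gk_det R i))[[/= t1 t2 t3] [c0 [c1 [c2 [[h0 h1 h2] EX]]]]].
  have := EX (1, 1, 1); have := EX (0, 0, 1); rewrite -/b.
  have one q : aff (1, 1, 1) q = 1 :> R by rewrite /aff /=; ring.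
  rewrite !one => e1 e2.
  have ub : u * 3^-1 <= b.
    have p0 := mulr_ge0 h0 (h (o 0)); have p1 := mulr_ge0 h1 (h (o 1)).
    have p2 := mulr_ge0 h2 (h (o 2)); have p4 := mulr_ge0 t2 (h (o 4)).
    have p5 := mulr_ge0 t3 (h (o 5)); have p3 := ler_wpM2l t1 h3.
    rewrite e1; lra.
  by split; [split|]; rewrite /I /= in_itv/=; apply/andP; split => //; lra.
have le : (L3 (cell (gk R i) X) <= (3 * b)%:E)%E.
  rewrite -EB; apply: le_measure => //; rewrite inE.
    exact: measurable_cell.
  exact: measurableX.
by rewrite /V -[leRHS]/(fine (3 * b)%:E) fine_le// ge0_fin_numE// (le_lt_trans le) ?ltry.
Qed.

Lemma V_zero i (X : @pt R) : i \in [:: 3; 8; 9; 14; 15; 18]%N ->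
  0 < aff (1, 0, -2) X -> 0 < aff (0, 1, -2) X -> V i X = 0.
Proof.
(* Only index 14 has [v1] among its knots, where [X1 - 2 X3] is positive; there [X2 - 2 X3]
   separates. *)
move=> hi h1 h2; have [i14|i14] := eqVneq i 14%N.
  apply: (V_eq0 _ h2) => k; rewrite gkE i14; case: k => -[|[|[|[|[|[|//]]]]]] /= _;
    by rewrite /aff /comb2 /padd /pscale /e1 /e2 /e3 /=; lra.
apply: (V_eq0 _ h1) => k; rewrite gkE; move: hi; rewrite !inE (negbTE i14) /=.
case/or4P => [/eqP ->|/eqP ->|/eqP ->|/orP[]/eqP ->];
  case: k => -[|[|[|[|[|[|//]]]]]] /= _;
  by rewrite /aff /comb2 /padd /pscale /e1 /e2 /e3 /=; lra.
Qed.

(** Outside the six listed indices at least two knots, with multiplicity, lie off the edge. [ptab]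
    places one of them fourth, as [V_bound] demands. *)
Lemma V_bound_interior i (X : @pt R) : (1 <= i <= 28)%N -> i \notin [:: 1; 2; 4; 7; 10; 13]%N ->
  0 <= aff (0, 0, 1) X -> V i X <= 3 * aff (0, 0, 1) X.
Proof.
move=> hi ni; apply: V_bound; first move=> k; rewrite gkE; move: ni hi.
  do 29?[case: i => [|i] //]; move=> _ _; case: k => -[|[|[|[|[|[|//]]]]]] /= _;
  by rewrite /aff /comb2 /padd /pscale /e1 /e2 /e3 /=; lra.
do 29?[case: i => [|i] //]; move=> _ _;
  by rewrite /aff /comb2 /padd /pscale /e1 /e2 /e3 /=; lra.
Qed.

End Bounds.

Section Explicit.
Context (R : realType).

Lemma seval_mirror i i' (X : @pt R) : (i, i') \in [:: (1, 2); (4, 7); (5, 6); (10, 13); (11, 12);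
    (16, 17); (21, 20); (22, 25); (23, 24); (26, 27)]%N ->
  seval (edge_terms R i') X = seval (edge_terms R i) (swap X).
Proof.
move=> h; have -> : edge_terms R i' = [seq (e.1, ((e.2.1.2, e.2.1.1), e.2.2)) | e <- edge_terms R i].
  by move: h; rewrite !inE; do 9?[case/orP]; case/eqP => -> ->.
rewrite /seval big_map; apply: eq_bigr => e _; rewrite /aff /swap /=; congr (_ * ppow _ _); ring.
Qed.

Lemma V_mirrorE i i' (X : @pt R) : (i, i') \in [:: (1, 2); (4, 7); (5, 6); (10, 13); (11, 12);
    (16, 17); (21, 20); (22, 25); (23, 24); (26, 27)]%N ->
  V i (swap X) = seval (edge_terms R i) (swap X) -> V i' X = seval (edge_terms R i') X.
Proof. by move=> h; rewrite (V_mirror X h) (seval_mirror X h). Qed.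

(** Valid in the whole triangle, so also around the ends of the edge, where the region of
    [V_near_edge] pinches. *)
Lemma V_edge (X : @pt R) i : i \in [:: 1; 2; 4; 7; 10; 13]%N ->
  0 <= X.1 -> 0 <= X.2 -> 0 <= 1 - X.1 - X.2 -> V i X = seval (edge_terms R i) X.
Proof.
move=> hi h1 h2 h3; have h3' : 0 <= 1 - (swap X).1 - (swap X).2 by rewrite /swap /=; lra.
move: hi; rewrite !inE => /or4P[/eqP->|/eqP->|/eqP->|/or3P[]/eqP->].
- exact: V_1.
- by apply: (@V_mirrorE 1) => //; exact: V_1.
- exact: V_4.
- by apply: (@V_mirrorE 4) => //; exact: V_4.
- exact: V_10.
- by apply: (@V_mirrorE 10) => //; exact: V_10.
Qed.

Lemma V_near_edge (X : @pt R) i : (1 <= i < 29)%N ->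
  0 <= 1 - X.1 - X.2 -> 8 * (1 - X.1 - X.2) < X.1 -> 8 * (1 - X.1 - X.2) < X.2 ->
  V i X = seval (edge_terms R i) X.
Proof.
move=> hi h3 h1 h2.
have h3' : 0 <= 1 - (swap X).1 - (swap X).2 by rewrite /swap /=; lra.
have h1' : 8 * (1 - (swap X).1 - (swap X).2) < (swap X).1 by rewrite /swap /=; lra.
have h2' : 8 * (1 - (swap X).1 - (swap X).2) < (swap X).2 by rewrite /swap /=; lra.
have X1 : 0 <= X.1 by lra.
have X2 : 0 <= X.2 by lra.
have z1 : 0 < aff (1, 0, -2) X by rewrite /aff /=; lra.
have z2 : 0 < aff (0, 1, -2) X by rewrite /aff /=; lra.
have Z j : j \in [:: 3; 8; 9; 14; 15; 18]%N -> edge_terms R j = [::] -> V j X = seval (edge_terms R j) X.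
  by move=> hj ->; rewrite /seval big_nil V_zero.
have M j j' := @V_mirrorE j j' X.
case: i hi => // -[|[|[|[|[|[|[|[|[|[|[|[|[|[|[|[|[|[|[|[|[|[|[|[|[|[|[|[|//]]]]]]]]]]]]]]]]]]]]]]]]]]]] _.
- exact: V_1.
- by apply: (M 1%N) => //; exact: V_1.
- exact: Z.
- exact: V_4.
- exact: V_5.
- by apply: (M 5%N) => //; exact: V_5.
- by apply: (M 4%N) => //; exact: V_4.
- exact: Z.
- exact: Z.
- exact: V_10.
- exact: V_11.
- by apply: (M 11%N) => //; exact: V_11.
- by apply: (M 10%N) => //; exact: V_10.
- exact: Z.
- exact: Z.
- exact: V_16.
- by apply: (M 16%N) => //; exact: V_16.
- exact: Z.
- exact: V_19.
- by apply: (M 21%N) => //; exact: V_21.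
- exact: V_21.
- exact: V_22.
- exact: V_23.
- by apply: (M 23%N) => //; exact: V_23.
- by apply: (M 22%N) => //; exact: V_22.
- exact: V_26.
- by apply: (M 26%N) => //; exact: V_26.
- exact: V_28.
Qed.

End Explicit.

(** * Barycentric coordinates and the splines near the common edge *)

Section Barycentric.
Context (R : realType).
Implicit Types (x X v : @pt R).

Definition bary (v1 v2 v3 : @pt R) x : @pt R :=
  (area2 x v2 v3 / area2 v1 v2 v3, area2 v1 x v3 / area2 v1 v2 v3).

Definition third X : R := 1 - X.1 - X.2.

Lemma amapK (v1 v2 v3 : @pt R) : area2 v1 v2 v3 != 0 -> cancel (amap v1 v2 v3) (bary v1 v2 v3).
Proof.
move=> D0 [X1 X2]; rewrite /bary.
have E1 : area2 (amap v1 v2 v3 (X1, X2)) v2 v3 = X1 * area2 v1 v2 v3.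
  by rewrite /area2 /amap /comb3 /comb2 /padd /pscale /=; ring.
have E2 : area2 v1 (amap v1 v2 v3 (X1, X2)) v3 = X2 * area2 v1 v2 v3.
  by rewrite /area2 /amap /comb3 /comb2 /padd /pscale /=; ring.
by rewrite E1 E2 !mulfK.
Qed.

Lemma baryK (v1 v2 v3 : @pt R) : area2 v1 v2 v3 != 0 -> cancel (bary v1 v2 v3) (amap v1 v2 v3).
Proof.
move=> D0 [x1 x2]; rewrite /amap /comb3 /comb2 /padd /pscale /bary /=.
by move: D0; rewrite /area2 /= => D0; congr (_, _); field.
Qed.

Lemma triP (v1 v2 v3 : @pt R) x : area2 v1 v2 v3 != 0 ->
  tri v1 v2 v3 x <->
  [/\ 0 <= (bary v1 v2 v3 x).1, 0 <= (bary v1 v2 v3 x).2 & 0 <= third (bary v1 v2 v3 x)].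
Proof.
move=> D0; split=> [[a [b [c [a0 [b0 [c0 [abc ->]]]]]]]|[h1 h2 h3]].
  have E : 1 - a - b = c by lra.
  have -> : comb3 a v1 b v2 c v3 = amap v1 v2 v3 (a, b) by rewrite /amap /= E.
  by rewrite amapK// /third /=; split => //; lra.
exists (bary v1 v2 v3 x).1, (bary v1 v2 v3 x).2, (third (bary v1 v2 v3 x)).
do 3!split => //; split; last by rewrite -[LHS](baryK D0).
by rewrite /third; lra.
Qed.

Lemma otriP (v1 v2 v3 : @pt R) x : area2 v1 v2 v3 != 0 ->
  otri v1 v2 v3 x <->
  [/\ 0 < (bary v1 v2 v3 x).1, 0 < (bary v1 v2 v3 x).2 & 0 < third (bary v1 v2 v3 x)].
Proof.
move=> D0; split=> [[a [b [c [a0 [b0 [c0 [abc ->]]]]]]]|[h1 h2 h3]].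
  have E : 1 - a - b = c by lra.
  have -> : comb3 a v1 b v2 c v3 = amap v1 v2 v3 (a, b) by rewrite /amap /= E.
  by rewrite amapK// /third /=; split => //; lra.
exists (bary v1 v2 v3 x).1, (bary v1 v2 v3 x).2, (third (bary v1 v2 v3 x)).
do 3!split => //; split; last by rewrite -[LHS](baryK D0).
by rewrite /third; lra.
Qed.

Lemma bary_edge (v1 v2 v3 : @pt R) t : area2 v1 v2 v3 != 0 ->
  bary v1 v2 v3 (comb2 (1 - t) v1 t v2) = (1 - t, t).
Proof.
move=> D0; have <- : amap v1 v2 v3 (1 - t, t) = comb2 (1 - t) v1 t v2.
  by rewrite /amap /comb3 /comb2 /padd /pscale /=; congr (_, _); ring.
exact: amapK.
Qed.

(** Barycentric coordinates of a direction. They are evaluated at [v3 + v] because the first two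
    coordinates vanish at [v3]; the implicit third one is minus their sum. *)
Definition dbary (v1 v2 v3 : @pt R) v : @pt R :=
  (area2 (padd v3 v) v2 v3 / area2 v1 v2 v3, area2 v1 (padd v3 v) v3 / area2 v1 v2 v3).

Lemma bary_line (v1 v2 v3 : @pt R) x v (h : R) :
  bary v1 v2 v3 (h *: v + x) =
  ((bary v1 v2 v3 x).1 + h * (dbary v1 v2 v3 v).1, (bary v1 v2 v3 x).2 + h * (dbary v1 v2 v3 v).2).
Proof.
rewrite /bary /dbary; set D := (area2 v1 v2 v3)^-1; rewrite /area2 /padd /=.
by rewrite -[_ *: v.1]/(h * v.1) -[_ *: v.2]/(h * v.2); congr (_, _); ring.
Qed.

Definition daff (l : R * R * R) (w : @pt R) : R := l.1.1 * w.1 + l.1.2 * w.2 - l.2 * (w.1 + w.2).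

Lemma aff_bary_line (v1 v2 v3 : @pt R) l x v (h : R) :
  aff l (bary v1 v2 v3 (h *: v + x)) =
  aff l (bary v1 v2 v3 x) + daff l (dbary v1 v2 v3 v) * h.
Proof. by rewrite bary_line /aff /daff /=; ring. Qed.

Lemma continuous_aff_bary (v1 v2 v3 : @pt R) l : continuous (fun x => aff l (bary v1 v2 v3 x)).
Proof.
pose a := aff l (bary v1 v2 v3 (0, 0)).
pose b := daff l (dbary v1 v2 v3 (1, 0)); pose c := daff l (dbary v1 v2 v3 (0, 1)).
have -> : (fun x => aff l (bary v1 v2 v3 x)) = fun x => a + b * x.1 + c * x.2.
  apply/funext => x; rewrite /a /b /c.
  have -> : x = x.1 *: ((1, 0) : @pt R) + (x.2 *: ((0, 1) : @pt R) + 0).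
    case: x => x1 x2; congr (_, _) => /=.
      by rewrite -[_ *: 1]/(x1 * 1) -[_ *: 0]/(x2 * 0); ring.
    by rewrite -[_ *: 0]/(x1 * 0) -[_ *: 1]/(x2 * 1); ring.
  rewrite !aff_bary_line /= -[_ *: 1]/(x.1 * 1) -[x.2 *: 0]/(x.2 * 0).
  rewrite -[_ *: 0]/(x.1 * 0) -[x.2 *: 1]/(x.2 * 1) (_ : 0 = (0, 0))//; ring.
by move=> x; apply: cvgD; [apply: cvgD|]; [exact: cvg_cst|apply: cvgM|apply: cvgM];
  try exact: cvg_cst; [exact: cvg_fst|exact: cvg_snd].
Qed.

End Barycentric.

Section SplineNearEdge.
Context (R : realType).
Implicit Types (x X v w : @pt R) (s : seq (R * (R * R * R))) (b : nat -> R).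

Definition sgrad s w X := \sum_(e <- s) e.1 * (3 * ppow 2 (aff e.2 X) * daff e.2 w).

(* The truncated powers making up the restriction of a spline to a neighbourhood
   of the edge, up to the factor [scale]. *)
Definition terms b : seq (R * (R * R * R)) :=
  flatten [seq [seq (b i * cw i * e.1, e.2) | e <- edge_terms R i] | i <- index_iota 1 29].

Lemma seval_terms b X : seval (terms b) X = \sum_(1 <= i < 29) b i * (cw i * seval (edge_terms R i) X).
Proof.
rewrite /seval /terms big_flatten big_map; apply: eq_bigr => i _.
by rewrite big_map /= big_distrr/= big_distrr/=; apply: eq_bigr => e _; rewrite !mulrA.
Qed.

Lemma sgrad_terms b w X : sgrad (terms b) w X = \sum_(1 <= i < 29) b i * (cw i * sgrad (edge_terms R i) w X).
Proof.
rewrite /sgrad /terms big_flatten big_map; apply: eq_bigr => i _.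
by rewrite big_map /= big_distrr/= big_distrr/=; apply: eq_bigr => e _; rewrite !mulrA.
Qed.

Lemma continuous_seval_bary (v1 v2 v3 : @pt R) s : continuous (fun x => seval s (bary v1 v2 v3 x)).
Proof.
elim: s => [|e s IH] x.
  rewrite (_ : (fun x => _) = cst 0); first exact: cvg_cst.
  by apply/funext => y; rewrite /seval big_nil.
rewrite (_ : (fun x => _) =
    fun y => e.1 * ppow 3 (aff e.2 (bary v1 v2 v3 y)) + seval s (bary v1 v2 v3 y)); last first.
  by apply/funext => y; rewrite /seval big_cons.
apply: cvgD; last exact: IH.
apply: cvgM; first exact: cvg_cst.
apply: (continuous_comp (@continuous_aff_bary R v1 v2 v3 e.2 x)); exact: continuous_ppow.
Qed.

Lemma continuous_sgrad_bary (v1 v2 v3 : @pt R) s w :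
  continuous (fun x => sgrad s w (bary v1 v2 v3 x)).
Proof.
elim: s => [|e s IH] x.
  rewrite (_ : (fun x => _) = cst 0); first exact: cvg_cst.
  by apply/funext => y; rewrite /sgrad big_nil.
rewrite (_ : (fun x => _) = fun y => e.1 * (3 * ppow 2 (aff e.2 (bary v1 v2 v3 y)) * daff e.2 w)
    + sgrad s w (bary v1 v2 v3 y)); last first.
  by apply/funext => y; rewrite /sgrad big_cons.
apply: cvgD; last exact: IH.
apply: cvgM; first exact: cvg_cst.
apply: cvgM; last exact: cvg_cst.
apply: cvgM; first exact: cvg_cst.
apply: (continuous_comp (@continuous_aff_bary R v1 v2 v3 e.2 x)); exact: continuous_ppow.
Qed.

Lemma is_derive_seval_bary (v1 v2 v3 : @pt R) s x v :
  is_derive x v (fun x => seval s (bary v1 v2 v3 x))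
    (sgrad s (dbary v1 v2 v3 v) (bary v1 v2 v3 x)).
Proof.
elim: s => [|e s IH].
  rewrite (_ : (fun x => _) = cst 0); last by apply/funext => y; rewrite /seval big_nil.
  by rewrite /sgrad big_nil; exact: is_derive_cst.
pose f y := e.1 * ppow 3 (aff e.2 (bary v1 v2 v3 y)).
have -> : (fun y => seval (e :: s) (bary v1 v2 v3 y)) = f + (fun y => seval s (bary v1 v2 v3 y)).
  by apply/funext => y; rewrite /seval big_cons.
set w := dbary v1 v2 v3 v in IH *.
have -> : sgrad (e :: s) w (bary v1 v2 v3 x) = e.1 * (3 * ppow 2 (aff e.2 (bary v1 v2 v3 x)) *
    daff e.2 w) + sgrad s w (bary v1 v2 v3 x) by rewrite /sgrad big_cons.
apply: is_deriveD; apply: is_derive_cvg.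
set a := aff e.2 (bary v1 v2 v3 x); set m := daff e.2 w.
have dl : is_derive (0 : R) 1 (fun t : R => a + m * t) m.
  have d := is_deriveD (is_derive_cst a (0 : R) (1 : R)) (is_deriveZ m (is_derive_id (0 : R) (1 : R))).
  by apply: is_derive_eq d _; rewrite add0r [LHS]mulr1.
have d := is_deriveZ e.1 (is_derive1_comp (@is_derive_ppow R 1 _) dl).
have {}d := cvg_is_derive d.
have E0 : a + m * 0 = a by ring.
rewrite E0 in d; apply: cvg_trans d; apply: near_eq_cvg; near=> h.
rewrite /f aff_bary_line -/a -/m.
by rewrite -[X in h^-1 * X = _]/(e.1 * ppow 3 (a + m * (h * 1 + 0)) - e.1 * ppow 3 (a + m * 0))
  E0 mulr1 addr0.
Unshelve. all: by end_near. Qed.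

Lemma otri_closure (v1 v2 v3 : @pt R) x : area2 v1 v2 v3 != 0 ->
  0 <= (bary v1 v2 v3 x).1 -> 0 <= (bary v1 v2 v3 x).2 -> 0 <= third (bary v1 v2 v3 x) ->
  ProperFilter (within (otri v1 v2 v3) (nbhs x)).
Proof.
move=> D0 h1 h2 h3; apply: within_nbhs_proper => B xB.
(* [v] points to the centroid, so [h *: v + x] is interior for [0 < h < 1]. *)
pose X := bary v1 v2 v3 x; pose v := amap v1 v2 v3 (3^-1, 3^-1) - x.
have E : dbary v1 v2 v3 v = (3^-1 - X.1, 3^-1 - X.2).
  have := bary_line v1 v2 v3 x v 1; rewrite scale1r subrK amapK// -/X !mul1r.
  by case: (dbary _ _ _ _) => d1 d2 /= [e1 e2]; congr (_, _); lra.
have lx : (fun h : R => h *: v + x) @ (0 : R)^'+ --> x.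
  apply: cvg_at_right_filter; rewrite -[X in _ --> X]add0r -(scale0r v).
  by apply: cvgD; [apply: cvgZr_tmp; exact: cvg_id|exact: cvg_cst].
have : \forall h \near (0 : R)^'+, [/\ 0 < h, h < 1 & B (h *: v + x)].
  near=> h; split; near: h; [exact: nbhs_right_gt|exact: nbhs_right_lt|exact: lx].
move=> /filter_ex[h [h0 hlt Bh]]; exists (h *: v + x); split => //.
apply/(otriP _ D0); rewrite bary_line E; move: h1 h2 h3; rewrite -/X; clearbody X; rewrite /third /= => h1 h2 h3.
have h10 : 0 <= 1 - h by lra.
have m1 := mulr_ge0 h10 h1; have m2 := mulr_ge0 h10 h2; have m3 := mulr_ge0 h10 h3.
split; lra.
Unshelve. all: by end_near. Qed.

Definition scale : R := 3 / (10 * kappa R).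

Lemma scale_gt0 : 0 < scale.
Proof. by have [_ k0] := @leb5_std5 R; rewrite divr_gt0// mulr_gt0. Qed.

Lemma aff_third X : aff (0, 0, 1) X = third X.
Proof. by rewrite /aff /third /=; ring. Qed.

Lemma V_on_edge i X : (1 <= i < 29)%N -> i \notin [:: 1; 2; 4; 7; 10; 13]%N ->
  third X = 0 -> V i X = 0.
Proof.
move=> hi ni X3.
apply/eqP; rewrite eq_le V_ge0 andbT.
by have := @V_bound_interior R i X hi ni; rewrite aff_third X3 mulr0; apply.
Qed.

(** This identifies the limits defining boundary values: through the continuous closed form for the
    six edge functions, and by squeezing between 0 and [3 * X3] for the others. *)
Lemma cvg_V_bary (v1 v2 v3 : @pt R) i x : area2 v1 v2 v3 != 0 -> (1 <= i < 29)%N ->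
  0 <= (bary v1 v2 v3 x).1 -> 0 <= (bary v1 v2 v3 x).2 -> third (bary v1 v2 v3 x) = 0 ->
  V i (bary v1 v2 v3 z) @[z --> within (otri v1 v2 v3) (nbhs x)] --> V i (bary v1 v2 v3 x).
Proof.
move=> D0 hi x1 x2 x3.
have [he|he] := boolP (i \in [:: 1; 2; 4; 7; 10; 13]%N).
  rewrite (V_edge he x1 x2); last by rewrite -[_ - _]/(third _) x3.
  have c : seval (edge_terms R i) (bary v1 v2 v3 z) @[z --> within (otri v1 v2 v3) (nbhs x)] -->
      seval (edge_terms R i) (bary v1 v2 v3 x) by apply: cvg_within_filter; exact: continuous_seval_bary.
  apply: cvg_trans c; apply: near_eq_cvg; apply: filterS (withinT _ _) => z /(otriP _ D0)[z1 z2 z3].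
  by rewrite V_edge// ltW.
rewrite (V_on_edge hi he x3).
have b0 : 3 * aff (0, 0, 1) (bary v1 v2 v3 z) @[z --> within (otri v1 v2 v3) (nbhs x)] -->
    3 * aff (0, 0, 1) (bary v1 v2 v3 x).
  apply: cvg_within_filter.
  by apply: cvgM; [exact: cvg_cst|exact: continuous_aff_bary].
rewrite aff_third x3 mulr0 in b0.
apply: (squeeze_cvgr _ (cvg_cst 0) b0); apply: filterS (withinT _ _) => z /(otriP _ D0)[z1 z2 z3].
by rewrite V_ge0 V_bound_interior// aff_third ltW.
Qed.

Lemma Bfun_bary (v1 v2 v3 : @pt R) i x : area2 v1 v2 v3 != 0 -> (1 <= i < 29)%N ->
  0 <= (bary v1 v2 v3 x).1 -> 0 <= (bary v1 v2 v3 x).2 ->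
  third (bary v1 v2 v3 x) = 0 \/
    [/\ 0 < (bary v1 v2 v3 x).1, 0 < (bary v1 v2 v3 x).2 & 0 < third (bary v1 v2 v3 x)] ->
  Bfun v1 v2 v3 i x = scale * (cw i * V i (bary v1 v2 v3 x)).
Proof.
move=> D0 hi x1 x2 x3.
have fE z : wgt v1 v2 v3 i * simplex_spline (knots (Xi v1 v2 v3 i)) z =
    scale * (cw i * V i (bary v1 v2 v3 z)).
  by rewrite -{1}(baryK D0 z) wgt_spline.
rewrite /Bfun; case: ifPn => [_|]; first exact: fE.
rewrite notin_setE => xo; case: x3 => [x3|/(otriP _ D0)//].
have PF : ProperFilter (within (otri v1 v2 v3) (nbhs x)) by apply: otri_closure; rewrite ?x3.
apply: cvg_lim => //.
rewrite (_ : (fun z => _) = fun z => scale * (cw i * V i (bary v1 v2 v3 z))); last exact/funext.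
apply: cvgM; first exact: cvg_cst.
apply: cvgM; first exact: cvg_cst.
exact: cvg_V_bary.
Qed.

Lemma spline_bary (v1 v2 v3 : @pt R) b x : area2 v1 v2 v3 != 0 ->
  let X := bary v1 v2 v3 x in
  0 <= third X -> 8 * third X < X.1 -> 8 * third X < X.2 ->
  spline v1 v2 v3 b x = scale * seval (terms b) X.
Proof.
move=> D0 X X3 h1 h2.
rewrite /spline seval_terms big_distrr/=; apply: eq_big_nat => i hi.
have X1 : 0 < X.1 by lra.
have X2 : 0 < X.2 by lra.
rewrite Bfun_bary -/X//; [|exact: ltW|exact: ltW|].
  by rewrite V_near_edge// mulrCA.
by move: X3; rewrite le_eqVlt => /predU1P[<-|]; [left|right].
Qed.

Lemma spline_edge (v1 v2 v3 : @pt R) b t : area2 v1 v2 v3 != 0 -> 0 <= t <= 1 ->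
  spline v1 v2 v3 b (comb2 (1 - t) v1 t v2) =
  scale * \sum_(i <- [:: 1; 2; 4; 7; 10; 13]%N) b i * (cw i * seval (edge_terms R i) (1 - t, t)).
Proof.
move=> D0 /andP[t0 t1].
have X3 : third (1 - t, t) = 0 by rewrite /third /=; ring.
have X1 : 0 <= 1 - t by lra.
rewrite /spline big_distrr /= [LHS](bigID (mem [:: 1; 2; 4; 7; 10; 13]%N)) /=.
rewrite [X in _ + X]big1_seq ?addr0; last first.
  move=> i /andP[ni]; rewrite mem_index_iota => hi.
  by rewrite Bfun_bary// bary_edge ?X3//; [rewrite V_on_edge// !mulr0|left].
rewrite -big_filter (_ : seq.filter _ _ = [:: 1; 2; 4; 7; 10; 13]%N)//; apply: eq_big_seq => i hi.
have hi' : (1 <= i < 29)%N.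
  by apply: (allP (_ : all (fun i => 1 <= i < 29)%N [:: 1; 2; 4; 7; 10; 13]%N)).
rewrite Bfun_bary// bary_edge ?X3//; last by left.
rewrite V_edge//; last by rewrite -[_ - _]/(third (1 - t, t)) X3.
exact: mulrCA.
Qed.

End SplineNearEdge.

(** * Values and gradients on the common edge *)

Ltac ppow2_sign := repeat match goal with |- context [ppow 2 ?x] =>
  first [rewrite (@ppow_ge _ 2 x); [|lra] | rewrite (@ppow_le _ 1 x); [|lra]] end.

Section EdgeGradient.
Context (R : realType).
Implicit Types (w : @pt R) (t : R).

Lemma aff_edge (l : R * R * R) t : aff l (1 - t, t) = l.1.1 * (1 - t) + l.1.2 * t.
Proof. by rewrite /aff /=; ring. Qed.

(* Up to the weight [cw i], the transversal derivative along the edge of the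
   basis function i. *)
Definition nrm (i : nat) t : R := sgrad (edge_terms R i) (-1, 0) (1 - t, t).

(** On the open edge the forms in [edge_terms] change sign only at 1/3 and 2/3, the parameters of
    [v31] and [v32]; on each piece the powers are plain polynomials. *)
Lemma edge_cases t : 0 <= t <= 1 -> [\/ 0 <= t <= 3^-1, 3^-1 <= t <= 2 / 3 | 2 / 3 <= t <= 1].
Proof.
move=> /andP[t0 t1]; have [h|h] := leP t 3^-1; first by constructor 1; rewrite t0.
by have [h'|h'] := leP t (2 / 3); [constructor 2; rewrite ltW|constructor 3; rewrite ltW].
Qed.

Ltac edge_tac := move=> /edge_cases[] /andP[t0 t1];
  rewrite /nrm /sgrad !big_cons !big_nil !aff_edge /daff /=; ppow2_sign; rewrite ?expr2; lra.

(** These functions vanish on the edge to first order, so their coefficients do not enter (ii). *)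
Lemma sgrad_edge0 i w t : i \in [:: 11; 12; 20; 21; 22; 23; 24; 25; 26; 27; 28]%N ->
  0 <= t <= 1 -> sgrad (edge_terms R i) w (1 - t, t) = 0.
Proof.
rewrite !inE; do 10?[case/orP]; move/eqP ->; edge_tac.
Qed.

(** A function that is zero along the edge has no tangential derivative; only the third barycentric
    component [- (w.1 + w.2)] of the direction counts. *)
Lemma sgrad_edge1 i w t : i \in [:: 5; 6; 16; 17; 19]%N ->
  0 <= t <= 1 -> sgrad (edge_terms R i) w (1 - t, t) = - (w.1 + w.2) * nrm i t.
Proof.
rewrite !inE; do 4?[case/orP]; move/eqP ->; edge_tac.
Qed.

(** Here and in the next five lemmas the derivative of an edge function is expanded in the five
    transversal derivatives. The factors of [w.1] and [w.2] reappear in (ii) as those of [eta1] and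
    [eta2]; in particular 3/5 and 2/5 come from the functions 10 and 13. *)
Lemma sgrad_edge_1 w t : 0 <= t <= 1 ->
  cw 1 * sgrad (edge_terms R 1) w (1 - t, t) = w.1 * (cw 5 * nrm 5 t).
Proof. rewrite /cw /=; edge_tac. Qed.

Lemma sgrad_edge_4 w t : 0 <= t <= 1 -> cw 4 * sgrad (edge_terms R 4) w (1 - t, t) =
  w.2 * (cw 5 * nrm 5 t) + (w.1 + w.2 / 2) * (cw 16 * nrm 16 t).
Proof. rewrite /cw /=; edge_tac. Qed.

Lemma sgrad_edge_10 w t : 0 <= t <= 1 -> cw 10 * sgrad (edge_terms R 10) w (1 - t, t) =
  w.2 / 2 * (cw 16 * nrm 16 t) + (3 / 5 * w.1 + 2 / 5 * w.2) * (cw 19 * nrm 19 t).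
Proof. rewrite /cw /=; edge_tac. Qed.

Lemma sgrad_edge_13 w t : 0 <= t <= 1 -> cw 13 * sgrad (edge_terms R 13) w (1 - t, t) =
  w.1 / 2 * (cw 17 * nrm 17 t) + (3 / 5 * w.2 + 2 / 5 * w.1) * (cw 19 * nrm 19 t).
Proof. rewrite /cw /=; edge_tac. Qed.

Lemma sgrad_edge_7 w t : 0 <= t <= 1 -> cw 7 * sgrad (edge_terms R 7) w (1 - t, t) =
  w.1 * (cw 6 * nrm 6 t) + (w.2 + w.1 / 2) * (cw 17 * nrm 17 t).
Proof. rewrite /cw /=; edge_tac. Qed.

Lemma sgrad_edge_2 w t : 0 <= t <= 1 ->
  cw 2 * sgrad (edge_terms R 2) w (1 - t, t) = w.2 * (cw 6 * nrm 6 t).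
Proof. rewrite /cw /=; edge_tac. Qed.

End EdgeGradient.

Ltac ppow3_sign := repeat match goal with |- context [ppow 3 ?x] =>
  first [rewrite (@ppow_ge _ 3 x); [|lra] | rewrite (@ppow_le _ 2 x); [|lra]] end.

(** * Linear independence on the edge and the jump of the gradient *)

Section Independence.
Context (R : realType).
Implicit Types (w : @pt R) (t : R).

Ltac edge_val t := match goal with h : forall _, _ |- _ => have := h t ltac:(lra) end;
  clear;
  rewrite !big_cons !big_nil /cw /seval /= !big_cons !big_nil !aff_edge /=; ppow3_sign;
  rewrite ?exprS ?expr0; lra.

(** Sampling at six points. The ends isolate [d 1] and [d 2]; the other four values give an
    invertible system for the rest. *)
Lemma edge_values_indep (d : nat -> R) :
  (forall t, 0 <= t <= 1 ->
    \sum_(i <- [:: 1; 2; 4; 7; 10; 13]%N) d i * (cw i * seval (edge_terms R i) (1 - t, t)) = 0) ->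
  forall i, i \in [:: 1; 2; 4; 7; 10; 13]%N -> d i = 0.
Proof.
move=> h.
have E0 : 1/36 * d 1%N = 0 by edge_val (0 : R).
have E1 : 1/288 * d 1%N + 19/1152 * d 4%N + 25/3456 * d 10%N + 1/1728 * d 13%N = 0.
  by edge_val (6^-1 : R).
have E2 : 1/144 * d 4%N + 7/432 * d 10%N + 1/216 * d 13%N = 0 by edge_val (3^-1 : R).
have E3 : 1/144 * d 7%N + 1/216 * d 10%N + 7/432 * d 13%N = 0 by edge_val (2/3 : R).
have E4 : 1/288 * d 2%N + 19/1152 * d 7%N + 1/1728 * d 10%N + 25/3456 * d 13%N = 0.
  by edge_val (5/6 : R).
have E5 : 1/36 * d 2%N = 0 by edge_val (1 : R).
have z1 : d 1%N = 0 by move: E0; clear; lra.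
have z2 : d 2%N = 0 by move: E5; clear; lra.
rewrite z1 z2 in E1 E4; clear h E0 E5; move=> i; rewrite !inE => /or4P[/eqP->|/eqP->|/eqP->|/or3P[]/eqP->]; lra.
Qed.

Definition normal_form (d : nat -> R) t : R :=
  \sum_(i <- [:: 5; 16; 19; 17; 6]%N) d i * (cw i * nrm i t).

Ltac edge_val' t := match goal with h : forall _, _ |- _ => have := h t ltac:(lra) end;
  clear;
  rewrite /normal_form /nrm /sgrad !big_cons !big_nil /cw !aff_edge /daff /=;
  ppow2_sign; rewrite ?expr2; lra.

(** All five sample points are interior, since a $C^1$ join gives information on the open edge
    only. *)
Lemma normal_form_indep (d : nat -> R) : (forall t, 0 < t < 1 -> normal_form d t = 0) ->
  forall i, i \in [:: 5; 16; 19; 17; 6]%N -> d i = 0.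
Proof.
move=> h.
have E1 : 1/16 * d 5%N + 5/32 * d 16%N + 5/96 * d 19%N = 0 by edge_val' (6^-1 : R).
have E2 : 1/8 * d 16%N + 5/24 * d 19%N = 0 by edge_val' (3^-1 : R).
have E3 : 1/32 * d 16%N + 5/16 * d 19%N + 1/32 * d 17%N = 0 by edge_val' (2^-1 : R).
have E4 : 5/24 * d 19%N + 1/8 * d 17%N = 0 by edge_val' (2/3 : R).
have E5 : 5/96 * d 19%N + 5/32 * d 17%N + 1/16 * d 6%N = 0 by edge_val' (5/6 : R).
move=> i; rewrite !inE => /or4P[/eqP->|/eqP->|/eqP->|/orP[]/eqP->]; lra.
Qed.

Lemma sgrad_terms_edge (b : nat -> R) w t : 0 <= t <= 1 ->
  let N i := cw i * nrm i t in
  sgrad (terms b) w (1 - t, t) =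
    b 1%N * (w.1 * N 5%N) + b 2%N * (w.2 * N 6%N)
  + b 4%N * (w.2 * N 5%N + (w.1 + w.2 / 2) * N 16%N)
  + b 7%N * (w.1 * N 6%N + (w.2 + w.1 / 2) * N 17%N)
  + b 10%N * (w.2 / 2 * N 16%N + (3 / 5 * w.1 + 2 / 5 * w.2) * N 19%N)
  + b 13%N * (w.1 / 2 * N 17%N + (3 / 5 * w.2 + 2 / 5 * w.1) * N 19%N)
  - (w.1 + w.2) * (b 5%N * N 5%N + b 6%N * N 6%N + b 16%N * N 16%N + b 17%N * N 17%N + b 19%N * N 19%N).
Proof.
move=> ht N; pose M i := cw i * sgrad (edge_terms R i) w (1 - t, t).
have Z i : i \in [:: 3; 8; 9; 14; 15; 18]%N -> M i = 0.
  by rewrite /M !inE; do 5?[case/orP]; move/eqP ->; rewrite /sgrad big_nil mulr0.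
have Z0 i : i \in [:: 11; 12; 20; 21; 22; 23; 24; 25; 26; 27; 28]%N -> M i = 0.
  by move=> hi; rewrite /M sgrad_edge0 ?mulr0.
have Z1 i : i \in [:: 5; 6; 16; 17; 19]%N -> M i = - (w.1 + w.2) * N i.
  by move=> hi; rewrite /M sgrad_edge1// mulrCA.
have M1 : M 1%N = _ := sgrad_edge_1 w ht; have M2 : M 2%N = _ := sgrad_edge_2 w ht.
have M4 : M 4%N = _ := sgrad_edge_4 w ht; have M7 : M 7%N = _ := sgrad_edge_7 w ht.
have M10 : M 10%N = _ := sgrad_edge_10 w ht; have M13 : M 13%N = _ := sgrad_edge_13 w ht.
rewrite sgrad_terms; transitivity (\sum_(1 <= i < 29) b i * M i); first by [].
(* With [M] and [N] opaque, unlocking the big operator unfolds it into an explicit sum of 28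
   terms. *)
rewrite -!/(N _) in M1 M2 M4 M7 M10 M13; clearbody M N; rewrite unlock /=.
rewrite M1 M2 M4 M7 M10 M13 (Z 3%N isT) (Z 8%N isT) (Z 9%N isT) (Z 14%N isT) (Z 15%N isT) (Z 18%N isT).
rewrite (Z0 11%N isT) (Z0 12%N isT) (Z0 20%N isT) (Z0 21%N isT) (Z0 22%N isT) (Z0 23%N isT) (Z0 24%N isT)
  (Z0 25%N isT) (Z0 26%N isT) (Z0 27%N isT) (Z0 28%N isT).
by rewrite (Z1 5%N isT) (Z1 6%N isT) (Z1 16%N isT) (Z1 17%N isT) (Z1 19%N isT); ring.
Qed.

(** [wL] and [wR] describe one direction in the two triangles, with third components [eta3 * c] and
    [c]. Since the edge coefficients agree, the parts linear in [wR] cancel and every surviving term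
    is a multiple of [c]. *)
Lemma sgrad_jump (bL bR : nat -> R) (eta1 eta2 eta3 : R) wL wR t :
  0 <= t <= 1 -> eta1 + eta2 + eta3 = 1 ->
  (forall i, i \in [:: 1; 2; 4; 7; 10; 13]%N -> bR i = bL i) ->
  let c := - (wR.1 + wR.2) in
  wL = (wR.1 + eta1 * c, wR.2 + eta2 * c) ->
  sgrad (terms bL) wL (1 - t, t) - sgrad (terms bR) wR (1 - t, t) =
  c * normal_form (fun i => match i with
   | 5 => eta1 * bL 1%N + eta2 * bL 4%N + eta3 * bL 5%N - bR 5%N
   | 16 => (eta1 + eta2 / 2) * bL 4%N + eta2 / 2 * bL 10%N + eta3 * bL 16%N - bR 16%N
   | 19 => (3 / 5 * eta1 + 2 / 5 * eta2) * bL 10%N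
               + (2 / 5 * eta1 + 3 / 5 * eta2) * bL 13%N + eta3 * bL 19%N - bR 19%N
   | 17 => (eta1 / 2 + eta2) * bL 7%N + eta1 / 2 * bL 13%N + eta3 * bL 17%N - bR 17%N
   | _ => eta1 * bL 7%N + eta2 * bL 2%N + eta3 * bL 6%N - bR 6%N
   end) t.
Proof.
move=> ht e3 hb c ->; rewrite !sgrad_terms_edge//= /c.
rewrite (hb 1%N isT) (hb 2%N isT) (hb 4%N isT) (hb 7%N isT) (hb 10%N isT) (hb 13%N isT).
rewrite /normal_form !big_cons big_nil.
by move/(canRL (addKr _)): e3 => ->; rewrite /cw /=; field.
Qed.

End Independence.

(** * Gluing along the common edge *)

Section Piecewise.
Context (R : realType) (V : normedModType R).
Implicit Types (f g : V -> R) (P : V -> bool).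

(** Both difference quotients tend to [d], so it does not matter how the branches alternate near
    [z]. *)
Lemma is_derive_if P f g (z v : V) (d : R) : f z = g z ->
  is_derive z v f d -> is_derive z v g d -> is_derive z v (fun x => if P x then f x else g x) d.
Proof.
move=> fg df dg; apply: is_derive_cvg; apply/cvgrPdist_lt => e e0.
have /cvgrPdist_lt/(_ _ e0) hf := cvg_is_derive df.
have /cvgrPdist_lt/(_ _ e0) hg := cvg_is_derive dg.
have -> : (if P z then f z else g z) = f z by case: ifP.
near=> h; case: ifP => _; last rewrite fg; by near: h.
Unshelve. all: by end_near. Qed.

Lemma continuous_if P f g (z : V) : f z = g z ->
  {for z, continuous f} -> {for z, continuous g} ->
  {for z, continuous (fun x => if P x then f x else g x)}.
Proof.
move=> fg cf cg; apply/cvgrPdist_lt => e e0.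
have /cvgrPdist_lt/(_ _ e0) hf := cf; have /cvgrPdist_lt/(_ _ e0) hg := cg.
have -> : (if P z then f z else g z) = f z by case: ifP.
near=> h; case: ifP => _; last rewrite fg; by near: h.
Unshelve. all: by end_near. Qed.

(** With [F] one-sided, this reads off the derivative of the glued function from one triangle
    alone. *)
Lemma derive_along (F : set_system R) f g (z v : V) (d d' : R) : ProperFilter F ->
  0^' `<=` F -> f z = g z -> (\forall h \near F, f (h *: v + z) = g (h *: v + z)) ->
  is_derive z v f d -> is_derive z v g d' -> d = d'.
Proof.
move=> PF sub fg near_fg df dg.
have hf : (fun h : R => h^-1 * (f (h *: v + z) - f z)) @ F --> d.
  by move=> A /(cvg_is_derive df) /sub.
have hg : (fun h : R => h^-1 * (g (h *: v + z) - g z)) @ F --> d'.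
  by move=> A /(cvg_is_derive dg) /sub.
apply: (@cvg_unique _ (@Rhausdorff R) _ _ _ _ hf); apply: cvg_trans hg; apply: near_eq_cvg; near=> h.
by rewrite fg; congr (_ * (_ - _)); apply/esym; near: h.
Unshelve. all: by end_near. Qed.

End Piecewise.

(** * Geometry around the open edge *)

Section Wedge.
Context (R : realType).
Implicit Types (x X v : @pt R).

(* A neighbourhood of the open edge in the plane, on one side of which the spline
   is given by [terms]; the slope 8 is not critical. *)
Definition wedge (v1 v2 v3 : @pt R) : set (@pt R) :=
  [set x | [/\ 0 < aff (1, 0, 0) (bary v1 v2 v3 x), 0 < aff (0, 1, 0) (bary v1 v2 v3 x),
               0 < aff (1, 0, -8) (bary v1 v2 v3 x) & 0 < aff (0, 1, -8) (bary v1 v2 v3 x)]].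

Lemma open_wedge (v1 v2 v3 : @pt R) : open (wedge v1 v2 v3).
Proof.
have H l : open [set x | 0 < aff l (bary v1 v2 v3 x)].
  apply: (open_comp (f := fun x => aff l (bary v1 v2 v3 x)) (D := [set y | 0 < y])).
    by move=> x _; exact: continuous_aff_bary.
  exact: open_gt.
have := openI (openI (H (1, 0, 0)) (H (0, 1, 0))) (openI (H (1, 0, -8)) (H (0, 1, -8))).
by congr open; apply/seteqP; split => [x [[? ?] [? ?]]|x [? ? ? ?]].
Qed.

Lemma wedgeP (v1 v2 v3 : @pt R) x : let X := bary v1 v2 v3 x in
  wedge v1 v2 v3 x <-> [/\ 0 < X.1, 0 < X.2, 8 * third X < X.1 & 8 * third X < X.2].
Proof.
move=> X; rewrite /wedge /= -/X /aff /third /=.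
by split=> -[h1 h2 h3 h4]; split; lra.
Qed.

Lemma wedge_tri (v1 v2 v3 : @pt R) x : area2 v1 v2 v3 != 0 -> wedge v1 v2 v3 x ->
  tri v1 v2 v3 x <-> 0 <= third (bary v1 v2 v3 x).
Proof.
move=> D0 /wedgeP[h1 h2 _ _]; split=> [/(triP _ D0)[]//|h3].
by apply/(triP _ D0); split => //; exact: ltW.
Qed.

Lemma spline_wedge (v1 v2 v3 : @pt R) b x : area2 v1 v2 v3 != 0 -> wedge v1 v2 v3 x ->
  0 <= third (bary v1 v2 v3 x) ->
  spline v1 v2 v3 b x = scale R * seval (terms b) (bary v1 v2 v3 x).
Proof. by move=> D0 /wedgeP[_ _ h1 h2] h3; exact: spline_bary. Qed.

Lemma wedge_edge (v1 v2 v3 : @pt R) t : area2 v1 v2 v3 != 0 -> 0 < t < 1 ->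
  wedge v1 v2 v3 (comb2 (1 - t) v1 t v2).
Proof.
move=> D0 /andP[t0 t1]; apply/wedgeP; rewrite bary_edge// /third /=.
by split; lra.
Qed.

Lemma bary_change (p1 p2 p3 p4 : @pt R) eta1 eta2 eta3 x :
  area2 p1 p2 p3 != 0 -> area2 p1 p2 p4 != 0 -> eta1 + eta2 + eta3 = 1 ->
  p4 = comb3 eta1 p1 eta2 p2 eta3 p3 ->
  let X := bary p1 p2 p4 x in
  bary p1 p2 p3 x = (X.1 + eta1 * third X, X.2 + eta2 * third X).
Proof.
move=> D0 D0' e3 p4E X; rewrite -{1}(baryK D0' x) -/X.
rewrite -[RHS](amapK D0); congr bary.
have e3E : eta3 = 1 - eta1 - eta2 by lra.
clearbody X; rewrite p4E e3E /amap /third /comb3 /comb2 /padd /pscale /=.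
by congr (_, _); ring.
Qed.

Lemma bary0_dbary (v1 v2 v3 : @pt R) v :
  dbary v1 v2 v3 v =
  ((bary v1 v2 v3 v).1 - (bary v1 v2 v3 0).1, (bary v1 v2 v3 v).2 - (bary v1 v2 v3 0).2).
Proof.
have := bary_line v1 v2 v3 0 v 1; rewrite scale1r addr0 !mul1r => ->.
by rewrite [LHS]surjective_pairing /=; congr (_, _); ring.
Qed.

Lemma dbary_change (p1 p2 p3 p4 : @pt R) eta1 eta2 eta3 v :
  area2 p1 p2 p3 != 0 -> area2 p1 p2 p4 != 0 -> eta1 + eta2 + eta3 = 1 ->
  p4 = comb3 eta1 p1 eta2 p2 eta3 p3 ->
  let w := dbary p1 p2 p4 v in
  dbary p1 p2 p3 v = (w.1 + eta1 * - (w.1 + w.2), w.2 + eta2 * - (w.1 + w.2)).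
Proof.
move=> D0 D0' e3 p4E w; rewrite /w !bary0_dbary.
rewrite !(bary_change _ D0 D0' e3 p4E) /third /=.
by congr (_, _); ring.
Qed.

Lemma third_line (v1 v2 v3 : @pt R) x v (h : R) : third (bary v1 v2 v3 (h *: v + x)) =
  third (bary v1 v2 v3 x) - h * ((dbary v1 v2 v3 v).1 + (dbary v1 v2 v3 v).2).
Proof. by rewrite bary_line /third /=; ring. Qed.

(** [C1_on] tests the coordinate directions only, and the edge cannot be parallel to both axes. *)
Lemma transversal_axis (v1 v2 v3 : @pt R) : area2 v1 v2 v3 != 0 ->
  exists v : @pt R, (v = (1, 0) \/ v = (0, 1)) /\
    (dbary v1 v2 v3 v).1 + (dbary v1 v2 v3 v).2 != 0.
Proof.
move=> D0.
have E v : (dbary v1 v2 v3 v).1 + (dbary v1 v2 v3 v).2 =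
    ((v2.2 - v1.2) * v.1 - (v2.1 - v1.1) * v.2) / area2 v1 v2 v3.
  by rewrite /dbary /= -mulrDl; congr (_ / _); rewrite /area2 /padd /=; ring.
have [h|h] := eqVneq (v2.2 - v1.2) 0; last first.
  by exists (1, 0); split; [left|rewrite E /= mulr1 mulr0 subr0 mulf_neq0// invr_eq0].
have [h'|h'] := eqVneq (v2.1 - v1.1) 0; last first.
  exists (0, 1); split; [by right|].
  by rewrite E /= mulr1 mulr0 sub0r mulf_neq0 ?oppr_eq0// invr_eq0.
by move: D0; rewrite /area2 h h' mul0r mulr0 subrr eqxx.
Qed.

Lemma tri_area_area2 (v1 v2 v3 : @pt R) : 0 < tri_area v1 v2 v3 -> area2 v1 v2 v3 != 0.
Proof.
rewrite /tri_area -[`|_ - _|]/(`|area2 v1 v2 v3|); apply: contraTneq => ->.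
by rewrite normr0 mul0r ltxx.
Qed.

Lemma opposite_sides (p1 p2 p3 p4 : @pt R) eta1 eta2 eta3 :
  area2 p1 p2 p3 != 0 -> area2 p1 p2 p4 != 0 -> eta1 + eta2 + eta3 = 1 ->
  p4 = comb3 eta1 p1 eta2 p2 eta3 p3 ->
  otri p1 p2 p3 `&` otri p1 p2 p4 = set0 -> eta3 < 0.
Proof.
move=> D0 D0' e3 p4E dis.
have dtE : area2 p1 p2 p4 = eta3 * area2 p1 p2 p3.
  have e3E : eta3 = 1 - eta1 - eta2 by lra.
  by rewrite p4E e3E /area2 /comb3 /comb2 /padd /pscale /=; ring.
rewrite ltNge; apply/negP; rewrite le_eqVlt => /predU1P[e0|e0].
  by move: D0'; rewrite dtE -e0 mul0r eqxx.
(* For [eta3 > 0] the point at height [e] above the midpoint of the edge would lie in both open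
   triangles; [e] is small enough that the shifts [e * eta1] and [e * eta2] keep its left
   coordinates positive. *)
pose e := (4 * (1 + `|eta1| + `|eta2|))^-1.
have k0 : 0 < 4 * (1 + `|eta1| + `|eta2|).
  by rewrite mulr_gt0// ltr_wpDr// ltr_wpDr.
have eK : e * (4 * (1 + `|eta1| + `|eta2|)) = 1 by rewrite mulVf// gt_eqF.
have ep : 0 < e by rewrite invr_gt0.
have n1 : 0 <= e * (eta1 + `|eta1|).
  by apply: mulr_ge0; [exact: ltW|have := ler_norm (- eta1); rewrite normrN; lra].
have n2 : 0 <= e * (eta2 + `|eta2|).
  by apply: mulr_ge0; [exact: ltW|have := ler_norm (- eta2); rewrite normrN; lra].
have m1 : 0 <= e * `|eta1| by apply: mulr_ge0; [exact: ltW|].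
have m2 : 0 <= e * `|eta2| by apply: mulr_ge0; [exact: ltW|].
have m3 : 0 < e * eta3 by rewrite mulr_gt0.
have X3 : third ((1 - e) / 2, (1 - e) / 2) = e by rewrite /third /=; field.
suff : (otri p1 p2 p3 `&` otri p1 p2 p4) (amap p1 p2 p4 ((1 - e) / 2, (1 - e) / 2)) by rewrite dis.
split.
  apply/(otriP _ D0); rewrite (bary_change _ D0 D0' e3 p4E) amapK// X3 /third /=.
  have e3E : eta3 = 1 - eta1 - eta2 by lra.
  by rewrite e3E in m3; split; lra.
by apply/(otriP _ D0'); rewrite amapK// X3 /=; split => //; lra.
Qed.

End Wedge.

Section Gluing.
Context (R : realType) (p1 p2 p3 p4 : @pt R) (eta1 eta2 eta3 : R) (bL bR : nat -> R).
Hypotheses (D0 : area2 p1 p2 p3 != 0) (D0' : area2 p1 p2 p4 != 0).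
Hypotheses (e3 : eta1 + eta2 + eta3 = 1) (p4E : p4 = comb3 eta1 p1 eta2 p2 eta3 p3).
Hypothesis eta3_lt0 : eta3 < 0.

Let sL := spline p1 p2 p3 bL.
Let sR := spline p1 p2 p4 bR.
Let XL := bary p1 p2 p3.
Let XR := bary p1 p2 p4.
Let fL x := scale R * seval (terms bL) (XL x).
Let fR x := scale R * seval (terms bR) (XR x).
Let gL v x := scale R * sgrad (terms bL) (dbary p1 p2 p3 v) (XL x).
Let gR v x := scale R * sgrad (terms bR) (dbary p1 p2 p4 v) (XR x).
Let U := wedge p1 p2 p3 `&` wedge p1 p2 p4.

Lemma join_C0P : join_C0 sL sR p1 p2 <->
  forall i, i \in [:: 1; 2; 4; 7; 10; 13]%N -> bR i = bL i.
Proof.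
split=> [h i hi|h x [t [t01 ->]]]; last first.
  by rewrite /sL /sR !spline_edge//; congr (_ * _); apply: eq_big_seq => i /h ->.
apply/eqP; rewrite -subr_eq0; apply/eqP.
apply: (@edge_values_indep R (fun i => bR i - bL i)) hi => t t01.
have := h _ (ex_intro _ t (conj t01 erefl)).
rewrite /sL /sR !spline_edge// => /(mulfI (lt0r_neq0 (scale_gt0 R))) eLR.
rewrite -[RHS](subrr (\sum_(i <- [:: 1; 2; 4; 7; 10; 13]%N)
  bL i * (cw i * seval (edge_terms R i) (1 - t, t)))) {1}eLR -sumrB.
by apply: eq_bigr => j _; rewrite mulrBl.
Qed.

Lemma third_change x : third (XL x) = eta3 * third (XR x).
Proof.
rewrite /XL /XR (bary_change x D0 D0' e3 p4E) /third /=.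
have -> : eta3 = 1 - eta1 - eta2 by rewrite -e3; ring.
by ring.
Qed.

Lemma is_derive_fL v x : is_derive x v fL (gL v x).
Proof. by apply: is_deriveZ; exact: is_derive_seval_bary. Qed.

Lemma is_derive_fR v x : is_derive x v fR (gR v x).
Proof. by apply: is_deriveZ; exact: is_derive_seval_bary. Qed.

Lemma continuous_gL v : continuous (gL v).
Proof. by move=> x; apply: cvgM; [exact: cvg_cst|exact: continuous_sgrad_bary]. Qed.

Lemma continuous_gR v : continuous (gR v).
Proof. by move=> x; apply: cvgM; [exact: cvg_cst|exact: continuous_sgrad_bary]. Qed.

Lemma continuous_third : continuous (fun x => third (XL x)).
Proof.
rewrite (_ : (fun x => _) = fun x => aff (0, 0, 1) (XL x)); first exact: continuous_aff_bary.
by apply/funext => x; rewrite aff_third.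
Qed.

Lemma glue_wedge x : U x ->
  Defs.glue sL sR p1 p2 p3 x = if 0 <= third (XL x) then fL x else fR x.
Proof.
move=> [UL UR]; rewrite /Defs.glue; have [h|h] := leP 0 (third (XL x)).
  rewrite ifT ?inE; last by apply/(wedge_tri D0 UL).
  exact: spline_wedge.
rewrite ifF; last first.
  by apply/negbTE; rewrite notin_setE => /(wedge_tri D0 UL); rewrite leNgt h.
(* As [eta3 < 0], a point of the wedges outside the left triangle is on the right side of the
   edge. *)
apply: spline_wedge => //; move: h; rewrite third_change nmulr_rlt0// => /ltW.
exact.
Qed.

Lemma edge_point x : U x -> third (XL x) = 0 ->
  exists t, [/\ 0 < t < 1, x = comb2 (1 - t) p1 t p2, XL x = (1 - t, t) & XR x = (1 - t, t)].
Proof.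
move=> [/wedgeP[h1 h2 _ _] _] X3; exists (XL x).2.
have X1 : (XL x).1 = 1 - (XL x).2 by move: X3; rewrite /third; lra.
have xE : x = comb2 (1 - (XL x).2) p1 (XL x).2 p2.
  rewrite -[LHS](baryK D0) -/(XL x) /amap -/(third (XL x)) X3 X1.
  by rewrite /comb3 /comb2 /padd /pscale /=; congr (_, _); ring.
split => //; first by move: h1; rewrite -/(XL x) X1; lra.
  by rewrite [LHS]surjective_pairing X1.
by rewrite {1}xE /XR bary_edge.
Qed.

Lemma values_edge x : join_C0 sL sR p1 p2 -> U x -> third (XL x) = 0 -> fL x = fR x.
Proof.
move=> h Ux X3; have [UL UR] := Ux; have [t [t01 xE _ _]] := edge_point Ux X3.
have X3' : third (XR x) = 0.
  by apply/eqP; move/eqP: X3; rewrite third_change mulf_eq0 lt_eqF.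
have fLE : sL x = fL x by apply: (spline_wedge bL D0 UL); rewrite -/(XL x) X3.
have fRE : sR x = fR x by apply: (spline_wedge bR D0' UR); rewrite -/(XR x) X3'.
rewrite -fLE -fRE.
apply: h; exists t; split => //; by case/andP: t01 => /ltW -> /ltW ->.
Qed.

(** Right-hand side minus left-hand side of the five equations in (ii); the default case stands for
    index 6. *)
Definition defect (i : nat) : R := match i with
  | 5 => eta1 * bL 1%N + eta2 * bL 4%N + eta3 * bL 5%N - bR 5%N
  | 16 => (eta1 + eta2 / 2) * bL 4%N + eta2 / 2 * bL 10%N + eta3 * bL 16%N - bR 16%N
  | 19 => (3 / 5 * eta1 + 2 / 5 * eta2) * bL 10%N
            + (2 / 5 * eta1 + 3 / 5 * eta2) * bL 13%N + eta3 * bL 19%N - bR 19%N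
  | 17 => (eta1 / 2 + eta2) * bL 7%N + eta1 / 2 * bL 13%N + eta3 * bL 17%N - bR 17%N
  | _ => eta1 * bL 7%N + eta2 * bL 2%N + eta3 * bL 6%N - bR 6%N
  end.

Lemma gradient_jump v x t : join_C0 sL sR p1 p2 -> XL x = (1 - t, t) -> XR x = (1 - t, t) ->
  0 <= t <= 1 ->
  gL v x - gR v x =
  scale R * (- ((dbary p1 p2 p4 v).1 + (dbary p1 p2 p4 v).2) * normal_form defect t).
Proof.
move=> /join_C0P hb xl xr t01; rewrite /gL /gR xl xr -mulrBr; congr (_ * _).
exact: (sgrad_jump t01 e3 hb (dbary_change v D0 D0' e3 p4E)).
Qed.

Lemma join_C1_defect : join_C1 sL sR p1 p2 p3 p4 ->
  forall i, i \in [:: 5; 16; 19; 17; 6]%N -> defect i = 0.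
Proof.
move=> [h0 [W [oW [_ [eW C1]]]]]; apply: normal_form_indep => t t01.
have t01' : 0 <= t <= 1 by case/andP: t01 => /ltW -> /ltW ->.
pose z := comb2 (1 - t) p1 t p2.
have Uz : U z by split; exact: wedge_edge.
have zl : XL z = (1 - t, t) by exact: bary_edge.
have zr : XR z = (1 - t, t) by exact: bary_edge.
have X3 : third (XL z) = 0 by rewrite zl /third /=; ring.
have [v [vE c0]] := transversal_axis D0'.
set c := _ + _ in c0.
have [dz _] := C1 z (eW _ (ex_intro _ t (conj t01 erefl))) v vE.
have line0 : (fun h : R => h *: v + z) @ 0 --> z.
  rewrite -[X in _ --> X]add0r -(scale0r v).
  by apply: cvgD; [apply: cvgZr_tmp; exact: cvg_id|exact: cvg_cst].
have nU : \forall h \near 0, U (h *: v + z).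
  apply: line0; apply: open_nbhs_nbhs; split => //.
  by apply: openI; exact: open_wedge.
have dG : is_derive z v (Defs.glue sL sR p1 p2 p3) ('D_v (Defs.glue sL sR p1 p2 p3) z).
  exact: DeriveDef.
have Gz : Defs.glue sL sR p1 p2 p3 z = fL z by rewrite glue_wedge// X3 lexx.
have Gz' : Defs.glue sL sR p1 p2 p3 z = fR z by rewrite Gz (values_edge h0 Uz X3).
(* The line through [z] crosses the edge transversally, so small [h] of one sign lie in one triangle
   and those of the other sign in the other. *)
have lineX h : third (XL (h *: v + z)) = - eta3 * c * h.
  rewrite third_change /XR third_line -/XR zr /c /third /=; ring.
have eq_side (F : set_system R) : ProperFilter F -> 0^' `<=` F ->
    (\forall h \near F, 0 < - eta3 * c * h) -> 'D_v (Defs.glue sL sR p1 p2 p3) z = gL v z.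
  move=> PF sub side; apply: (derive_along PF sub Gz _ dG (is_derive_fL v z)).
  near=> h; rewrite glue_wedge; last by near: h; apply: sub; apply: filterS nU.
  by rewrite lineX ltW//; near: h.
have eq_side' (F : set_system R) : ProperFilter F -> 0^' `<=` F ->
    (\forall h \near F, - eta3 * c * h < 0) -> 'D_v (Defs.glue sL sR p1 p2 p3) z = gR v z.
  move=> PF sub side; apply: (derive_along PF sub Gz' _ dG (is_derive_fR v z)).
  near=> h; rewrite glue_wedge; last by near: h; apply: sub; apply: filterS nU.
  by rewrite lineX leNgt ifF//; apply/negbTE; rewrite negbK; near: h.
have subr : 0^' `<=` (0 : R)^'+.
  by move=> A [e e0 he]; exists e => // y ye y0; apply: he => //; exact: lt0r_neq0.
have subl : 0^' `<=` (0 : R)^'-.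
  by move=> A [e e0 he]; exists e => // y ye y0; apply: he => //; exact: ltr0_neq0.
(* The derivative of the glued function equals both one-sided gradients; the sign of [- eta3 * c]
   decides which one-sided filter belongs to which triangle. *)
have gg : gL v z = gR v z.
  have [k0|k0|k0] := ltrgtP 0 (- eta3 * c).
  - rewrite -(eq_side (0^'+)) -?(eq_side' (0^'-))//.
    + by near=> h; rewrite pmulr_rlt0//; near: h; exact: nbhs_left_lt.
    + by near=> h; rewrite pmulr_rgt0//; near: h; exact: nbhs_right_gt.
  - rewrite -(eq_side (0^'-)) -?(eq_side' (0^'+))//.
    + by near=> h; rewrite nmulr_rlt0//; near: h; exact: nbhs_right_gt.
    + by near=> h; rewrite nmulr_rgt0//; near: h; exact: nbhs_left_lt.
  - by move/eqP: k0; rewrite eq_sym mulf_eq0 oppr_eq0 (negbTE c0) lt_eqF.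
(* The jump is [scale * - c] times the normal form of the defects, and both factors are nonzero. *)
have c0' : - c != 0 by rewrite oppr_eq0.
apply: (mulfI c0'); apply: (mulfI (lt0r_neq0 (scale_gt0 R))).
by rewrite -(gradient_jump v h0 zl zr t01') gg subrr !mulr0.
Unshelve. all: by end_near. Qed.

Lemma defect_join_C1 : join_C0 sL sR p1 p2 ->
  (forall i, i \in [:: 5; 16; 19; 17; 6]%N -> defect i = 0) -> join_C1 sL sR p1 p2 p3 p4.
Proof.
move=> h0 hd; split => //; exists U; split; first by apply: openI; exact: open_wedge.
split.
  move=> x [UL UR]; have [h|h] := leP 0 (third (XL x)).
    by left; apply/(wedge_tri D0 UL).
  right; apply/(wedge_tri D0' UR); move: h; rewrite third_change nmulr_rlt0// => /ltW.
  exact.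
split; first by move=> _ [t [t01 ->]]; split; exact: wedge_edge.
have nU z : U z -> \forall x \near z, U x.
  by move=> Uz; apply: open_nbhs_nbhs; split => //; apply: openI; exact: open_wedge.
have npos z : 0 < third (XL z) -> \forall x \near z, 0 <= third (XL x).
  by move=> h; near=> x; apply: ltW; near: x; apply: cvgr_gt h; exact: continuous_third.
have nneg z : third (XL z) < 0 -> \forall x \near z, (0 <= third (XL x)) = false.
  move=> h; near=> x; apply/negbTE; rewrite -ltNge; near: x.
  by apply: cvgr_lt h; exact: continuous_third.
have gE v z : U z -> third (XL z) = 0 -> gL v z = gR v z.
  move=> Uz X3; have [t [/andP[t0 t1] _ zl zr]] := edge_point Uz X3.
  apply/eqP; rewrite -subr_eq0 (gradient_jump v h0 zl zr) ?ltW//.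
  rewrite /normal_form big1_seq ?mulr0// => i /andP[_ /hd ->].
  by rewrite mul0r.
(* The candidate derivative. Off the edge one branch applies in a neighbourhood; on the edge
   [values_edge] and [gE] make the two branches agree to first order. *)
pose G v x := if 0 <= third (XL x) then gL v x else gR v x.
have dG v z : U z -> is_derive z v (Defs.glue sL sR p1 p2 p3) (G v z).
  move=> Uz.
  apply: (near_eq_is_derive (f := fun x => if 0 <= third (XL x) then fL x else fR x)).
    by near=> x; rewrite glue_wedge//; near: x; exact: nU.
  rewrite /G; have [h|h|h] := ltrgtP 0 (third (XL z)).
  - apply: (near_eq_is_derive (f := fL)); last exact: is_derive_fL.
    by near=> x; rewrite ifT//; near: x; exact: npos.
  - apply: (near_eq_is_derive (f := fR)); last exact: is_derive_fR.
    by near=> x; rewrite ifF//; near: x; exact: nneg.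
  - apply: is_derive_if; first exact: values_edge.
      exact: is_derive_fL.
    by rewrite gE//; exact: is_derive_fR.
have cG v z : U z -> {for z, continuous (G v)}.
  move=> Uz; have [h|h|h] := ltrgtP 0 (third (XL z)).
  - have Gz : G v z = gL v z by rewrite /G ltW.
    rewrite /prop_for /continuous_at Gz; apply: cvg_trans (@continuous_gL v z).
    by rewrite /G; apply: near_eq_cvg; near=> x; rewrite ifT//; near: x; exact: npos.
  - have Gz : G v z = gR v z by rewrite /G leNgt h.
    rewrite /prop_for /continuous_at Gz; apply: cvg_trans (@continuous_gR v z).
    by rewrite /G; apply: near_eq_cvg; near=> x; rewrite ifF//; near: x; exact: nneg.
  - apply: continuous_if; [exact: gE|exact: continuous_gL|exact: continuous_gR].
move=> z Uz v _; split; first by have [] := dG v z Uz.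
rewrite /prop_for /continuous_at (@derive_val _ _ _ _ _ _ _ (dG v z Uz)).
apply: cvg_trans (cG v z Uz); apply: near_eq_cvg; near=> x.
have Ux : U x by near: x; exact: nU.
by rewrite (@derive_val _ _ _ _ _ _ _ (dG v x Ux)).
Unshelve. all: by end_near. Qed.

End Gluing.

Unset Implicit Arguments.

Theorem theorem4p1 (R : realType) (p1 p2 p3 p4 : @pt R)
  (eta1 eta2 eta3 : R) (bL bR : nat -> R) :
  0 < tri_area p1 p2 p3 ->
  0 < tri_area p1 p2 p4 ->
  otri p1 p2 p3 `&` otri p1 p2 p4 = set0 ->
  eta1 + eta2 + eta3 = 1 ->
  p4 = comb3 eta1 p1 eta2 p2 eta3 p3 ->
  let sL := spline p1 p2 p3 bL in
  let sR := spline p1 p2 p4 bR in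
  (join_C0 sL sR p1 p2 <->
     (forall i : nat, i \in [:: 1; 2; 4; 7; 10; 13]%N -> bR i = bL i)) /\
  (join_C1 sL sR p1 p2 p3 p4 <->
     join_C0 sL sR p1 p2 /\
     bR 5%N = eta1 * bL 1%N + eta2 * bL 4%N + eta3 * bL 5%N /\
     bR 16%N = (eta1 + eta2 / 2) * bL 4%N + eta2 / 2 * bL 10%N + eta3 * bL 16%N /\
     bR 19%N = (3 / 5 * eta1 + 2 / 5 * eta2) * bL 10%N
               + (2 / 5 * eta1 + 3 / 5 * eta2) * bL 13%N + eta3 * bL 19%N /\
     bR 17%N = (eta1 / 2 + eta2) * bL 7%N + eta1 / 2 * bL 13%N + eta3 * bL 17%N /\
     bR 6%N = eta1 * bL 7%N + eta2 * bL 2%N + eta3 * bL 6%N).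
Proof.
move=> /tri_area_area2 D0 /tri_area_area2 D0' dis e3 p4E sL sR.
have n3 := opposite_sides D0 D0' e3 p4E dis.
split; first exact: join_C0P.
split=> [h|[h0 [h5 [h16 [h19 [h17 h6]]]]]].
  have d := join_C1_defect D0 D0' e3 p4E n3 h.
  split; first by case: h.
  do 4?split; apply/esym/eqP; rewrite -subr_eq0; apply/eqP.
  - exact: (d 5%N).
  - exact: (d 16%N).
  - exact: (d 19%N).
  - exact: (d 17%N).
  - exact: (d 6%N).
apply: (defect_join_C1 D0 D0' e3 p4E n3 h0) => i.
by rewrite !inE => /or4P[/eqP->|/eqP->|/eqP->|/orP[]/eqP->];
  rewrite /defect ?h5 ?h16 ?h19 ?h17 ?h6 subrr.
Qed.
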